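(* The space $\mathrm{Diff}_{\mathrm{c}}(D^2,\omega)$ of area-preserving diffeomorphisms of $D^2$ with compact support in the interior $\mathrm{Int}(D^2)$ has $\{\mathrm{id}_{D^2}\}$ as a strong deformation retract.
   Context: $D^2$ is the closed unit disc with polar coordinates $(r,\theta)$ and area form $\omega=2r\,\mathrm{d}r\wedge\mathrm{d}\theta$. A diffeomorphism has compact support in $\mathrm{Int}(D^2)$ if it is the identity on some neighbourhood of $\partial D^2$. The space carries the $C^\infty$-topology. A strong deformation retraction to $\{\mathrm{id}_{D^2}\}$ is a homotopy $F_s$, $s\in[0,1]$, of self-maps of the space with $F_0$ the identity map, $F_1$ the constant map to $\mathrm{id}_{D^2}$, and $F_s(\mathrm{id}_{D^2})=\mathrm{id}_{D^2}$ for all $s$. *)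

(* Defs.v *)
From mathcomp Require Import all_boot all_order all_algebra.
From mathcomp Require Import all_classical all_reals all_analysis.

Set Implicit Arguments.
Unset Strict Implicit.
Unset Printing Implicit Defensive.

Import Order.TTheory GRing.Theory Num.Theory.
Import numFieldNormedType.Exports.

Local Open Scope classical_set_scope.
Local Open Scope ring_scope.

Notation plane R := (R * R)%type.

Definition disc (R : realType) : set (plane R) :=
  [set p | p.1 ^+ 2 + p.2 ^+ 2 <= 1].
Arguments disc R : clear implicits.

Definition disc_boundary (R : realType) : set (plane R) :=
  [set p | p.1 ^+ 2 + p.2 ^+ 2 = 1].
Arguments disc_boundary R : clear implicits.

Definition coord_vec (R : realType) (i : 'I_2) : plane R :=
  if i == ord0 then (1, 0) else (0, 1).

(* [partial [:: i1; ...; ik] F] is the iterated partial derivative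
   d_i1 (d_i2 (... (d_ik F))). *)
Definition partial (R : realType) (s : seq 'I_2) (F : plane R -> plane R) :
    plane R -> plane R :=
  foldr (fun i G => 'D_(coord_vec R i) G) F s.

(* A map on a subset of the plane is smooth when it extends to a map that is
   infinitely differentiable on an open neighbourhood of that subset. *)
Definition smooth (R : realType) (A : set (plane R)) (f : A -> plane R) :=
  exists U : set (plane R), exists F : plane R -> plane R,
    [/\ open U, A `<=` U,
        forall s p, U p -> differentiable (partial s F) p
      & forall p : A, F (set_val p) = f p].

Definition diffeo (R : realType) (A : set (plane R)) (f : A -> A) :=
  exists g : A -> A, [/\ cancel f g, cancel g f,
    smooth (fun p => set_val (f p)) & smooth (fun p => set_val (g p))].

Definition compactly_supported (R : realType) (f : disc R -> disc R) :=
  exists U : set (plane R), [/\ open U, disc_boundary R `<=` U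
    & forall p : disc R, U (set_val p) -> f p = p].

(* Extension by the identity outside of the disc. When f is smooth and
   compactly supported, so is its extension, whose derivatives at the points of
   the closed disc are those of f. *)
Definition ext_id (R : realType) (f : disc R -> disc R) (p : plane R) :
    plane R :=
  if pselect (disc R p) is left dp then set_val (f (SigSub (mem_set dp)))
  else p.

(* The form omega = 2 r dr /\ dtheta = 2 dx /\ dy evaluated on two tangent
   vectors; its Cartesian coefficients do not depend on the base point. *)
Definition area_form (R : realType) (u v : plane R) : R :=
  2 * (u.1 * v.2 - u.2 * v.1).

(* Evaluation on the polar coordinate frame d/dr, d/dtheta *)
Lemma area_form_polar (R : realType) (r t : R) :
  area_form (cos t, sin t) (- r * sin t, r * cos t) = 2 * r.
Proof.
rewrite /area_form /=; congr (_ * _).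
by rewrite mulrCA mulrCA !mulNr mulrN opprK !(mulrCA _ r) -mulrDr
  -!expr2 cos2Dsin2 mulr1.
Qed.

(* f^* omega = omega, the differential of f being that of its extension *)
Definition area_preserving (R : realType) (f : disc R -> disc R) :=
  forall p, disc R p -> forall u v : plane R,
    area_form ('d (ext_id f) p u) ('d (ext_id f) p v) = area_form u v.

Definition area_diff_set (R : realType) : set (disc R -> disc R) :=
  [set f | [/\ diffeo f, compactly_supported f & area_preserving f]].
Arguments area_diff_set R : clear implicits.

(* All the partial derivatives of f on the closed disc; the target is the
   product, over all iterated partial derivatives, of the spaces of functions on
   the disc with the topology of uniform convergence. *)
Definition jets (R : realType) (f : area_diff_set R) :
    {ptws seq 'I_2 -> {uniform disc R -> plane R}} :=
  fun s p => partial s (ext_id (set_val f)) (set_val p).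

(* Diff_c(D^2, omega) with the C^oo topology *)
Definition Diffc (R : realType) : topologicalType :=
  initial_topology (@jets R).

Section Identity.
Variable R : realType.

Lemma ext_id_id : ext_id (@id (disc R)) = id.
Proof. by apply/funext => p; rewrite /ext_id; case: pselect. Qed.

Lemma partial_cst (s : seq 'I_2) (c : plane R) :
  exists d, partial s (cst c) = cst d.
Proof.
elim: s => [|i s [d IH]]; first by exists c.
exists 0; rewrite /partial /= -/(partial s (cst c)) IH.
by apply/funext => p; rewrite derive_val.
Qed.

Lemma differentiable_partial_id (s : seq 'I_2) (p : plane R) :
  differentiable (partial s id) p.
Proof.
case/lastP: s => [|s i]; first exact: ex_diff.
rewrite /partial foldr_rcons.
have -> : 'D_(coord_vec R i) (@id (plane R)) = cst (coord_vec R i).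
  by apply/funext => q; rewrite deriveE ?diff_val.
by have [d] := partial_cst s (coord_vec R i); rewrite /partial => ->;
  exact: differentiable_cst.
Qed.

Lemma id_area_diff : area_diff_set R id.
Proof.
have smooth_id : smooth (fun p : disc R => set_val p).
  exists setT, id; split => //; first exact: openT.
  by move=> s p _; exact: differentiable_partial_id.
split.
- by exists id; split.
- by exists setT; split => //; exact: openT.
- by move=> p _ u v; rewrite ext_id_id diff_val.
Qed.

Definition id_Diffc : Diffc R := SigSub (mem_set id_area_diff).

End Identity.
Arguments id_Diffc R : clear implicits.

(* The homotopy F is only constrained for times in [0, 1]. *)
Definition strong_deformation_retract (R : realType) (X : topologicalType)
    (A : set X) :=
  exists F : R -> X -> X,
    [/\ {within `[0%R, 1%R] `*` [set: X],
          continuous (fun sx : R * X => F sx.1 sx.2)},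
        forall x, F 0 x = x,
        forall x, A (F 1 x)
      & forall s a, s \in `[0%R, 1%R] -> A a -> F s a = a].
Arguments strong_deformation_retract R {X} A.

(* Main.v *)
(** An area-preserving f = (u, v), equal to the identity outside of the disc, is
    determined by the vector field V = (- u_y, u_x), which f sends to the
    vertical unit field.  V has no zero and is vertical outside of the disc, so
    that it has a continuous angle b with the vertical which vanishes there;
    rotating V back by s b, 0 <= s <= 1, joins it, through nowhere zero fields
    W_s that are vertical outside of the disc, to a vertical field.

    An orbit of W_s never stays in a half-plane y <= const: it would come back
    close to itself, and comparing the angles of the secants of the first such
    return gives a contradiction.  Hence the orbits issued from the line y = -1
    sweep the plane and form a chart.  After replacing the time by the area swept
    the chart preserves the area, but the orbit of (c, -1) leaves the box
    [-1, 1]^2 along the vertical line of abscissa h(c) instead of c.  An explicit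
    area-preserving map of the region above the box undoes this, and one obtains
    compactly supported area-preserving maps G_s with G_0 = f^-1 and G_1 = id,
    and G_s = id for all s if f = id.

    The support of G_s leaves the disc; a conjugation by dilations, whose ratio
    is increased before the isotopy starts, brings it back.  Taking inverses, one
    gets the contraction.  All the constructions depend on f through families of
    functions whose partial derivatives of all orders are jointly continuous in f
    and in the point, and this is continuity for the C^oo topology. *)
Require Import Defs.
From HB Require Import structures.
From mathcomp Require Import all_boot all_order all_algebra.
From mathcomp Require Import all_classical all_reals all_analysis.
From mathcomp Require Import ring lra.

Set Implicit Arguments.
Unset Strict Implicit.
Unset Printing Implicit Defensive.

Import Order.TTheory GRing.Theory Num.Theory.
Import numFieldNormedType.Exports.

Local Open Scope classical_set_scope.
Local Open Scope ring_scope.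

(** * Derivatives in one variable *)

(** For 0 < s < 1 the rotated field W_s is in general not divergence free, so its orbits alone give
    no area-preserving chart. Two defects have to be removed. The time is one, and the swept area
    repairs it. The other is found above the box: the exit abscissa [h(c)] differs from [c], and the
    swept area is affine in the height, with slope [h'(c)] and an intercept depending on [c]. The
    correction stays in the strip [|x| <= 1] because this intercept has integral 0 over [-1, 1]. At
    s = 0 both defects vanish, as f carries V to the vertical unit field; at s = 1 the orbits are
    vertical and the swept area is the height.

    The height reached by the correction is bounded only by a continuous function of s and f, whence
    the dilations; their ratio grows while the map is still f^-1, whose support is in the disc.

    Diffeomorphisms enter as points of a mere topological space. Smoothness is therefore taken in
    the plane variables only, jointly continuous in the parameter, and every construction is a
    quadrature, a flow or an inversion, operations that respect this class. Uniformity in the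
    parameter is drawn from compactness. *)

Definition drv (R : realType) (f : R -> R) (x l : R) : Prop :=
  is_derive (x : R^o) 1 (f : R^o -> R^o) l.

Section OneVariable.
Variable R : realType.
Implicit Types (f g : R -> R) (x y a b c l : R).

Lemma drv_eq f x l l' : drv f x l -> l = l' -> drv f x l'.
Proof. by move=> + <-. Qed.

Lemma drv_uniq f x l l' : drv f x l -> drv f x l' -> l = l'.
Proof. by rewrite /drv => -[_ <-] [_ <-]. Qed.

Lemma drvC c x : drv (fun=> c) x 0.
Proof. exact: is_derive_cst. Qed.

Lemma drvI x : drv (fun t => t) x 1.
Proof. exact: is_derive_id. Qed.

Lemma drvD f g x a b : drv f x a -> drv g x b -> drv (fun t => f t + g t) x (a + b).
Proof. by rewrite /drv => fa gb; exact: is_deriveD. Qed.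

Lemma drvN f x a : drv f x a -> drv (fun t => - f t) x (- a).
Proof. by rewrite /drv => fa; exact: is_deriveN. Qed.

Lemma drvB f g x a b : drv f x a -> drv g x b -> drv (fun t => f t - g t) x (a - b).
Proof. by move=> fa gb; apply: drvD => //; exact: drvN. Qed.

Lemma drvM f g x a b : drv f x a -> drv g x b ->
  drv (fun t => f t * g t) x (a * g x + f x * b).
Proof.
move=> fa gb; have H : drv (fun t => f t * g t) x (f x *: b + g x *: a) by move: fa gb; rewrite /drv => fa gb; exact: is_deriveM.
apply: drv_eq H _.
by rewrite /GRing.scale /= addrC (mulrC a).
Qed.

Lemma drvZ f x a c : drv f x a -> drv (fun t => c * f t) x (c * a).
Proof.
by move=> fa; apply: drv_eq (drvM (drvC c x) fa) _; rewrite mul0r add0r.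
Qed.

Lemma drv_comp f g x a b : drv f (g x) a -> drv g x b ->
  drv (fun t => f (g t)) x (a * b).
Proof. by rewrite /drv => fa gb; exact: is_derive1_comp. Qed.

Lemma drvV f x a : f x != 0 -> drv f x a ->
  drv (fun t => (f t)^-1) x (- a * (f x)^-1 * (f x)^-1).
Proof.
move=> f0 fa.
have H : drv (fun t => (f t)^-1) x (- (f x) ^- 2 *: a).
  by move: fa; rewrite /drv => fa; exact: is_deriveV.
apply: drv_eq H _.
by rewrite /GRing.scale /= expr2 invfM !mulNr; congr (- _); rewrite mulrC mulrA.
Qed.

Lemma drv_cont f x a : drv f x a -> {for x, continuous f}.
Proof.
by move=> [fa _]; exact/differentiable_continuous/derivable1_diffP.
Qed.

Lemma drv_continuous f (df : R -> R) :
  (forall x, drv f x (df x)) -> continuous f.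
Proof. by move=> fdf x; exact: drv_cont (fdf x). Qed.

Lemma near_drv f g x a : (\forall t \near x, f t = g t) -> drv f x a -> drv g x a.
Proof. by move=> fg; rewrite /drv => fa; apply: near_eq_is_derive fa; rewrite ?oner_neq0. Qed.

Lemma drvE f x : derivable f x 1 -> drv f x (derive1 f x).
Proof. by rewrite derive1E /drv; exact: derivableP. Qed.

Lemma drv1E f x a : drv f x a -> derive1 f x = a.
Proof. by rewrite derive1E => -[_ ->]. Qed.

Lemma drv_within f (df : R -> R) a b : (forall x, a <= x <= b -> drv f x (df x)) ->
  {within `[a, b], continuous f}.
Proof.
move=> fdf; apply: derivable_within_continuous => x.
by rewrite in_itv /= => /fdf[].
Qed.

Lemma mvt f (df : R -> R) a b : a <= b ->
  (forall x, a <= x <= b -> drv f x (df x)) ->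
  exists2 c, a <= c <= b & f b - f a = df c * (b - a).
Proof.
move=> ab fdf.
have fdf' x : x \in `]a, b[%R -> drv f x (df x).
  by rewrite in_itv /= => /andP[/ltW ax /ltW xb]; apply: fdf; rewrite ax.
have [c] := MVT_segment ab fdf' (drv_within fdf).
by rewrite in_itv /=; exists c.
Qed.

Lemma mvt_abs f (df : R -> R) a b :
  (forall x, drv f x (df x)) ->
  exists2 c, `|c - a| <= `|b - a| & f b - f a = df c * (b - a).
Proof.
move=> fdf; have [ab|/ltW ba] := leP a b.
  have [c /andP[ac cb] e] := mvt ab (fun x _ => fdf x); exists c => //.
  by rewrite !ger0_norm ?subr_ge0// lerD2r.
have [c /andP[ac cb] e] := mvt ba (fun x _ => fdf x); exists c.
  by rewrite !ler0_norm ?subr_le0// lerN2 lerD2r.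
by rewrite -(opprB (f a)) e -mulrN opprB.
Qed.

Lemma le_drv f (df : R -> R) a b : a <= b ->
  (forall x, a <= x <= b -> drv f x (df x)) ->
  (forall x, a <= x <= b -> 0 <= df x) -> f a <= f b.
Proof.
move=> ab fdf df0; have [c cab e] := mvt ab fdf.
by rewrite -subr_ge0 e mulr_ge0 ?df0// subr_ge0.
Qed.

Lemma lt_drv f (df : R -> R) a b : a < b ->
  (forall x, a <= x <= b -> drv f x (df x)) ->
  (forall x, a <= x <= b -> 0 < df x) -> f a < f b.
Proof.
move=> ab fdf df0; have [c cab e] := mvt (ltW ab) fdf.
by rewrite -subr_gt0 e mulr_gt0 ?df0// subr_gt0.
Qed.

Lemma drv0_cst f : (forall x, drv f x 0) -> forall x y, f x = f y.
Proof. by move=> f0 x y; exact: is_derive_0_is_cst. Qed.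

Lemma drv0_cst_in f a b : a <= b -> (forall x, a <= x <= b -> drv f x 0) -> f a = f b.
Proof.
move=> ab f0; have [c _] := mvt ab f0.
by rewrite mul0r => /eqP; rewrite subr_eq0 => /eqP ->.
Qed.

(** Turns an estimate of increments into a derivative; most derivatives established by hand below
    come through here, with the division by [h] done once. *)
Lemma drv_quot f x l :
  (forall e, 0 < e -> \forall h \near 0^', `|(f (x + h) - f x) - h * l| <= e * `|h|) ->
  drv f x l.
Proof.
move=> fl.
have fcv : h^-1 *: (f (h *: (1 : R^o) + x) - f x) @[h --> 0^'] --> l.
  apply/cvgrPdist_le => e e0; near=> h.
  have h0 : h != 0 by near: h; exact: nbhs_dnbhs_neq.
  rewrite -(ler_pM2r (_ : 0 < `|h|)) ?normr_gt0// -normrM.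
  rewrite (_ : (_ - _) * h = - ((f (x + h) - f x) - h * l)).
    by rewrite normrN; near: h; exact: fl.
  by rewrite /GRing.scale /= mulr1 (addrC h); field.
constructor; first by apply: cvgP fcv.
exact: cvg_lim fcv.
Unshelve. all: by end_near. Qed.

Lemma drv_approx f x l : drv f x l -> forall e, 0 < e ->
  \forall h \near 0, `|(f (x + h) - f x) - h * l| <= e * `|h|.
Proof.
move=> [dfx <-] e e0.
have := dfx; rewrite /derivable => /cvgrPdist_le /(_ e e0) => H.
have {}H : \forall h \near 0^', `|(f (x + h) - f x) - h * 'D_1 f x| <= e * `|h|.
  near=> h.
  have h0 : h != 0 by near: h; exact: nbhs_dnbhs_neq.
  rewrite (_ : _ - _ = - (('D_1 f x - h^-1 *: (f (h *: (1 : R^o) + x) - f x)) * h)).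
    rewrite normrN normrM ler_pM2r ?normr_gt0//.
    by near: h; exact: H.
  by rewrite /GRing.scale /= mulr1 (addrC h); field.
move: H; rewrite /dnbhs near_withinE; apply: filterS => h.
have [-> _|h0 ->//] := eqVneq h 0.
by rewrite addr0 subrr mul0r subrr normr0 mulr0.
Unshelve. all: by end_near. Qed.

End OneVariable.

Lemma continuous_pair_at (Z U V : topologicalType) (b : Z -> U) (c : Z -> V) (z : Z) :
  {for z, continuous b} -> {for z, continuous c} ->
  {for z, continuous (fun z => (b z, c z))}.
Proof. by move=> bc cc; exact: (cvg_pair bc cc). Qed.

Section Pointwise.
Variables (R : realType) (Z : topologicalType) (f g : Z -> R) (z : Z).

Lemma atD : {for z, continuous f} -> {for z, continuous g} ->
  {for z, continuous (fun z => f z + g z)}.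
Proof. by move=> fc gc; exact: continuousD. Qed.

Lemma atM : {for z, continuous f} -> {for z, continuous g} ->
  {for z, continuous (fun z => f z * g z)}.
Proof. by move=> fc gc; exact: continuousM. Qed.

Lemma atN : {for z, continuous f} -> {for z, continuous (fun z => - f z)}.
Proof. by move=> fc; exact: continuousN. Qed.

Lemma at_fun (h : R -> R) : continuous h -> {for z, continuous f} ->
  {for z, continuous (fun z => h (f z))}.
Proof. by move=> hc fc; apply: continuous_comp fc _; exact: hc. Qed.

End Pointwise.

(** * Uniformity over compact sets and the chain rule in two variables *)

Section Tube.
Variable R : realType.

Lemma near_plane (g : R -> R -> R) (x0 y0 : R) :
  {for (x0, y0), continuous (fun p : R * R => g p.1 p.2)} ->
  forall e, 0 < e -> exists2 d, 0 < d & forall x y,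
    `|x - x0| < d -> `|y - y0| < d -> `|g x y - g x0 y0| < e.
Proof.
move=> gc e e0; move/cvgrPdist_lt : gc => /(_ e e0) /nbhs_ballP [d d0 dP].
exists d => // x y xd yd; rewrite distrC; apply: (dP (x, y)).
by split; rewrite /= /ball /= distrC.
Qed.

(** Tube lemma: joint continuity along [{m0} x K] becomes closeness on all of [K] at once. As [M]
    has no metric, this is the usual source of uniformity in the parameter. *)
Lemma compact_tube (M Y : topologicalType) (K : set Y) (a : M -> Y -> R) (m0 : M) :
  compact K ->
  (forall y, K y -> {for (m0, y), continuous (fun q : M * Y => a q.1 q.2)}) ->
  forall e, 0 < e ->
  \forall m \near m0, forall y, K y -> `|a m y - a m0 y| < e.
Proof.
move=> /compact_near_coveringP cK ac e e0.
apply: (cK M (nbhs m0) (fun m y => `|a m y - a m0 y| < e)) => y Ky.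
have e2 : 0 < e / 2 by rewrite divr_gt0.
have /cvgrPdist_lt /(_ _ e2) := ac y Ky.
move=> [[U V]] /= [Um Vy] UV.
exists (V, U) => //= -[y' m] /= [Vy' Um'].
rewrite (_ : _ - _ = (a m0 y - a m0 y') - (a m0 y - a m y')); last by ring.
apply: le_lt_trans (ler_normB _ _) _; rewrite [e]splitr ltrD//.
  by apply: (UV (m0, y')); split => //=; exact: nbhs_singleton.
exact: (UV (m, y')).
Qed.

Lemma segment_tube (M : topologicalType) (a : M -> R -> R) (m0 : M) (A B : R) :
  (forall y, A <= y <= B -> {for (m0, y), continuous (fun q : M * R => a q.1 q.2)}) ->
  forall e, 0 < e ->
  \forall m \near m0, forall y, A <= y <= B -> `|a m y - a m0 y| < e.
Proof.
move=> ac e e0.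
have := @compact_tube M R `[A, B] a m0 (@segment_compact R A B) _ e e0.
have H y : `[A, B]%classic y -> {for (m0, y), continuous (fun q : M * R => a q.1 q.2)}.
  by rewrite /= in_itv /=; exact: ac.
by move=> /(_ H); apply: filterS => m mP y yAB; apply: mP; rewrite /= in_itv.
Qed.

(** The increment is split at [(x0, y0 + k)] and the mean value theorem is applied on each leg; the
    intermediate points tend to the base point, where the partials are continuous. *)
Lemma linear_approximation (g gx gy : R -> R -> R) (x0 y0 : R) :
  (forall x y : R, drv (fun s => g s y) x (gx x y)) ->
  (forall x y : R, drv (g x) y (gy x y)) ->
  {for (x0, y0), continuous (fun p : R * R => gx p.1 p.2)} ->
  {for (x0, y0), continuous (fun p : R * R => gy p.1 p.2)} ->
  forall e, 0 < e -> exists2 d, 0 < d & forall h k, `|h| < d -> `|k| < d ->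
    `|g (x0 + h) (y0 + k) - g x0 y0 - (h * gx x0 y0 + k * gy x0 y0)|
      <= e * (`|h| + `|k|).
Proof.
move=> ggx ggy cx cy e e0.
have [d1 d10 H1] := near_plane cx e0; have [d2 d20 H2] := near_plane cy e0.
exists (Num.min d1 d2) => [|h k]; first by rewrite lt_min d10.
rewrite !lt_min => /andP[h1 h2] /andP[k1 k2].
have [c ch ec] := mvt_abs x0 (x0 + h) (fun x => ggx x (y0 + k)).
have [c' ck ec'] := mvt_abs y0 (y0 + k) (ggy x0).
have eh : x0 + h - x0 = h by ring.
have ek : y0 + k - y0 = k by ring.
rewrite eh in ch ec; rewrite ek in ck ec'.
rewrite (_ : _ - _ = h * (gx c (y0 + k) - gx x0 y0) + k * (gy x0 c' - gy x0 y0)).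
  apply: le_trans (ler_normD _ _) _; rewrite !normrM mulrDr ![e * _]mulrC.
  apply: lerD; apply: ler_wpM2l => //; apply: ltW.
    by apply: H1; [exact: le_lt_trans h1|rewrite addrAC subrr add0r].
  by apply: H2; [rewrite subrr normr0|exact: le_lt_trans k2].
have -> : g (x0 + h) (y0 + k) = g x0 (y0 + k) + gx c (y0 + k) * h.
  by rewrite -ec; ring.
have -> : g x0 (y0 + k) = g x0 y0 + gy x0 c' * k by rewrite -ec'; ring.
by ring.
Qed.

Lemma drv_locally_lipschitz (f : R -> R) (x l : R) : drv f x l ->
  \forall h \near (0 : R), `|f (x + h) - f x| <= (`|l| + 1) * `|h|.
Proof.
move=> fl; apply: filterS (drv_approx fl ltr01) => h H.
rewrite -[f (x + h) - f x](subrK (h * l)); apply: le_trans (ler_normD _ _) _.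
by rewrite mulrDl addrC lerD// normrM mulrC.
Qed.

Lemma drv_comp2 (g gx gy : R -> R -> R) (b c : R -> R) (t b' c' : R) :
  (forall x y : R, drv (fun s => g s y) x (gx x y)) ->
  (forall x y : R, drv (g x) y (gy x y)) ->
  {for (b t, c t), continuous (fun p : R * R => gx p.1 p.2)} ->
  {for (b t, c t), continuous (fun p : R * R => gy p.1 p.2)} ->
  drv b t b' -> drv c t c' ->
  drv (fun s => g (b s) (c s)) t (gx (b t) (c t) * b' + gy (b t) (c t) * c').
Proof.
move=> ggx ggy cx cy bb' cc'; apply: drv_quot => e e0.
set X := gx _ _; set Y := gy _ _.
(* [M] and [N] serve the two halves of the error: the increments of [b] and [c] add up to at most
   [M * |h|], and the first-order errors of [b] and [c] enter with total weight [|X| + |Y| < N]. *)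
set M := `|b'| + 1 + (`|c'| + 1).
have M0 : 0 < M by rewrite /M addr_gt0// ltr_wpDl.
have e1 : 0 < e / 2 / M by rewrite !divr_gt0.
have [d d0 H] := linear_approximation ggx ggy cx cy e1.
set N := `|X| + `|Y| + 1.
have N0 : 0 < N by rewrite /N ltr_wpDl// addr_ge0.
have e2 : 0 < e / 2 / N by rewrite !divr_gt0.
rewrite /dnbhs near_withinE; near=> h => _.
have Hb : `|b (t + h) - b t| <= (`|b'| + 1) * `|h| by near: h; exact: drv_locally_lipschitz.
have Hc : `|c (t + h) - c t| <= (`|c'| + 1) * `|h| by near: h; exact: drv_locally_lipschitz.
have Hb' : `|b (t + h) - b t - h * b'| <= e / 2 / N * `|h|.
  by near: h; exact: drv_approx.
have Hc' : `|c (t + h) - c t - h * c'| <= e / 2 / N * `|h|.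
  by near: h; exact: drv_approx.
have hd : `|h| < d / M.
  near: h; apply/nbhs_ballP; exists (d / M); rewrite /= ?divr_gt0// => z.
  by rewrite /ball /= sub0r normrN.
have HhM : M * `|h| < d by rewrite mulrC -ltr_pdivlMr.
have hMb : (`|b'| + 1) * `|h| <= M * `|h|.
  by rewrite ler_wpM2r// lerDl addr_ge0.
have hMc : (`|c'| + 1) * `|h| <= M * `|h|.
  by rewrite ler_wpM2r// lerDr addr_ge0.
have := H (b (t + h) - b t) (c (t + h) - c t).
rewrite !subrKC => /(_ (le_lt_trans (le_trans Hb hMb) HhM)
  (le_lt_trans (le_trans Hc hMc) HhM)).
set kb := b (t + h) - b t in Hb Hb' *; set kc := c (t + h) - c t in Hc Hc' *.
move=> HH.
rewrite (_ : _ - _ = (g (b (t + h)) (c (t + h)) - g (b t) (c t) - (kb * X + kc * Y))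
  + ((kb - h * b') * X + (kc - h * c') * Y)); last by ring.
apply: le_trans (ler_normD _ _) _.
rewrite [leRHS](_ : _ = e / 2 * `|h| + e / 2 * `|h|); last by field.
apply: lerD.
  apply: le_trans HH _.
  rewrite -mulrA ler_pM2l ?divr_gt0// mulrC ler_pdivrMr// mulrC.
  by apply: le_trans (lerD Hb Hc) _; rewrite -mulrDl.
apply: le_trans (ler_normD _ _) _; rewrite !normrM.
apply: (@le_trans _ _ (e / 2 / N * `|h| * (`|X| + `|Y|))).
  by rewrite mulrDr lerD// ler_wpM2r.
rewrite [leRHS](_ : _ = e / 2 / N * `|h| * N); last by field; rewrite gt_eqF.
by apply: ler_wpM2l; [exact: (mulr_ge0 (ltW e2))|rewrite /N lerDl].
Unshelve. all: by end_near. Qed.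

End Tube.

(** * Smooth functions of the plane depending continuously on a parameter *)

Section Class.
Variable R : realType.

Definition unc (T : topologicalType) (a : T -> R -> R -> R) (q : T * (R * R)) :=
  a q.1 q.2.1 q.2.2.

Definition dx (T : Type) (a : T -> R -> R -> R) l x y := derive1 (fun s => a l s y) x.

Definition dy (T : Type) (a : T -> R -> R -> R) l x y := derive1 (fun s => a l x s) y.

(* The derivatives are in the plane variables only, but they are continuous
   jointly in these and in the parameter l : T, on which no structure besides a
   topology is available. *)
Fixpoint cls (T : topologicalType) (k : nat) (a : T -> R -> R -> R) : Prop :=
  continuous (unc a) /\
  if k is k'.+1 then
    [/\ forall l x y, derivable (fun s => a l s y) x 1,
        forall l x y, derivable (fun s => a l x s) y 1,
        cls k' (dx a) & cls k' (dy a)]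
  else True.

Definition Cinf (T : topologicalType) (a : T -> R -> R -> R) := forall k, cls k a.

Section Basic.
Variable T : topologicalType.
Implicit Types (a b c : T -> R -> R -> R) (l : T) (x y : R).

Lemma unc_comp (Z : topologicalType) (m : Z -> T) (b c : Z -> R) a z :
  {for z, continuous m} -> {for z, continuous b} -> {for z, continuous c} ->
  {for (m z, (b z, c z)), continuous (unc a)} ->
  {for z, continuous (fun z => a (m z) (b z) (c z))}.
Proof.
move=> mc bc cc ac.
apply: (@continuous_comp _ _ _ (fun z => (m z, (b z, c z))) (unc a)) => //.
exact: (cvg_pair mc (cvg_pair bc cc)).
Qed.

Lemma cls_cont k a : cls k a -> continuous (unc a).
Proof. by case: k => [|k] []. Qed.

Lemma cls_dx k a l x y : cls k.+1 a -> drv (fun s => a l s y) x (dx a l x y).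
Proof. by move=> [_ [H _ _ _]]; exact: drvE. Qed.

Lemma cls_dy k a l x y : cls k.+1 a -> drv (fun s => a l x s) y (dy a l x y).
Proof. by move=> [_ [_ H _ _]]; exact: drvE. Qed.

Lemma clsdx k a : cls k.+1 a -> cls k (dx a).
Proof. by move=> [_ []]. Qed.

Lemma clsdy k a : cls k.+1 a -> cls k (dy a).
Proof. by move=> [_ []]. Qed.

(** Working form of the definition: the two partials are exhibited, and later regularity proofs are
    inductions on [k] checking the class of these candidates. *)
Lemma cls_intro k a ax ay : continuous (unc a) ->
  (forall l x y, drv (fun s => a l s y) x (ax l x y)) ->
  (forall l x y, drv (fun s => a l x s) y (ay l x y)) ->
  cls k ax -> cls k ay -> cls k.+1 a.
Proof.
move=> ac aax aay cx cy; split; first exact: ac.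
split.
- by move=> l x y; have [] := aax l x y.
- by move=> l x y; have [] := aay l x y.
- suff -> : dx a = ax by [].
  by apply/funext => l; apply/funext => x; apply/funext => y; exact: drv1E (aax l x y).
- suff -> : dy a = ay by [].
  by apply/funext => l; apply/funext => x; apply/funext => y; exact: drv1E (aay l x y).
Qed.

Lemma clsS k a : cls k.+1 a -> cls k a.
Proof.
elim: k a => [|k IH] a; first by case.
move=> [ac [d1 d2 cx cy]]; split; first exact: ac.
by split; [exact: d1|exact: d2|exact: (IH _ cx)|exact: (IH _ cy)].
Qed.

Lemma cls_ext k a b : (forall l x y, a l x y = b l x y) -> cls k a -> cls k b.
Proof.
by move=> ab; suff -> : a = b by []; apply/funext => l; apply/funext => x; apply/funext.
Qed.

Lemma dx_eq a l x y d : drv (fun s => a l s y) x d -> dx a l x y = d.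
Proof. exact: drv1E. Qed.

Lemma dy_eq a l x y d : drv (fun s => a l x s) y d -> dy a l x y = d.
Proof. exact: drv1E. Qed.

Lemma cls_param k (m : T -> R) : continuous m -> cls k (fun l _ _ => m l).
Proof.
elim: k m => [|k IH] m mc.
  by split => // z; apply: continuous_comp; [exact: cvg_fst|exact: mc].
apply: (@cls_intro _ _ (fun _ _ _ => 0) (fun _ _ _ => 0)).
- by move=> z; apply: continuous_comp; [exact: cvg_fst|exact: mc].
- by move=> *; exact: drvC.
- by move=> *; exact: drvC.
- by apply: (IH (fun=> 0)) => z; exact: cvg_cst.
- by apply: (IH (fun=> 0)) => z; exact: cvg_cst.
Qed.

Lemma clsC k (r : R) : cls k (fun (_ : T) _ _ => r).
Proof. by apply: (@cls_param k (fun=> r)) => z; exact: cvg_cst. Qed.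

Lemma cont_x : continuous (unc (fun (_ : T) x _ => x)).
Proof. by move=> z; apply: continuous_comp; [exact: cvg_snd|exact: cvg_fst]. Qed.

Lemma cont_y : continuous (unc (fun (_ : T) _ y => y)).
Proof. by move=> z; apply: continuous_comp; [exact: cvg_snd|exact: cvg_snd]. Qed.

Lemma clsX k : cls k (fun (_ : T) x _ => x).
Proof.
case: k => [|k]; first by split => //; exact: cont_x.
apply: (@cls_intro _ _ (fun _ _ _ => 1) (fun _ _ _ => 0)).
- exact: cont_x.
- by move=> *; exact: drvI.
- by move=> *; exact: drvC.
- exact: clsC.
- exact: clsC.
Qed.

Lemma clsY k : cls k (fun (_ : T) _ y => y).
Proof.
case: k => [|k]; first by split => //; exact: cont_y.
apply: (@cls_intro _ _ (fun _ _ _ => 0) (fun _ _ _ => 1)).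
- exact: cont_y.
- by move=> *; exact: drvC.
- by move=> *; exact: drvI.
- exact: clsC.
- exact: clsC.
Qed.

Lemma contD a b : continuous (unc a) -> continuous (unc b) ->
  continuous (unc (fun l x y => a l x y + b l x y)).
Proof. by move=> ac bc z; apply: continuousD; [exact: ac|exact: bc]. Qed.

Lemma contM a b : continuous (unc a) -> continuous (unc b) ->
  continuous (unc (fun l x y => a l x y * b l x y)).
Proof. by move=> ac bc z; apply: continuousM; [exact: ac|exact: bc]. Qed.

Lemma clsD k a b : cls k a -> cls k b -> cls k (fun l x y => a l x y + b l x y).
Proof.
elim: k a b => [|k IH] a b ac bc.
  by split => //; apply: contD; [case: ac|case: bc].
apply: (@cls_intro _ _ (fun l x y => dx a l x y + dx b l x y)
                       (fun l x y => dy a l x y + dy b l x y)).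
- by apply: contD; [case: ac|case: bc].
- by move=> l x y; apply: drvD; [exact: (cls_dx _ _ _ ac)|exact: (cls_dx _ _ _ bc)].
- by move=> l x y; apply: drvD; [exact: (cls_dy _ _ _ ac)|exact: (cls_dy _ _ _ bc)].
- by apply: IH; exact: clsdx.
- by apply: IH; exact: clsdy.
Qed.

Lemma clsM k a b : cls k a -> cls k b -> cls k (fun l x y => a l x y * b l x y).
Proof.
elim: k a b => [|k IH] a b ac bc.
  by split => //; apply: contM; [case: ac|case: bc].
apply: (@cls_intro _ _ (fun l x y => dx a l x y * b l x y + a l x y * dx b l x y)
                       (fun l x y => dy a l x y * b l x y + a l x y * dy b l x y)).
- by apply: contM; [case: ac|case: bc].
- by move=> l x y; apply: drvM; [exact: (cls_dx _ _ _ ac)|exact: (cls_dx _ _ _ bc)].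
- by move=> l x y; apply: drvM; [exact: (cls_dy _ _ _ ac)|exact: (cls_dy _ _ _ bc)].
- by apply: clsD; apply: IH; [exact: clsdx|exact: clsS|exact: clsS|exact: clsdx].
- by apply: clsD; apply: IH; [exact: clsdy|exact: clsS|exact: clsS|exact: clsdy].
Qed.

Lemma clsN k a : cls k a -> cls k (fun l x y => - a l x y).
Proof.
move=> ac; apply: (cls_ext _ (clsM (clsC k (- 1)) ac)) => l x y.
by rewrite mulN1r.
Qed.

Lemma clsB k a b : cls k a -> cls k b -> cls k (fun l x y => a l x y - b l x y).
Proof. by move=> ac bc; apply: clsD => //; exact: clsN. Qed.

Lemma clsV k a : (forall l x y, a l x y != 0) -> cls k a ->
  cls k (fun l x y => (a l x y)^-1).
Proof.
move=> a0; have ca : continuous (unc a) -> continuous (unc (fun l x y => (a l x y)^-1)).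
  by move=> ac z; apply: (@continuousV _ _ (unc a)); [exact: a0|exact: ac].
elim: k => [|k IH] ac.
  by split => //; apply: ca; case: ac.
apply: (@cls_intro _ _ (fun l x y => - dx a l x y * (a l x y)^-1 * (a l x y)^-1)
                       (fun l x y => - dy a l x y * (a l x y)^-1 * (a l x y)^-1)).
- by apply: ca; case: ac.
- by move=> l x y; apply: drvV; [exact: a0|exact: (cls_dx _ _ _ ac)].
- by move=> l x y; apply: drvV; [exact: a0|exact: (cls_dy _ _ _ ac)].
- have /IH H := clsS ac; do 2 apply: clsM => //; apply: clsN; exact: clsdx.
- have /IH H := clsS ac; do 2 apply: clsM => //; apply: clsN; exact: clsdy.
Qed.

Lemma cont_pt a l x y : continuous (unc a) ->
  {for (x, y), continuous (fun p : R * R => a l p.1 p.2)}.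
Proof.
move=> ac; apply: (@unc_comp _ (fun=> l) fst snd a (x, y)).
- exact: cvg_cst.
- exact: cvg_fst.
- exact: cvg_snd.
- exact: ac.
Qed.

Lemma cls_drv k a l (b c : R -> R) (t b' c' : R) : cls k.+1 a -> drv b t b' -> drv c t c' ->
  drv (fun s => a l (b s) (c s)) t
    (dx a l (b t) (c t) * b' + dy a l (b t) (c t) * c').
Proof.
move=> ac bb cc; apply: (@drv_comp2 R (a l) (dx a l) (dy a l)).
- by move=> x y; exact: (cls_dx _ _ _ ac).
- by move=> x y; exact: (cls_dy _ _ _ ac).
- by apply: cont_pt; apply: cls_cont (clsdx ac).
- by apply: cont_pt; apply: cls_cont (clsdy ac).
- exact: bb.
- exact: cc.
Qed.

End Basic.

(** The change of parameter [m] need only be continuous, since nothing is differentiated in the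
    parameter. The induction closes because the chain rule yields products of [dx a], [dy a],
    composed with the same [b], [c], and of partials of [b], [c]. *)
Lemma cls_comp (T T' : topologicalType) k (m : T' -> T) (a : T -> R -> R -> R)
    (b c : T' -> R -> R -> R) : continuous m ->
  cls k a -> cls k b -> cls k c ->
  cls k (fun l x y => a (m l) (b l x y) (c l x y)).
Proof.
move=> mc; have cont0 (a0 : T -> R -> R -> R) : continuous (unc a0) ->
  continuous (unc b) -> continuous (unc c) ->
  continuous (unc (fun l x y => a0 (m l) (b l x y) (c l x y))).
  move=> ac bc cc z; apply: (@unc_comp _ _ (fun z => m z.1) (unc b) (unc c) a0 z).
  - by apply: continuous_comp; [exact: cvg_fst|exact: mc].
  - exact: bc.
  - exact: cc.
  - exact: ac.
elim: k a => [|k IH] a ac bc cc.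
  by split => //; apply: cont0; [exact: cls_cont ac|exact: cls_cont bc|exact: cls_cont cc].
apply: (@cls_intro _ _ _
  (fun l x y => dx a (m l) (b l x y) (c l x y) * dx b l x y
              + dy a (m l) (b l x y) (c l x y) * dx c l x y)
  (fun l x y => dx a (m l) (b l x y) (c l x y) * dy b l x y
              + dy a (m l) (b l x y) (c l x y) * dy c l x y)).
- by apply: cont0; [exact: cls_cont ac|exact: cls_cont bc|exact: cls_cont cc].
- move=> l x y; apply: (cls_drv (b := fun s => b l s y) (c := fun s => c l s y) _ ac).
    exact: (cls_dx _ _ _ bc).
  exact: (cls_dx _ _ _ cc).
- move=> l x y; apply: (cls_drv (b := b l x) (c := c l x) _ ac).
    exact: (cls_dy _ _ _ bc).
  exact: (cls_dy _ _ _ cc).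
- apply: clsD; apply: clsM.
  + by apply: IH; [exact: clsdx ac|exact: clsS bc|exact: clsS cc].
  + exact: clsdx bc.
  + by apply: IH; [exact: clsdy ac|exact: clsS bc|exact: clsS cc].
  + exact: clsdx cc.
- apply: clsD; apply: clsM.
  + by apply: IH; [exact: clsdx ac|exact: clsS bc|exact: clsS cc].
  + exact: clsdy bc.
  + by apply: IH; [exact: clsdy ac|exact: clsS bc|exact: clsS cc].
  + exact: clsdy cc.
Qed.

End Class.

(** * Primitives with parameters *)

Section Primitive.
Variable R : realType.
Implicit Types (f g F : R -> R) (x y : R).

Local Notation mu := (@lebesgue_measure R).

Lemma drv_prim_from f (a x : R) : continuous f -> a < x ->
  drv (fun u => \int[mu]_(t in `[a, u]) f t)%R x (f x).
Proof.
move=> fc ax.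
have [] := @continuous_FTC1_closed R f a x (x + 1) _ _ ax (fc x).
- by rewrite ltrDl.
- apply: continuous_compact_integrable; first exact: segment_compact.
  exact: continuous_subspaceT.
- by move=> d1 <-; exact: drvE.
Qed.

(** Integrals are available from a fixed left endpoint only. Those from [- n], normalised to vanish
    at 0, agree to the right of both endpoints and are glued together. *)
Lemma antiderivative f : continuous f -> exists F, forall x, drv F x (f x).
Proof.
move=> fc.
pose G (n : nat) u := (\int[mu]_(t in `[- n%:R, u]) f t)%R.
pose N x := (Num.bound `|x|).+1.
have NP x : `|x| < (N x)%:R.
  rewrite /N; apply: lt_trans (_ : (Num.bound `|x|)%:R < _); last by rewrite ltr_nat.
  exact/archi_boundP/normr_ge0.
have Nn x : - (N x)%:R < x by have := NP x; rewrite ltr_norml => /andP[].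
have eqG n m x : 0 < n%:R :> R -> 0 < m%:R :> R -> - n%:R < x -> - m%:R < x ->
    G n x - G n 0 = G m x - G m 0.
  move=> n0 m0 nx mx.
  suff : G n x - G m x = G n 0 - G m 0 by lra.
  have dG z : - n%:R < z -> - m%:R < z -> drv (fun t => G n t - G m t) z 0.
    move=> nz mz; apply: drv_eq (drvB (drv_prim_from fc nz) (drv_prim_from fc mz)) _.
    by rewrite subrr.
  have [x0|/ltW x0] := leP x 0.
    by apply: (@drv0_cst_in _ (fun t => G n t - G m t) _ _ x0) => z /andP[xz z0]; apply: dG; lra.
  by apply/esym; apply: (@drv0_cst_in _ (fun t => G n t - G m t) _ _ x0) => z /andP[xz z0]; apply: dG; lra.
have N0 x : 0 < (N x)%:R :> R by rewrite ltr0n.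
exists (fun x => G (N x) x - G (N x) 0) => x.
have lt1 : - (N (`|x| + 1))%:R < x.
  have := NP (`|x| + 1); rewrite ger0_norm ?addr_ge0// => H.
  by have := ler_norm (- x); rewrite normrN; lra.
apply: (@near_drv _ (fun z => G (N (`|x| + 1)) z - G (N (`|x| + 1)) 0)).
  near=> z; apply: eqG => //.
  have xz : `|x - z| < 1 by near: z; apply/nbhs_ballP; exists 1 => //= z.
  have := NP (`|x| + 1); rewrite ger0_norm ?addr_ge0// => H.
  have := ler_norm (- x); rewrite normrN.
  by move: xz; rewrite ltr_norml => /andP[]; lra.
apply: drv_eq (drvB (drv_prim_from fc lt1) (drvC _ _)) _.
by rewrite subr0.
Unshelve. all: by end_near. Qed.

(** The signed integral of [f] from [y0] to [y], taken through a chosen global antiderivative so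
    that [y < y0] is no special case. Without an antiderivative the default is the zero function and
    the value is 0. *)
Definition prim f (y0 y : R) : R :=
  let F := xget (fun=> 0) [set F | forall x, drv F x (f x)] in F y - F y0.

Lemma drv_prim f y0 x : continuous f -> drv (prim f y0) x (f x).
Proof.
move=> fc; rewrite /prim.
case: xgetP => [F _ FP|]; last by have [F FP] := antiderivative fc => /(_ F).
by apply: drv_eq (drvB (FP x) (drvC _ _)) _; rewrite subr0.
Qed.

Lemma prim0 f y0 : prim f y0 y0 = 0.
Proof. by rewrite /prim subrr. Qed.

Lemma prim_eq f F y0 : continuous f -> (forall y, drv F y (f y)) ->
  forall y, prim f y0 y = F y - F y0.
Proof.
move=> fc Ff y.
have : prim f y0 y - F y = prim f y0 y0 - F y0.
  apply: (@drv0_cst _ (fun z => prim f y0 z - F z)) => z.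
  by apply: drv_eq (drvB (drv_prim y0 z fc) (Ff z)) _; rewrite subrr.
by rewrite prim0; lra.
Qed.

Lemma prim_close f g y0 y e : continuous f -> continuous g ->
  (forall t, `|t - y0| <= `|y - y0| -> `|f t - g t| <= e) ->
  `|prim f y0 y - prim g y0 y| <= e * `|y - y0|.
Proof.
move=> fc gc fg.
have [c cy E] := @mvt_abs _ (fun z => prim f y0 z - prim g y0 z) _ y0 y
  (fun z => drvB (drv_prim y0 z fc) (drv_prim y0 z gc)).
move: E; rewrite !prim0 !subr0 => ->.
by rewrite normrM ler_wpM2r// fg.
Qed.

Lemma prim_cont (M : topologicalType) (a : M -> R -> R) y0 :
  continuous (fun q : M * R => a q.1 q.2) ->
  continuous (fun q : M * R => prim (a q.1) y0 q.2).
Proof.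
move=> ac [m1 x1].
have am m : continuous (a m).
  move=> z; apply: (@continuous_comp _ _ _ (fun z : R => (m, z)) (fun q : M * R => a q.1 q.2)).
    by apply: continuous_pair_at; [exact: cvg_cst|exact: cvg_id].
  exact: ac.
apply/cvgrPdist_lt => e e0 /=.
set B := `|x1 - y0| + 1.
have B0 : 0 < B by rewrite ltr_wpDl.
have e1 : 0 < e / 2 / B by rewrite !divr_gt0.
have e2 : 0 < e / 2 by rewrite divr_gt0.
have tb : \forall m \near m1, forall y, y0 - B <= y <= y0 + B ->
   `|a m y - a m1 y| < e / 2 / B by apply: segment_tube => // y _; exact: ac.
have cx : \forall x \near x1, `|prim (a m1) y0 x1 - prim (a m1) y0 x| < e / 2.
  by have /cvgrPdist_lt /(_ _ e2) := drv_cont (drv_prim y0 x1 (am m1)).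
near=> q.
have qm : forall y, y0 - B <= y <= y0 + B -> `|a q.1 y - a m1 y| < e / 2 / B.
  by near: q; exact: (cvg_fst tb).
have qx : `|prim (a m1) y0 x1 - prim (a m1) y0 q.2| < e / 2.
  by near: q; exact: (cvg_snd cx).
have qB : `|q.2 - y0| <= B.
  have : `|x1 - q.2| < 1.
    near: q; apply: (cvg_snd (_ : \forall x \near x1, `|x1 - x| < 1)).
    by apply/nbhs_ballP; exists 1 => //=.
  rewrite (_ : q.2 - y0 = (x1 - y0) - (x1 - q.2)) => [H|]; last by ring.
  by apply: le_trans (ler_normB _ _) _; rewrite /B lerD2l ltW.
rewrite -(subrKA (prim (a m1) y0 q.2)) [e]splitr.
apply: le_lt_trans (ler_normD _ _) _; apply: ltr_leD => //.
rewrite distrC; apply: le_trans (prim_close (e := e / 2 / B) _ _ _) _ => //.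
  move=> t tq; apply/ltW/qm.
  have := le_trans tq qB; rewrite ler_norml => /andP[]; lra.
rewrite [leRHS](_ : _ = e / 2 / B * B); last by field; rewrite gt_eqF.
by apply: ler_wpM2l => //; exact: ltW.
Unshelve. all: by end_near. Qed.

End Primitive.

Section ParametricPrimitive.
Variables (R : realType) (T : topologicalType).
Implicit Types (a b c : T -> R -> R -> R) (l : T) (x y : R).

Lemma unc_sect a l x : continuous (unc a) -> continuous (a l x).
Proof.
move=> ac z; apply: (@unc_comp R T _ (fun=> l) (fun=> x) id a z).
- exact: cvg_cst.
- exact: cvg_cst.
- exact: cvg_id.
- exact: ac.
Qed.

Lemma prim_unc a y0 : continuous (unc a) ->
  continuous (unc (fun l x y => prim (a l x) y0 y)).
Proof.
move=> ac.
have ac' : continuous (fun q : (T * R) * R => a q.1.1 q.1.2 q.2).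
  move=> z; apply: (@unc_comp R T _ (fun z : (T * R) * R => z.1.1)
    (fun z : (T * R) * R => z.1.2) (fun z : (T * R) * R => z.2) a z).
  - by apply: continuous_comp; exact: cvg_fst.
  - by apply: continuous_comp; [exact: cvg_fst|exact: cvg_snd].
  - exact: cvg_snd.
  - exact: ac.
have := @prim_cont R _ (fun (q : T * R) => a q.1 q.2) y0 ac'.
move=> H [l [x y]].
apply: (@continuous_comp _ _ _ (fun q : T * (R * R) => ((q.1, q.2.1), q.2.2))
  (fun q : (T * R) * R => prim (a q.1.1 q.1.2) y0 q.2)); last exact: H.
apply: continuous_pair_at; last by apply: continuous_comp; exact: cvg_snd.
apply: continuous_pair_at; first exact: cvg_fst.
by apply: continuous_comp; [exact: cvg_snd|exact: cvg_fst].
Qed.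

(** Differentiation under the integral sign by two mean values: one in the upper limit, for the
    whole error as a function of it, and one in the parameter. What remains is a difference of
    values of [dx a], uniformly small on a segment. *)
Lemma drv_param_prim k a y0 l x y : cls k.+1 a ->
  drv (fun s => prim (a l s) y0 y) x (prim (dx a l x) y0 y).
Proof.
move=> ac; apply: drv_quot => e e0.
have a_c s : continuous (a l s) by apply: unc_sect; exact: cls_cont ac.
have da_c s : continuous (dx a l s) by apply: unc_sect; exact: cls_cont (clsdx ac).
set B := `|y - y0| + 1.
have B0 : 0 < B by rewrite ltr_wpDl.
have e1 : 0 < e / B by rewrite divr_gt0.
have tb : \forall s \near x, forall z, y0 - B <= z <= y0 + B ->
   `|dx a l s z - dx a l x z| < e / B.
  apply: segment_tube => // z _; exact: cont_pt (cls_cont (clsdx ac)).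
have [d d0 dP] : exists2 d, 0 < d & forall s, `|s - x| < d ->
    forall z, y0 - B <= z <= y0 + B -> `|dx a l s z - dx a l x z| < e / B.
  move/nbhs_ballP : tb => [d d0 dP]; exists d => // s sx; apply: dP.
  by rewrite /ball /= distrC.
rewrite /dnbhs near_withinE; near=> h => _.
have hd : `|h| < d.
  by near: h; apply/nbhs_ballP; exists d => //= z; rewrite /ball /= sub0r normrN.
have [c cy E] := @mvt_abs _
  (fun z => prim (a l (x + h)) y0 z - prim (a l x) y0 z - h * prim (dx a l x) y0 z) _ y0 y
  (fun z => drvB (drvB (drv_prim y0 z (a_c _)) (drv_prim y0 z (a_c _)))
     (drvZ h (drv_prim y0 z (da_c _)))).
move: E; rewrite !prim0 mulr0 !subr0 => ->.
have [c' ch ->] := mvt_abs x (x + h) (fun s => cls_dx l s c ac).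
move: ch; rewrite [x + h - x]addrAC subrr add0r => ch.
rewrite (mulrC h) -mulrBl !normrM.
have Hc : `|dx a l c' c - dx a l x c| < e / B.
  apply: dP; first exact: le_lt_trans hd.
  have : `|c - y0| <= B by rewrite (le_trans cy)// /B lerDl.
  by rewrite ler_norml => /andP[]; lra.
apply: le_trans (_ : e / B * `|h| * `|y - y0| <= _).
  by rewrite ler_wpM2r// ler_wpM2r// ltW.
rewrite [leRHS](_ : _ = e / B * `|h| * B); last by field; rewrite gt_eqF.
by apply: ler_wpM2l; [exact: (mulr_ge0 (ltW e1))|rewrite /B lerDl].
Unshelve. all: by end_near. Qed.

Lemma cls_prim k a y0 : cls k a -> cls k (fun l x y => prim (a l x) y0 y).
Proof.
elim: k a => [|k IH] a ac.
  by split => //; apply: prim_unc; exact: cls_cont ac.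
apply: (@cls_intro _ _ _ _ (fun l x y => prim (dx a l x) y0 y) a).
- by apply: prim_unc; exact: cls_cont ac.
- by move=> l x y; exact: drv_param_prim ac.
- by move=> l x y; apply: drv_prim; apply: unc_sect; exact: cls_cont ac.
- by apply: IH; exact: clsdx.
- exact: clsS.
Qed.

End ParametricPrimitive.

(** * Elementary functions and locally defined families *)

Section Closure.
Variable R : realType.

(** A set of functions stable under differentiation consists of smooth functions, which spares
    formulas for higher derivatives. It serves for the span of sine and cosine, for the exponential
    and for flat functions. *)
Lemma cls_fun_set (T : topologicalType) (P : (R -> R) -> Prop) :
  (forall g, P g -> exists2 g', P g' & forall x, drv g x (g' x)) ->
  forall k g, P g -> cls k (fun (_ : T) x _ => g x).
Proof.
move=> PD; elim=> [|k IH] g Pg; have [g' Pg' gg'] := PD g Pg;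
    have gc : continuous (unc (fun (_ : T) x _ => g x)).
- move=> z; apply: (@continuous_comp _ _ _ (fun z : T * (R * R) => z.2.1) g).
    exact: cont_x.
  exact: drv_cont (gg' _).
- by split.
- move=> z; apply: (@continuous_comp _ _ _ (fun z : T * (R * R) => z.2.1) g).
    exact: cont_x.
  exact: drv_cont (gg' _).
apply: (@cls_intro _ _ _ _ (fun _ x _ => g' x) (fun _ _ _ => 0)).
- exact: gc.
- by move=> l x y; exact: gg'.
- by move=> l x y; exact: drvC.
- exact: IH.
- exact: clsC.
Qed.

Lemma drv_sin (x : R) : drv sin x (cos x).
Proof. exact: is_derive_sin. Qed.

Lemma drv_cos (x : R) : drv cos x (- sin x).
Proof. exact: is_derive_cos. Qed.

Lemma drv_exp (x : R) : drv expR x (expR x).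
Proof. exact: is_derive_expR. Qed.

Lemma drv_expf (f : R -> R) (x a : R) : drv f x a ->
  drv (fun t => expR (f t)) x (expR (f x) * a).
Proof. exact: drv_comp (drv_exp (f x)). Qed.

Lemma drv_sinf (f : R -> R) (x a : R) : drv f x a ->
  drv (fun t => sin (f t)) x (cos (f x) * a).
Proof. exact: drv_comp (drv_sin (f x)). Qed.

Lemma drv_cosf (f : R -> R) (x a : R) : drv f x a ->
  drv (fun t => cos (f t)) x (- sin (f x) * a).
Proof. exact: drv_comp (drv_cos (f x)). Qed.

Lemma cls_trig (T : topologicalType) k :
  cls k (fun (_ : T) (x : R) _ => sin x) /\ cls k (fun (_ : T) (x : R) _ => cos x).
Proof.
pose P (g : R -> R) := exists a b, g = fun x => a * sin x + b * cos x.
have PD g : P g -> exists2 g', P g' & forall x, drv g x (g' x).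
  move=> [a [b ->]]; exists (fun x => - b * sin x + a * cos x).
    by exists (- b), a.
  move=> x; apply: drv_eq (drvD (drvZ a (drv_sin x)) (drvZ b (drv_cos x))) _.
  by rewrite mulrN mulNr addrC.
split.
- apply: (@cls_fun_set T P PD k sin); exists 1, 0; apply/funext => x.
  by rewrite mul1r mul0r addr0.
- apply: (@cls_fun_set T P PD k cos); exists 0, 1; apply/funext => x.
  by rewrite mul1r mul0r add0r.
Qed.

Lemma cls_exp0 (T : topologicalType) k : cls k (fun (_ : T) (x : R) _ => expR x).
Proof.
apply: (@cls_fun_set T (fun g => g = expR)) => // g ->.
by exists expR => // x; exact: drv_exp.
Qed.

Lemma cont_id (T : topologicalType) : continuous (fun l : T => l).
Proof. by move=> l; exact: cvg_id. Qed.

Lemma dx_congr (T T' : Type) (a : T -> R -> R -> R) (b : T' -> R -> R -> R) l l' x y y' :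
  (forall s, a l s y = b l' s y') -> dx a l x y = dx b l' x y'.
Proof. by move=> ab; rewrite /dx; congr (derive1 _ _); apply/funext. Qed.

Section OneSpace.
Variable T : topologicalType.
Implicit Types (a b c : T -> R -> R -> R) (l : T) (x y : R).

Lemma cls_fun1 k (g : R -> R) b : cls k (fun (_ : T) x _ => g x) -> cls k b ->
  cls k (fun l x y => g (b l x y)).
Proof.
move=> gk bk.
exact: (@cls_comp _ _ _ _ _ (fun (_ : T) x _ => g x) b b (@cont_id T)).
Qed.

Lemma cls_sin k b : cls k b -> cls k (fun l x y => sin (b l x y)).
Proof. by apply: cls_fun1; have [] := @cls_trig T k. Qed.

Lemma cls_cos k b : cls k b -> cls k (fun l x y => cos (b l x y)).
Proof. by apply: cls_fun1; have [] := @cls_trig T k. Qed.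

Lemma cls_exp k b : cls k b -> cls k (fun l x y => expR (b l x y)).
Proof. by apply: cls_fun1; exact: cls_exp0. Qed.

Lemma cls_subst k a b c : cls k a -> cls k b -> cls k c ->
  cls k (fun l x y => a l (b l x y) (c l x y)).
Proof. by move=> ak bk ck; apply: (@cls_comp _ _ _ _ (fun l => l)) => //; exact: cont_id. Qed.

Lemma cls_prim1 k a (x0 : R) : cls k a -> cls k (fun l x y => prim (fun s => a l s y) x0 x).
Proof.
move=> ak.
have H := cls_prim x0 (cls_subst ak (clsY R T k) (clsX R T k)).
exact: (cls_subst H (clsY R T k) (clsX R T k)).
Qed.

Lemma drv_param_prim1 k a (x0 : R) l x y : cls k.+1 a ->
  drv (fun t => prim (fun s => a l s t) x0 x) y (prim (fun s => dy a l s y) x0 x).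
Proof.
move=> ak.
exact: (drv_param_prim x0 l y x (cls_subst ak (clsY R T _) (clsX R T _))).
Qed.

(** Admits families defined by a choice made separately, perhaps discontinuously, for each
    parameter, as long as the result agrees locally with a good family. The exit data of the chart
    are of this kind. *)
Lemma cls_local k a :
  (forall l0, exists2 a', cls k a' & \forall l \near l0, forall x y, a l x y = a' l x y) ->
  cls k a.
Proof.
have cl b : (forall l0, exists2 a', continuous (unc a') &
      \forall l \near l0, forall x y, b l x y = a' l x y) -> continuous (unc b).
  move=> bl [l0 xy]; have [a' a'c ba'] := bl l0.
  rewrite /prop_for /continuous_at.
  have <- : unc a' (l0, xy) = unc b (l0, xy).
    by rewrite /unc /= (nbhs_singleton ba').
  apply: cvg_trans (a'c (l0, xy)); apply: near_eq_cvg.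
  near=> q; rewrite /unc.
  suff : forall x y, b q.1 x y = a' q.1 x y by move->.
  near: q; exact: (cvg_fst ba').
elim: k a => [|k IH] a al.
  split => //; apply: cl => l0; have [a' [a'c _] e] := al l0; by exists a'.
split.
  apply: cl => l0; have [a' a'k e] := al l0; exists a' => //; exact: cls_cont a'k.
split.
- move=> l x y; have [a' a'k e] := al l.
  have -> : (fun s => a l s y) = (fun s => a' l s y).
    by apply/funext => s; rewrite (nbhs_singleton e).
  by have [_ [H _ _ _]] := a'k; exact: H.
- move=> l x y; have [a' a'k e] := al l.
  have -> : (fun s => a l x s) = (fun s => a' l x s).
    by apply/funext => s; rewrite (nbhs_singleton e).
  by have [_ [_ H _ _]] := a'k; exact: H.
- apply: IH => l0; have [a' a'k e] := al l0; exists (dx a'); first exact: clsdx a'k.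
  apply: filterS e => l e x y; rewrite /dx; congr (derive1 _ _).
  by apply/funext => s; rewrite e.
- apply: IH => l0; have [a' a'k e] := al l0; exists (dy a'); first exact: clsdy a'k.
  apply: filterS e => l e x y; rewrite /dy; congr (derive1 _ _).
  by apply/funext => s; rewrite e.
Unshelve. all: by end_near. Qed.

End OneSpace.
End Closure.

(** * Inverse functions with parameters *)

Section Inverse.
Variable R : realType.

(** Here [(p1, p2)] is an inverse map restricted to a line, so [(G1, G2)] is affine along it.
    Cramer's rule on the linear approximation gives the derivatives; the error is relative to the
    unknown increment of [(p1, p2)], which has to be bounded by a multiple of [|h|] beforehand. *)
Lemma inverse_curve (G1 G2 G1x G1y G2x G2y : R -> R -> R) (p1 p2 : R -> R)
    (t u1 u2 D : R) :
  (forall x y, drv (fun s => G1 s y) x (G1x x y)) ->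
  (forall x y, drv (G1 x) y (G1y x y)) ->
  (forall x y, drv (fun s => G2 s y) x (G2x x y)) ->
  (forall x y, drv (G2 x) y (G2y x y)) ->
  {for (p1 t, p2 t), continuous (fun p : R * R => G1x p.1 p.2)} ->
  {for (p1 t, p2 t), continuous (fun p : R * R => G1y p.1 p.2)} ->
  {for (p1 t, p2 t), continuous (fun p : R * R => G2x p.1 p.2)} ->
  {for (p1 t, p2 t), continuous (fun p : R * R => G2y p.1 p.2)} ->
  {for t, continuous p1} -> {for t, continuous p2} ->
  (forall h, G1 (p1 (t + h)) (p2 (t + h)) = G1 (p1 t) (p2 t) + h * u1) ->
  (forall h, G2 (p1 (t + h)) (p2 (t + h)) = G2 (p1 t) (p2 t) + h * u2) ->
  D = G1x (p1 t) (p2 t) * G2y (p1 t) (p2 t) - G1y (p1 t) (p2 t) * G2x (p1 t) (p2 t) ->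
  D != 0 ->
  drv p1 t ((G2y (p1 t) (p2 t) * u1 - G1y (p1 t) (p2 t) * u2) / D) /\
  drv p2 t ((G1x (p1 t) (p2 t) * u2 - G2x (p1 t) (p2 t) * u1) / D).
Proof.
move=> d1x d1y d2x d2y c1x c1y c2x c2y cp1 cp2 E1 E2.
set a := G1x _ _; set b := G1y _ _; set c := G2x _ _; set d := G2y _ _ => DE D0.
set M := `|a| + `|b| + `|c| + `|d| + `|d * u1 - b * u2| + `|a * u2 - c * u1| + 1.
have M0 : 0 < M by rewrite /M ltr_wpDl// !addr_ge0.
have Dp : 0 < `|D| by rewrite normr_gt0.
have key e : 0 < e -> \forall h \near 0,
    `|p1 (t + h) - p1 t - h * ((d * u1 - b * u2) / D)| <= e * `|h| /\
    `|p2 (t + h) - p2 t - h * ((a * u2 - c * u1) / D)| <= e * `|h|.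
  move=> e0.
  (* The first bound lets the error [M * e1 * s] be absorbed in [|D| * s], whence
     [|D| * s <= 4 * M * |h|]. The second makes the same error at most [|D| * (e * |h|)] once [s] is
     replaced through that inequality. *)
  pose e1 := Num.min (`|D| / (4 * M)) (e * `|D| ^+ 2 / (4 * M ^+ 2)).
  have e10 : 0 < e1.
    by rewrite /e1 lt_min !divr_gt0 ?mulr_gt0 ?exprn_gt0.
  have e1a : e1 * (4 * M) <= `|D|.
    by rewrite -ler_pdivlMr ?mulr_gt0// /e1 ge_min lexx.
  have e1b : e1 * (4 * M ^+ 2) <= e * `|D| ^+ 2.
    by rewrite -ler_pdivlMr ?mulr_gt0 ?exprn_gt0// /e1 ge_min lexx orbT.
  have [r1 r10 H1] := linear_approximation d1x d1y c1x c1y e10.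
  have [r2 r20 H2] := linear_approximation d2x d2y c2x c2y e10.
  pose r := Num.min r1 r2.
  have r0 : 0 < r by rewrite lt_min r10.
  have nr (p : R -> R) : {for t, continuous p} -> \forall h \near 0, `|p (t + h) - p t| < r.
    move=> /cvgrPdist_lt /(_ _ r0) /nbhs_ballP [q q0 qP].
    apply/nbhs_ballP; exists q => // h; rewrite /ball /= sub0r normrN => hq.
    rewrite distrC; apply: qP; rewrite /ball /= opprD addrA subrr sub0r normrN//.
  near=> h.
  have : `|p1 (t + h) - p1 t| < r by near: h; exact: nr.
  have : `|p2 (t + h) - p2 t| < r by near: h; exact: nr.
  set k1 := p1 (t + h) - p1 t; set k2 := p2 (t + h) - p2 t.
  rewrite !lt_min => /andP[k2a k2b] /andP[k1a k1b].
  have := H1 _ _ k1a k2a; have := H2 _ _ k1b k2b.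
  have -> : p1 t + k1 = p1 (t + h) by rewrite /k1; ring.
  have -> : p2 t + k2 = p2 (t + h) by rewrite /k2; ring.
  rewrite E1 E2 -/a -/b -/c -/d (addrC (G1 _ _)) (addrC (G2 _ _)) !addrK.
  set F2 := h * u2 - _; set F1 := h * u1 - _; set s := `|k1| + `|k2| => F2s F1s.
  have s0 : 0 <= s by rewrite addr_ge0.
  have I1 : D * k1 - h * (d * u1 - b * u2) = b * F2 - d * F1.
    by rewrite /F1 /F2 DE; ring.
  have I2 : D * k2 - h * (a * u2 - c * u1) = c * F1 - a * F2.
    by rewrite /F1 /F2 DE; ring.
  have B (v w : R) : `|v| + `|w| <= M -> `|v * F2 - w * F1| <= M * e1 * s.
    move=> vw; apply: le_trans (ler_normB _ _) _; rewrite !normrM.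
    apply: le_trans (_ : (`|v| + `|w|) * (e1 * s) <= _).
      by rewrite mulrDl lerD// ler_wpM2l.
    by rewrite -mulrA ler_wpM2r// mulr_ge0// ltW.
  have Mn (v : R) : 0 <= `|v| by [].
  have J1 : `|D * k1 - h * (d * u1 - b * u2)| <= M * e1 * s.
    rewrite I1; apply: B; rewrite /M.
    by have := (Mn a, Mn c, Mn (d * u1 - b * u2), Mn (a * u2 - c * u1)); case=> [[[]]]; lra.
  have J2 : `|D * k2 - h * (a * u2 - c * u1)| <= M * e1 * s.
    rewrite I2 -normrN opprB; apply: B; rewrite /M.
    by have := (Mn b, Mn d, Mn (d * u1 - b * u2), Mn (a * u2 - c * u1)); case=> [[[]]]; lra.
  have K1 : `|D| * `|k1| <= `|h| * M + M * e1 * s.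
    rewrite -normrM -[D * k1](subrK (h * (d * u1 - b * u2))).
    apply: le_trans (ler_normD _ _) _; rewrite addrC lerD// normrM ler_wpM2l// /M.
    by have := (Mn a, Mn b, Mn c, Mn d, Mn (a * u2 - c * u1)); case=> [[[[]]]]; lra.
  have K2 : `|D| * `|k2| <= `|h| * M + M * e1 * s.
    rewrite -normrM -[D * k2](subrK (h * (a * u2 - c * u1))).
    apply: le_trans (ler_normD _ _) _; rewrite addrC lerD// normrM ler_wpM2l// /M.
    by have := (Mn a, Mn b, Mn c, Mn d, Mn (d * u1 - b * u2)); case=> [[[[]]]]; lra.
  have Ds : `|D| * s <= 4 * M * `|h|.
    have : `|D| * s <= 2 * (`|h| * M) + 2 * (M * e1 * s) by rewrite mulrDr; lra.
    have : 4 * (M * e1 * s) <= `|D| * s.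
      rewrite (_ : 4 * (M * e1 * s) = e1 * (4 * M) * s); last by ring.
      by rewrite ler_wpM2r.
    lra.
  have fin : M * e1 * s <= `|D| * (e * `|h|).
    rewrite -(ler_pM2l Dp).
    apply: le_trans (_ : M * e1 * (4 * M * `|h|) <= _).
      rewrite (_ : `|D| * (M * e1 * s) = M * e1 * (`|D| * s)); last by ring.
      by apply: ler_wpM2l Ds; rewrite mulr_ge0// ltW.
    rewrite [leRHS](_ : _ = e * `|D| ^+ 2 * `|h|); last by ring.
    rewrite [leLHS](_ : _ = e1 * (4 * M ^+ 2) * `|h|); last by ring.
    by rewrite ler_wpM2r.
  split; rewrite -(ler_pM2l Dp) -normrM; (apply: le_trans fin).
    by rewrite (_ : D * _ = D * k1 - h * (d * u1 - b * u2)) //; field.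
  by rewrite (_ : D * _ = D * k2 - h * (a * u2 - c * u1)) //; field.
split; apply: drv_quot => e e0; apply: (@cvg_within _ (nbhs 0));
  apply: filterS (key e e0) => h [] //.
Unshelve. all: by end_near. Qed.

Variable T : topologicalType.
Implicit Types (a b c : T -> R -> R -> R) (l : T) (x y : R).

(** Bootstrap: the partials of [H1], [H2] are rational in partials of [G1], [G2] taken at
    [(H1, H2)], hence of the class already known for [H1], [H2], which gains one order. The
    continuity of the inverse starts the induction. *)
Lemma cls_inverse (G1 G2 H1 H2 : T -> R -> R -> R) :
  Cinf G1 -> Cinf G2 -> continuous (unc H1) -> continuous (unc H2) ->
  (forall l x y, G1 l (H1 l x y) (H2 l x y) = x) ->
  (forall l x y, G2 l (H1 l x y) (H2 l x y) = y) ->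
  (forall l x y, dx G1 l x y * dy G2 l x y - dy G1 l x y * dx G2 l x y != 0) ->
  Cinf H1 /\ Cinf H2.
Proof.
move=> G1c G2c H1c H2c GH1 GH2 D0.
pose D l x y := dx G1 l x y * dy G2 l x y - dy G1 l x y * dx G2 l x y.
have Dc k : cls k D.
  by apply: clsB; apply: clsM; [exact: clsdx (G1c _)|exact: clsdy (G2c _)
    |exact: clsdy (G1c _)|exact: clsdx (G2c _)].
pose V a l x y := a l (H1 l x y) (H2 l x y) / D l (H1 l x y) (H2 l x y).
have contH (H : T -> R -> R -> R) l x y : continuous (unc H) ->
    {for x, continuous (fun s => H l s y)} /\ {for y, continuous (fun s => H l x s)}.
  move=> Hc; split.
    apply: (@unc_comp R T _ (fun=> l) id (fun=> y) H x);
      [exact: cvg_cst|exact: cvg_id|exact: cvg_cst|exact: Hc].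
  exact: unc_sect.
have dH l x y :
  [/\ drv (fun s => H1 l s y) x (V (dy G2) l x y),
      drv (fun s => H2 l s y) x (V (fun l x y => - dx G2 l x y) l x y),
      drv (fun s => H1 l x s) y (V (fun l x y => - dy G1 l x y) l x y) &
      drv (fun s => H2 l x s) y (V (dx G1) l x y)].
  have cG (G : T -> R -> R -> R) (z : R * R) : Cinf G ->
      {for z, continuous (fun p : R * R => dx G l p.1 p.2)} /\
      {for z, continuous (fun p : R * R => dy G l p.1 p.2)}.
    move=> Gc; case: z => z1 z2; split; apply: cont_pt.
      exact: cls_cont (clsdx (Gc 1%N)).
    exact: cls_cont (clsdy (Gc 1%N)).
  have dG (G : T -> R -> R -> R) z1 z2 : Cinf G ->
      drv (fun s => G l s z2) z1 (dx G l z1 z2) /\ drv (G l z1) z2 (dy G l z1 z2).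
    by move=> Gc; split; [exact: cls_dx (Gc 1%N)|exact: cls_dy (Gc 1%N)].
  have [||||||||||||||A1 A2] := @inverse_curve (G1 l) (G2 l) (dx G1 l) (dy G1 l) (dx G2 l) (dy G2 l)
     (fun s => H1 l s y) (fun s => H2 l s y) x 1 0 (D l (H1 l x y) (H2 l x y)).
  - by move=> z1 z2; have [] := dG G1 z1 z2 G1c.
  - by move=> z1 z2; have [] := dG G1 z1 z2 G1c.
  - by move=> z1 z2; have [] := dG G2 z1 z2 G2c.
  - by move=> z1 z2; have [] := dG G2 z1 z2 G2c.
  - exact: (proj1 (cG G1 (H1 l x y, H2 l x y) G1c)).
  - exact: (proj2 (cG G1 (H1 l x y, H2 l x y) G1c)).
  - exact: (proj1 (cG G2 (H1 l x y, H2 l x y) G2c)).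
  - exact: (proj2 (cG G2 (H1 l x y, H2 l x y) G2c)).
  - by have [] := contH H1 l x y H1c.
  - by have [] := contH H2 l x y H2c.
  - by move=> h; rewrite !GH1 mulr1.
  - by move=> h; rewrite !GH2 mulr0 addr0.
  - by [].
  - exact: D0.
  have [||||||||||||||A3 A4] := @inverse_curve (G1 l) (G2 l) (dx G1 l) (dy G1 l) (dx G2 l) (dy G2 l)
     (H1 l x) (H2 l x) y 0 1 (D l (H1 l x y) (H2 l x y)).
  - by move=> z1 z2; have [] := dG G1 z1 z2 G1c.
  - by move=> z1 z2; have [] := dG G1 z1 z2 G1c.
  - by move=> z1 z2; have [] := dG G2 z1 z2 G2c.
  - by move=> z1 z2; have [] := dG G2 z1 z2 G2c.
  - exact: (proj1 (cG G1 (H1 l x y, H2 l x y) G1c)).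
  - exact: (proj2 (cG G1 (H1 l x y, H2 l x y) G1c)).
  - exact: (proj1 (cG G2 (H1 l x y, H2 l x y) G2c)).
  - exact: (proj2 (cG G2 (H1 l x y, H2 l x y) G2c)).
  - by have [] := contH H1 l x y H1c.
  - by have [] := contH H2 l x y H2c.
  - by move=> h; rewrite !GH1 mulr0 addr0.
  - by move=> h; rewrite !GH2 mulr1.
  - by [].
  - exact: D0.
  split.
  - by apply: drv_eq A1 _; rewrite /V mulr1 mulr0 subr0.
  - by apply: drv_eq A2 _; rewrite /V mulr1 mulr0 sub0r.
  - by apply: drv_eq A3 _; rewrite /V mulr1 mulr0 sub0r.
  - by apply: drv_eq A4 _; rewrite /V mulr1 mulr0 subr0.
suff HH k : cls k H1 /\ cls k H2 by split=> k; have [] := HH k.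
elim: k => [|k [IH1 IH2]]; first by split.
have Vc a : Cinf a -> cls k (V a).
  move=> ac; apply: clsM; first exact: cls_subst.
  apply: clsV; first by move=> l x y; exact: D0.
  exact: cls_subst.
have dG2 : Cinf (dy G2) by move=> j; exact: clsdy (G2c _).
have dG2' : Cinf (fun l x y => - dx G2 l x y) by move=> j; apply: clsN; exact: clsdx (G2c _).
have dG1 : Cinf (dx G1) by move=> j; exact: clsdx (G1c _).
have dG1' : Cinf (fun l x y => - dy G1 l x y) by move=> j; apply: clsN; exact: clsdy (G1c _).
split.
- apply: (cls_intro H1c _ _ (Vc _ dG2) (Vc _ dG1')).
    by move=> l x y; have [] := dH l x y.
  by move=> l x y; have [] := dH l x y.
- apply: (cls_intro H2c _ _ (Vc _ dG2') (Vc _ dG1)).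
    by move=> l x y; have [] := dH l x y.
  by move=> l x y; have [] := dH l x y.
Qed.

(** For nearby data the values of [S] at the heights [y0 - e] and [y0 + e] still bracket the
    prescribed value, and monotonicity traps [W] between these heights. *)
Lemma monotone_inverse_cont (S W : T -> R -> R -> R) : continuous (unc S) ->
  (forall l x y y', y < y' -> S l x y < S l x y') ->
  (forall l x v, S l x (W l x v) = v) -> continuous (unc W).
Proof.
move=> Sc Sm SW [l0 [x0 v0]]; apply/cvgrPdist_lt => e e0 /=.
have slt (y : R) : {for (l0, (x0, v0)), continuous (fun q : T * (R * R) => S q.1 q.2.1 y)}.
  apply: (@unc_comp R T _ (fun z => z.1) (fun z => z.2.1) (fun=> y) S).
  - exact: cvg_fst.
  - exact: cont_x.
  - exact: cvg_cst.
  - exact: Sc.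
have vc : {for (l0, (x0, v0)), continuous (fun q : T * (R * R) => q.2.2)} by exact: cont_y.
set y0 := unc W (l0, (x0, v0)).
have L1 : S l0 x0 (y0 - e) < v0 by rewrite -[ltRHS](SW l0 x0 v0); apply: Sm; rewrite /y0 /unc /=; lra.
have L2 : v0 < S l0 x0 (y0 + e) by rewrite -[ltLHS](SW l0 x0 v0); apply: Sm; rewrite /y0 /unc /=; lra.
have N1 : \forall q \near (l0, (x0, v0)), 0 < q.2.2 - S q.1 q.2.1 (y0 - e).
  have H : {for (l0, (x0, v0)), continuous (fun q : T * (R * R) => q.2.2 - S q.1 q.2.1 (y0 - e))}.
    by apply: continuousB; [exact: vc|exact: slt].
  by apply: (cvgr_gt _ H); rewrite /= subr_gt0.
have N2 : \forall q \near (l0, (x0, v0)), 0 < S q.1 q.2.1 (y0 + e) - q.2.2.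
  have H : {for (l0, (x0, v0)), continuous (fun q : T * (R * R) => S q.1 q.2.1 (y0 + e) - q.2.2)}.
    by apply: continuousB; [exact: slt|exact: vc].
  by apply: (cvgr_gt _ H); rewrite /= subr_gt0.
near=> q.
have A1 : 0 < q.2.2 - S q.1 q.2.1 (y0 - e) by near: q.
have A2 : 0 < S q.1 q.2.1 (y0 + e) - q.2.2 by near: q.
have Sm' l x y y' : S l x y < S l x y' -> y < y'.
  by move=> h; rewrite ltNge; apply/negP; rewrite le_eqVlt => /predU1P[ee|/(Sm l x)];
    [move: h; rewrite ee ltxx|move/(lt_trans h); rewrite ltxx].
have B1 : y0 - e < unc W q.
  by apply: (Sm' q.1 q.2.1); rewrite /unc SW; lra.
have B2 : unc W q < y0 + e.
  by apply: (Sm' q.1 q.2.1); rewrite /unc SW; lra.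
by rewrite ltr_norml; lra.
Unshelve. all: by end_near. Qed.

Lemma increasing_of_dy (S : T -> R -> R -> R) : Cinf S ->
  (forall l x y, 0 < dy S l x y) -> forall l x y y', y < y' -> S l x y < S l x y'.
Proof.
move=> Sc S0 l x y y' yy'; apply: (lt_drv (df := dy S l x) yy') => z _.
  exact: cls_dy (Sc 1%N).
exact: S0.
Qed.

Lemma cls_inverse1 (S : T -> R -> R -> R) : Cinf S ->
  (forall l x y, 0 < dy S l x y) -> (forall l x v, exists y, S l x y = v) ->
  exists W, [/\ Cinf W, forall l x v, S l x (W l x v) = v &
    forall l x y, W l x (S l x y) = y].
Proof.
move=> Sc S0 Ss.
have Sm := increasing_of_dy Sc S0.
pose W l x v := projT1 (cid (Ss l x v)).
have SW l x v : S l x (W l x v) = v by rewrite /W; case: cid.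
have Wc := monotone_inverse_cont (cls_cont (Sc 0%N)) Sm SW.
exists W; split => //; last first.
  move=> l x y; have := SW l x (S l x y).
  by have [/(Sm l x)|/(Sm l x)|//] := ltgtP (W l x (S l x y)) y; move=> /[swap] ->; rewrite ltxx.
(* The planar inversion is used with the first coordinate left alone; the determinant is then
   [dy S]. *)
have [] := @cls_inverse (fun _ x _ => x) S (fun _ x _ => x) W.
- by move=> k; exact: clsX.
- exact: Sc.
- exact: cont_x.
- exact: Wc.
- by [].
- exact: SW.
- move=> l x y; have -> : dx (fun (_ : T) (x : R) (_ : R) => x) l x y = 1 by exact: dx_eq (drvI x).
  have -> : dy (fun (_ : T) (x : R) (_ : R) => x) l x y = 0 by exact: dy_eq (drvC x y).
  rewrite mul1r mul0r subr0.
  by rewrite gt_eqF//; exact: S0.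
- by [].
Qed.

(** Supplies bounds that must vary continuously with the parameter. The maximising point may jump,
    but the maximum does not, since neighbouring slices are uniformly close on the segment. *)
Lemma continuous_majorant (q : T -> R -> R) :
  continuous (fun z : T * R => q z.1 z.2) ->
  exists2 M : T -> R, continuous M & forall l x, -1 <= x <= 1 -> `|q l x| <= M l.
Proof.
move=> qc.
have qs l : continuous (q l).
  move=> x; apply: (@continuous_comp _ _ _ (fun x => (l, x)) (fun z : T * R => q z.1 z.2)).
    by apply: continuous_pair_at; [exact: cvg_cst|exact: cvg_id].
  exact: qc.
have mx l : exists2 c : R, -1 <= c <= 1 & forall x, -1 <= x <= 1 -> `|q l x| <= `|q l c|.
  have [||c] := @EVT_max R (fun x => `|q l x|) (-1) 1.
  - by rewrite -subr_ge0 opprK.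
  - apply: continuous_subspaceT => x; apply: continuous_comp; first exact: qs.
    exact: norm_continuous.
  rewrite in_itv /= => c1 H; exists c => // x x1; exact: H.
pose M l := `|q l (projT1 (cid2 (mx l)))|.
have MP l x : -1 <= x <= 1 -> `|q l x| <= M l by rewrite /M; case: cid2 => c /= _; exact.
have Mex l : exists2 c : R, -1 <= c <= 1 & M l = `|q l c|.
  by rewrite /M; case: cid2 => c /= c1 _; exists c.
exists M => //.
move=> l0; apply/cvgrPdist_lt => e e0.
have e2 : 0 < e / 2 by rewrite divr_gt0.
have := @segment_tube R T q l0 (-1) 1 (fun x _ => qc (l0, x)) _ e2.
apply: filterS => l lP.
have close x : -1 <= x <= 1 -> `| `|q l x| - `|q l0 x| | < e / 2.
  by move=> x1; apply: le_lt_trans (ler_dist_dist _ _) (lP x x1).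
have [c c1 Ec] := Mex l; have [c' c1' Ec'] := Mex l0.
have := close c c1; have := close c' c1'; have := MP l c' c1'; have := MP l0 c c1.
rewrite -Ec -Ec' !ltr_norml; lra.
Qed.

End Inverse.

Opaque dx dy.

(** * Orbits of a planar vector field *)

Section Estimates.
Variable R : realType.
Implicit Types (x y t s A K D L eps : R).

Lemma norm_le_sq x y : 0 <= y -> x ^+ 2 <= y ^+ 2 -> `|x| <= y.
Proof.
move=> y0 xy; rewrite -(@ler_pXn2r _ 2) ?nnegrE//.
by rewrite real_normK ?num_real.
Qed.

(* Comparison in the norm weighted by exp (- K |t|), for which the Picard
   iteration contracts on the whole line. *)
Lemma exp_compare (f df : R -> R) A K : 0 < K ->
  f 0 = 0 -> (forall t, drv f t (df t)) ->
  (forall t, `|df t| <= A * K * expR (K * `|t|)) ->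
  forall t, `|f t| <= A * expR (K * `|t|).
Proof.
move=> K0 f0 fd dfb.
have A0 : 0 <= A.
  have := dfb 0; rewrite normr0 mulr0 expR0 mulr1 => H.
  by rewrite -(pmulr_lge0 _ K0) (le_trans _ H).
have main (g dg : R -> R) : g 0 = 0 -> (forall t, drv g t (dg t)) ->
    (forall t, `|dg t| <= A * K * expR (K * `|t|)) ->
    forall t, 0 <= t -> g t <= A * expR (K * t).
  move=> g0 gd dgb t t0; rewrite -subr_ge0.
  apply: (@le_trans _ _ (A * expR (K * 0) - g 0)).
    by rewrite g0 mulr0 expR0 mulr1 subr0.
  apply: (@le_drv _ (fun s => A * expR (K * s) - g s) _ _ _ t0) => s.
    move=> _; apply: drvB (gd s).
    exact: drvZ A (drv_expf (drvZ K (drvI s))).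
  move=> /andP[s0 _]; have := dgb s; rewrite (ger0_norm s0) => H.
  have := le_trans (ler_norm _) H.
  rewrite mulr1 subr_ge0 => {}H; apply: le_trans H _.
  by rewrite le_eqVlt; apply/orP; left; apply/eqP; ring.
move=> t; have [t0|t0] := leP 0 t.
  rewrite (ger0_norm t0) ler_norml; apply/andP; split; last exact: (main f df).
  rewrite -lerNl; apply: (main (fun s => - f s) (fun s => - df s)) => //.
  - by rewrite f0 oppr0.
  - by move=> s; exact: drvN.
  - by move=> s; rewrite normrN.
have tn : 0 <= - t by rewrite oppr_ge0 ltW.
have rev s : drv (fun s => f (- s)) s (df (- s) * - 1).
  exact: (drv_comp (fd (- s)) (drvN (drvI s))).
rewrite (ltr0_norm t0) ler_norml; apply/andP; split.
  rewrite -lerNl -{1}(opprK t).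
  apply: (main (fun s => - f (- s)) (fun s => - (df (- s) * - 1))) => //.
  - by rewrite !oppr0 f0 oppr0.
  - by move=> s; exact: drvN.
  - by move=> s; rewrite mulrN1 opprK -(normrN s).
rewrite -{1}(opprK t).
apply: (main (fun s => f (- s)) (fun s => df (- s) * - 1)) => //.
- by rewrite oppr0.
- by move=> s; rewrite mulrN1 normrN -(normrN s).
Qed.

(** Nested intervals: [lo] increases, [hi] decreases, and the limit is the supremum of [lo]. The
    radius [2 * D * 2^-1 ^+ n] is the sum of all remaining steps. *)
Lemma geometric_limit (v : nat -> R) D : 0 <= D ->
  (forall n, `|v n.+1 - v n| <= D * 2^-1 ^+ n) ->
  exists l, forall n, `|l - v n| <= 2 * D * 2^-1 ^+ n.
Proof.
move=> D0 vD.
pose lo n := v n - 2 * D * 2^-1 ^+ n; pose hi n := v n + 2 * D * 2^-1 ^+ n.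
have p0 n : 0 <= D * 2^-1 ^+ n by rewrite mulr_ge0// exprn_ge0// invr_ge0.
have loS n : lo n <= lo n.+1.
  by have := vD n; have := p0 n; rewrite /lo exprS ler_norml; lra.
have hiS n : hi n.+1 <= hi n.
  by have := vD n; have := p0 n; rewrite /hi exprS ler_norml; lra.
have lohi n : lo n <= hi n by have := p0 n; rewrite /lo /hi; lra.
have mono n m : lo n <= hi m.
  have lon k : lo n <= lo (n + k)%N.
    by elim: k => [|k IH]; [rewrite addn0|rewrite addnS; exact: le_trans (loS _)].
  have him k : hi (m + k)%N <= hi m.
    by elim: k => [|k IH]; [rewrite addn0|rewrite addnS; exact: le_trans (hiS _) _].
  by apply: le_trans (lon m) _; rewrite addnC; apply: le_trans (lohi _) (him n).
pose S := [set lo n | n in setT].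
have hS : has_sup S.
  by split; [exists (lo 0%N), 0%N|exists (hi 0%N) => _ [n _ <-]].
exists (sup S) => n; rewrite ler_norml; apply/andP; split.
  have : lo n <= sup S by apply: ub_le_sup; [exact: hS.2|exists n].
  by rewrite /lo; lra.
have : sup S <= hi n by apply: ge_sup; [exact: hS.1|move=> _ [m _ <-]].
by rewrite /hi; lra.
Qed.

Lemma le_of_geometric x y D : 0 <= D -> (forall n, x <= y + D * 2^-1 ^+ n) -> x <= y.
Proof.
move=> D0 H; apply/ler_addgt0Pr => e e0.
have h : (2^-1 : R) ^+ n @[n --> \oo] --> 0.
  by apply: cvg_expr; rewrite ger0_norm ?invr_ge0// invf_lt1// ltr1n.
have e1 : 0 < e / (D + 1) by rewrite divr_gt0// ltr_wpDl.
have /cvgrPdist_lt /(_ _ e1) [n _ /(_ n (leqnn n))] := h.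
rewrite /= sub0r normrN ger0_norm ?exprn_ge0 ?invr_ge0// => hn.
apply: le_trans (H n) _; rewrite lerD2l.
have D1 : 0 < D + 1 by rewrite ltr_wpDl.
apply: (@le_trans _ _ ((D + 1) * (e / (D + 1)))).
  by apply: ler_pM; [|rewrite exprn_ge0// invr_ge0|rewrite lerDl|exact: ltW].
by rewrite le_eqVlt; apply/orP; left; apply/eqP; field; rewrite gt_eqF.
Qed.

Definition Lip (W : R -> R -> R) (L : R) :=
  forall x y x' y', `|W x y - W x' y'| <= L * (`|x - x'| + `|y - y'|).

Lemma Lip_cont (W : R -> R -> R) L (f g : R -> R) : 0 <= L -> Lip W L ->
  continuous f -> continuous g -> continuous (fun t => W (f t) (g t)).
Proof.
move=> L0 WL fc gc t; apply/cvgrPdist_lt => e e0.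
pose L1 := 2 * (L + 1).
have L10 : 0 < L1 by rewrite mulr_gt0// ltr_wpDl.
have e1 : 0 < e / L1 by rewrite divr_gt0.
have /cvgrPdist_lt /(_ _ e1) fe := fc t.
have /cvgrPdist_lt /(_ _ e1) ge := gc t.
near=> s.
have fs : `|f t - f s| < e / L1 by near: s; exact: fe.
have gs : `|g t - g s| < e / L1 by near: s; exact: ge.
apply: le_lt_trans (WL _ _ _ _) _.
apply: (@le_lt_trans _ _ (L * (e / L1 + e / L1))).
  by rewrite ler_wpM2l// lerD// ltW.
have -> : L * (e / L1 + e / L1) = e * (L / (L + 1)).
  by rewrite /L1; field; rewrite gt_eqF// ltr_wpDl.
have L1' : 0 < L + 1 by rewrite ltr_wpDl.
by rewrite -[ltRHS]mulr1 ltr_pM2l// ltr_pdivrMr// mul1r ltrDl.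
Unshelve. all: by end_near. Qed.

Lemma picard (W1 W2 : R -> R -> R) L (p1 p2 : R) : 0 < L ->
  Lip W1 L -> Lip W2 L ->
  (forall x y, `|W1 x y| <= L) -> (forall x y, `|W2 x y| <= L) ->
  exists g1 g2 : R -> R, [/\ g1 0 = p1, g2 0 = p2,
    forall t, drv g1 t (W1 (g1 t) (g2 t)) & forall t, drv g2 t (W2 (g1 t) (g2 t))].
Proof.
move=> L0 L1 L2 B1 B2.
pose step (u : (R -> R) * (R -> R)) : (R -> R) * (R -> R) :=
  (fun t => p1 + prim (fun s => W1 (u.1 s) (u.2 s)) 0 t,
   fun t => p2 + prim (fun s => W2 (u.1 s) (u.2 s)) 0 t).
pose good (u : (R -> R) * (R -> R)) := continuous u.1 /\ continuous u.2.
have stepD u : good u ->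
    (forall t, drv (step u).1 t (W1 (u.1 t) (u.2 t))) /\
    (forall t, drv (step u).2 t (W2 (u.1 t) (u.2 t))).
  move=> [c1 c2]; split=> t.
    apply: drv_eq (drvD (drvC p1 t) (drv_prim 0 t (Lip_cont (ltW L0) L1 c1 c2))) _.
    by rewrite add0r.
  apply: drv_eq (drvD (drvC p2 t) (drv_prim 0 t (Lip_cont (ltW L0) L2 c1 c2))) _.
  by rewrite add0r.
have step0 u : (step u).1 0 = p1 /\ (step u).2 0 = p2.
  by rewrite /step /= !prim0 !addr0.
have stepG u : good u -> good (step u).
  move=> gu; have [d1 d2] := stepD u gu; split; [exact: drv_continuous d1|exact: drv_continuous d2].
(* A Lipschitz bound in two coordinates gives [2 * L * A = A / 2 * K], so one Picard step halves the
   weighted distance. *)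
pose K := 4 * L.
have K0 : 0 < K by rewrite mulr_gt0.
have stepC u v A : good u -> good v ->
    (forall t, `|u.1 t - v.1 t| <= A * expR (K * `|t|) /\ `|u.2 t - v.2 t| <= A * expR (K * `|t|)) ->
    forall t, `|(step u).1 t - (step v).1 t| <= A / 2 * expR (K * `|t|) /\
              `|(step u).2 t - (step v).2 t| <= A / 2 * expR (K * `|t|).
  move=> gu gv uv t.
  have [du1 du2] := stepD u gu; have [dv1 dv2] := stepD v gv.
  have [su1 su2] := step0 u; have [sv1 sv2] := step0 v.
  have est (W : R -> R -> R) s : Lip W L ->
      `|W (u.1 s) (u.2 s) - W (v.1 s) (v.2 s)| <= A / 2 * K * expR (K * `|s|).
    move=> WL; apply: le_trans (WL _ _ _ _) _.
    have [a b] := uv s.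
    rewrite [leRHS](_ : _ = L * (A * expR (K * `|s|) + A * expR (K * `|s|))).
      by rewrite ler_pM2l// lerD.
    by rewrite /K; field.
  split.
    apply: (@exp_compare (fun t => (step u).1 t - (step v).1 t)
      (fun s => W1 (u.1 s) (u.2 s) - W1 (v.1 s) (v.2 s)) _ _ K0).
    - by rewrite su1 sv1 subrr.
    - by move=> s; exact: drvB.
    - by move=> s; exact: est.
  apply: (@exp_compare (fun t => (step u).2 t - (step v).2 t)
    (fun s => W2 (u.1 s) (u.2 s) - W2 (v.1 s) (v.2 s)) _ _ K0).
  - by rewrite su2 sv2 subrr.
  - by move=> s; exact: drvB.
  - by move=> s; exact: est.
pose u n := iter n step (fun=> p1, fun=> p2).
have uG n : good (u n).
  elim: n => [|n IH]; last exact: stepG.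
  by split=> t; exact: cvg_cst.
pose C := L / K.
have C0 : 0 <= C by rewrite divr_ge0 ?ltW.
have uC n t : `|(u n.+1).1 t - (u n).1 t| <= C * 2^-1 ^+ n * expR (K * `|t|) /\
              `|(u n.+1).2 t - (u n).2 t| <= C * 2^-1 ^+ n * expR (K * `|t|).
  elim: n t => [|n IH] t; last first.
    have := @stepC (u n.+1) (u n) (C * 2^-1 ^+ n) (uG _) (uG _) IH t.
    by rewrite exprSr mulrA.
  have [d1 d2] := stepD (u 0%N) (uG _); have [s1 s2] := step0 (u 0%N).
  have e1 : forall s : R, 1 <= expR (K * `|s|).
    by move=> s; rewrite -expR0 ler_expR mulr_ge0// ltW.
  have LE (s : R) : L <= C * 2^-1 ^+ 0 * K * expR (K * `|s|).
    rewrite expr0 mulr1 /C divfK ?gt_eqF//.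
    by apply: ler_peMr; [exact: ltW|exact: e1].
  split.
    apply: (@exp_compare (fun t => (u 1%N).1 t - p1) (fun s => W1 p1 p2) _ _ K0).
    - by rewrite s1 subrr.
    - by move=> s; apply: drv_eq (drvB (d1 s) (drvC _ _)) _; rewrite subr0.
    - by move=> s; exact: le_trans (B1 _ _) (LE s).
  apply: (@exp_compare (fun t => (u 1%N).2 t - p2) (fun s => W2 p1 p2) _ _ K0).
  - by rewrite s2 subrr.
  - by move=> s; apply: drv_eq (drvB (d2 s) (drvC _ _)) _; rewrite subr0.
  - by move=> s; exact: le_trans (B2 _ _) (LE s).
have lim1 t : exists l, forall n, `|l - (u n).1 t| <= 2 * (C * expR (K * `|t|)) * 2^-1 ^+ n.
  apply: geometric_limit; first by rewrite mulr_ge0// expR_ge0.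
  by move=> n; rewrite mulrAC; have [] := uC n t.
have lim2 t : exists l, forall n, `|l - (u n).2 t| <= 2 * (C * expR (K * `|t|)) * 2^-1 ^+ n.
  apply: geometric_limit; first by rewrite mulr_ge0// expR_ge0.
  by move=> n; rewrite mulrAC; have [] := uC n t.
pose w : (R -> R) * (R -> R) := (fun t => projT1 (cid (lim1 t)), fun t => projT1 (cid (lim2 t))).
have wu n t : `|w.1 t - (u n).1 t| <= 2 * (C * 2^-1 ^+ n) * expR (K * `|t|) /\
              `|w.2 t - (u n).2 t| <= 2 * (C * 2^-1 ^+ n) * expR (K * `|t|).
  split.
    have H : `|w.1 t - (u n).1 t| <= 2 * (C * expR (K * `|t|)) * 2^-1 ^+ n.
      by rewrite /w /=; case: cid.
    by apply: le_trans H _; rewrite le_eqVlt; apply/orP; left; apply/eqP; ring.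
  have H : `|w.2 t - (u n).2 t| <= 2 * (C * expR (K * `|t|)) * 2^-1 ^+ n.
    by rewrite /w /=; case: cid.
  by apply: le_trans H _; rewrite le_eqVlt; apply/orP; left; apply/eqP; ring.
have lipu n s t : `|(u n).1 s - (u n).1 t| <= L * `|s - t| /\ `|(u n).2 s - (u n).2 t| <= L * `|s - t|.
  case: n => [|n]; first by rewrite /= !subrr normr0 mulr_ge0// ltW.
  have [d1 d2] := stepD (u n) (uG _).
  have [c1 _ E1] := mvt_abs t s d1; have [c2 _ E2] := mvt_abs t s d2.
  by rewrite [u n.+1]/= E1 E2 !normrM !ler_wpM2r.
have contlip (f : R -> R) : (forall s t, `|f s - f t| <= L * `|s - t|) -> continuous f.
  move=> fL t; apply/cvgrPdist_lt => e e0; apply/nbhs_ballP; exists (e / L) => /=.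
    by rewrite divr_gt0.
  by move=> s; rewrite /ball /= ltr_pdivlMr// mulrC; exact: le_lt_trans.
have pick (f : R -> R) (un : nat -> R -> R) :
    (forall n t, `|f t - un n t| <= 2 * (C * 2^-1 ^+ n) * expR (K * `|t|)) ->
    (forall n s t, `|un n s - un n t| <= L * `|s - t|) -> continuous f.
  move=> fu ul; apply: contlip => s t.
  apply: (@le_of_geometric _ _ (2 * C * expR (K * `|s|) + 2 * C * expR (K * `|t|))).
    by rewrite addr_ge0// mulr_ge0 ?expR_ge0// mulr_ge0.
  move=> n; have := fu n s; have := fu n t; have := ul n s t.
  rewrite !ler_norml; lra.
have wG : good w.
  split.
    by apply: (pick _ (fun n => (u n).1)) => [n t|n s t]; [have [] := wu n t|have [] := lipu n s t].
  by apply: (pick _ (fun n => (u n).2)) => [n t|n s t]; [have [] := wu n t|have [] := lipu n s t].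
have fixw t : (step w).1 t = w.1 t /\ (step w).2 t = w.2 t.
  have H n : `|(step w).1 t - w.1 t| <= 4 * C * expR (K * `|t|) * 2^-1 ^+ n /\
             `|(step w).2 t - w.2 t| <= 4 * C * expR (K * `|t|) * 2^-1 ^+ n.
    have [a1 a2] := @stepC w (u n) _ wG (uG n) (wu n) t.
    have [b1 b2] := wu n.+1 t.
    move: a1 a2 b1 b2; rewrite -[step (u n)]/(u n.+1) exprSr.
    have x0 : 0 <= C * 2^-1 ^+ n * expR (K * `|t|).
      apply: mulr_ge0; last exact: expR_ge0.
      by apply: mulr_ge0; [exact: C0|apply: exprn_ge0; rewrite invr_ge0 ler0n].
    rewrite !ler_norml; lra.
  have E0 : 0 <= 4 * C * expR (K * `|t|) by apply: mulr_ge0; [exact: mulr_ge0|exact: expR_ge0].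
  split; apply/eqP; rewrite -subr_eq0 -normr_le0; apply: (le_of_geometric E0) => n;
    rewrite add0r; by have [] := H n.
have [d1 d2] := stepD w wG; have [s1 s2] := step0 w.
have e1 : (step w).1 = w.1 by apply/funext => t; have [] := fixw t.
have e2 : (step w).2 = w.2 by apply/funext => t; have [] := fixw t.
by exists w.1, w.2; split; rewrite -?e1 -?e2//; rewrite ?e1 ?e2 // => t;
  [rewrite -{1}e1|rewrite -{1}e2].
Qed.

(** Sums of squares are differentiable where norms are not. In the rate, [4 * L] comes from
    [2 * L * (a + b) ^+ 2], and 1 from the cross terms [2 * a * eps + 2 * b * eps], whose remainder
    [2 * eps ^+ 2] is the constant added to the energy. *)
Lemma gronwall (d1 d2 e1 e2 : R -> R) (t0 t1 L eps : R) : 0 <= L -> 0 <= eps ->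
  (forall t, t0 <= t <= t1 -> drv d1 t (e1 t)) ->
  (forall t, t0 <= t <= t1 -> drv d2 t (e2 t)) ->
  (forall t, t0 <= t <= t1 -> `|e1 t| <= L * (`|d1 t| + `|d2 t|) + eps) ->
  (forall t, t0 <= t <= t1 -> `|e2 t| <= L * (`|d1 t| + `|d2 t|) + eps) ->
  forall t, t0 <= t <= t1 -> d1 t ^+ 2 + d2 t ^+ 2 <=
    (d1 t0 ^+ 2 + d2 t0 ^+ 2 + 2 * eps ^+ 2) * expR ((4 * L + 1) * (t - t0)).
Proof.
move=> L0 eps0 D1 D2 E1 E2 t /andP[t0t tt1].
set k := 4 * L + 1.
pose N s := (d1 s * d1 s + d2 s * d2 s + 2 * eps ^+ 2) * expR (- k * (s - t0)).
have inr s : t0 <= s <= t -> t0 <= s <= t1.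
  by move=> /andP[-> st] /=; exact: le_trans tt1.
have : N t <= N t0.
  rewrite -lerN2.
  pose E s := (e1 s * d1 s + d1 s * e1 s + (e2 s * d2 s + d2 s * e2 s)) - k * (d1 s * d1 s + d2 s * d2 s + 2 * eps ^+ 2).
  apply: (@le_drv _ (fun s => - N s) (fun s => - (E s * expR (- k * (s - t0)))) _ _ t0t).
    move=> s /inr st; apply: drvN.
    apply: (@drv_eq _ N s _ _ (drvM (drvD (drvD (drvM (D1 s st) (D1 s st)) (drvM (D2 s st) (D2 s st))) (drvC (2 * eps ^+ 2) s))
      (drv_expf (drvZ (- k) (drvB (drvI s) (drvC t0 s)))))).
    by rewrite /E; ring.
  move=> s /inr st; rewrite -mulNr mulr_ge0 ?expR_ge0// oppr_ge0 /E subr_le0.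
  have h1 := E1 s st; have h2 := E2 s st.
  set a := `|d1 s| in h1 h2; set b := `|d2 s| in h1 h2.
  have a0 : 0 <= a by exact: normr_ge0.
  have b0 : 0 <= b by exact: normr_ge0.
  have aa : d1 s * d1 s = a ^+ 2 by rewrite -expr2 /a real_normK ?num_real.
  have bb : d2 s * d2 s = b ^+ 2 by rewrite -expr2 /b real_normK ?num_real.
  have m1 : e1 s * d1 s <= a * (L * (a + b) + eps).
    by apply: le_trans (ler_norm _) _; rewrite normrM mulrC ler_wpM2l.
  have m2 : e2 s * d2 s <= b * (L * (a + b) + eps).
    by apply: le_trans (ler_norm _) _; rewrite normrM mulrC ler_wpM2l.
  rewrite aa bb (mulrC (d1 s)) (mulrC (d2 s)) /k.
  apply: (@le_trans _ _ (2 * (a * (L * (a + b) + eps)) + 2 * (b * (L * (a + b) + eps)))).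
    lra.
  have q1 : 0 <= L * (a - b) ^+ 2 by rewrite mulr_ge0// sqr_ge0.
  have q2 : 0 <= (a - eps) ^+ 2 by exact: sqr_ge0.
  have q3 : 0 <= (b - eps) ^+ 2 by exact: sqr_ge0.
  have q4 : 0 <= L * eps ^+ 2 by rewrite mulr_ge0// sqr_ge0.
  nra.
rewrite /N subrr mulr0 expR0 mulr1 mulNr expRN -!expr2.
rewrite ler_pdivrMr ?expR_gt0// => H.
by apply: le_trans H; rewrite lerDl mulr_ge0// sqr_ge0.
Qed.

Lemma gronwall2 (d1 d2 e1 e2 : R -> R) (t0 D L eps : R) : 0 <= L -> 0 <= eps ->
  (forall t, drv d1 t (e1 t)) -> (forall t, drv d2 t (e2 t)) ->
  (forall t, `|t - t0| <= D -> `|e1 t| <= L * (`|d1 t| + `|d2 t|) + eps) ->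
  (forall t, `|t - t0| <= D -> `|e2 t| <= L * (`|d1 t| + `|d2 t|) + eps) ->
  forall t, `|t - t0| <= D -> d1 t ^+ 2 + d2 t ^+ 2 <=
    (d1 t0 ^+ 2 + d2 t0 ^+ 2 + 2 * eps ^+ 2) * expR ((4 * L + 1) * D).
Proof.
move=> L0 eps0 D1 D2 E1 E2 t tD.
have D0 : 0 <= D by exact: le_trans tD.
have k0 : 0 <= 4 * L + 1 by rewrite addr_ge0// mulr_ge0.
have c0 : 0 <= d1 t0 ^+ 2 + d2 t0 ^+ 2 + 2 * eps ^+ 2.
  by rewrite !addr_ge0 ?sqr_ge0// mulr_ge0// sqr_ge0.
have [t0t|/ltW tt0] := leP t0 t.
  have inr s : t0 <= s <= t0 + D -> `|s - t0| <= D.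
    by move=> /andP[a b]; rewrite ger0_norm; lra.
  move: tD; rewrite ger0_norm ?subr_ge0// => tD.
  apply: le_trans (@gronwall d1 d2 e1 e2 t0 (t0 + D) L eps L0 eps0
      (fun s _ => D1 s) (fun s _ => D2 s)
      (fun s h => E1 s (inr s h)) (fun s h => E2 s (inr s h)) t _) _.
    by rewrite t0t; lra.
  by apply: ler_wpM2l => //; rewrite ler_expR ler_wpM2l.
have rev (f df : R -> R) s : (forall t, drv f t (df t)) ->
    drv (fun s => f (t0 - s)) s (- df (t0 - s)).
  move=> fd; apply: drv_eq (@drv_comp _ f (fun s => t0 - s) s _ _ (fd (t0 - s)) (drvB (drvC t0 s) (drvI s))) _.
  by rewrite sub0r mulrN1.
have inr s : 0 <= s <= D -> `|t0 - s - t0| <= D.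
  move=> /andP[a b]; rewrite addrAC subrr add0r normrN ger0_norm//.
move: tD; rewrite ler0_norm ?subr_le0// opprB => tD.
have := @gronwall (fun s => d1 (t0 - s)) (fun s => d2 (t0 - s))
  (fun s => - e1 (t0 - s)) (fun s => - e2 (t0 - s)) 0 D L eps L0 eps0
  (fun s _ => rev _ _ s D1) (fun s _ => rev _ _ s D2) _ _ (t0 - t) _.
rewrite subr0 subKr subr0 => H; apply: le_trans (H _ _ _) _.
- by move=> s /inr h; rewrite normrN; exact: E1.
- by move=> s /inr h; rewrite normrN; exact: E2.
- by rewrite subr_ge0 tt0.
by apply: ler_wpM2l => //; rewrite ler_expR ler_wpM2l.
Qed.

Lemma ode_unique (W1 W2 : R -> R -> R) L (g1 g2 h1 h2 : R -> R) t0 t1 : 0 <= L ->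
  Lip W1 L -> Lip W2 L ->
  (forall t, t0 <= t <= t1 -> drv g1 t (W1 (g1 t) (g2 t))) ->
  (forall t, t0 <= t <= t1 -> drv g2 t (W2 (g1 t) (g2 t))) ->
  (forall t, t0 <= t <= t1 -> drv h1 t (W1 (h1 t) (h2 t))) ->
  (forall t, t0 <= t <= t1 -> drv h2 t (W2 (h1 t) (h2 t))) ->
  g1 t0 = h1 t0 -> g2 t0 = h2 t0 ->
  forall t, t0 <= t <= t1 -> g1 t = h1 t /\ g2 t = h2 t.
Proof.
move=> L0 L1 L2 G1 G2 H1 H2 i1 i2 t tt.
have := @gronwall (fun t => g1 t - h1 t) (fun t => g2 t - h2 t)
  (fun t => W1 (g1 t) (g2 t) - W1 (h1 t) (h2 t))
  (fun t => W2 (g1 t) (g2 t) - W2 (h1 t) (h2 t)) t0 t1 L 0 L0 (lexx 0)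
  (fun t h => drvB (G1 t h) (H1 t h)) (fun t h => drvB (G2 t h) (H2 t h)) _ _ t tt.
rewrite i1 i2 !subrr expr0n /= mulr0 !addr0 mul0r => H.
have {}H : (g1 t - h1 t) ^+ 2 + (g2 t - h2 t) ^+ 2 <= 0.
  by apply: H => s _; rewrite addr0; [exact: L1|exact: L2].
have z1 := sqr_ge0 (g1 t - h1 t); have z2 := sqr_ge0 (g2 t - h2 t).
have y1 : (g1 t - h1 t) ^+ 2 = 0 by lra.
have y2 : (g2 t - h2 t) ^+ 2 = 0 by lra.
by split; apply/eqP; rewrite -subr_eq0 -sqrf_eq0 ?y1 ?y2.
Qed.

End Estimates.

(** * Functions that are constant outside the box *)

Section BoxLipschitz.
Variable R : realType.

Lemma box_bounded (b : R -> R -> R) : continuous (fun p : R * R => b p.1 p.2) ->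
  exists B, forall x y, -1 <= x <= 1 -> -1 <= y <= 1 -> `|b x y| <= B.
Proof.
move=> bc.
have bc' : continuous (fun z : R * R => b z.2 z.1).
  move=> z; apply: (@continuous_comp _ _ _ (fun z : R * R => (z.2, z.1)) (fun p : R * R => b p.1 p.2)).
    by apply: continuous_pair_at; [exact: cvg_snd|exact: cvg_fst].
  exact: bc.
have [M Mc MP] := @continuous_majorant R R (fun y x => b x y) bc'.
have Mc' : continuous (fun z : R * R => M z.2).
  by move=> z; apply: continuous_comp; [exact: cvg_snd|exact: Mc].
have [N _ NP] := @continuous_majorant R R (fun _ y => M y) Mc'.
exists (N 0) => x y x1 y1; apply: le_trans (MP y x x1) _.
exact: le_trans (ler_norm _) (NP 0 y y1).
Qed.

Variable T : topologicalType.

Lemma cont_slice (a : T -> R -> R -> R) l : continuous (unc a) ->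
  continuous (fun p : R * R => a l p.1 p.2).
Proof. by move=> ac [x y]; exact: cont_pt. Qed.

Definition outside (x y : R) := 1 <= `|x| \/ 1 <= `|y|.

Lemma insideP (x y : R) : outside x y \/ (-1 <= x <= 1 /\ -1 <= y <= 1).
Proof.
have [x1|x1] := leP 1 `|x|; first by left; left.
have [y1|y1] := leP 1 `|y|; first by left; right.
by right; rewrite -!ler_norml !ltW.
Qed.

Lemma near_norm_gt1 (x : R) : 1 < `|x| -> \forall s \near x, 1 <= `|s|.
Proof.
move=> x1.
have /cvgrPdist_lt H := @norm_continuous R R x.
have e0 : 0 < `|x| - 1 by rewrite subr_gt0.
apply: filterS (H _ e0) => s; rewrite ltr_norml; lra.
Qed.

(** Compactness bounds the derivatives on the closed box; strictly beyond it they vanish. *)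
Lemma box_derivatives (a : T -> R -> R -> R) (c0 : R) l : cls 1 a ->
  (forall x y, outside x y -> a l x y = c0) ->
  exists2 B, 0 < B & forall x y, `|dx a l x y| <= B /\ `|dy a l x y| <= B.
Proof.
move=> ac aout.
have [B1 B1P] := box_bounded (cont_slice (l := l) (cls_cont (clsdx ac))).
have [B2 B2P] := box_bounded (cont_slice (l := l) (cls_cont (clsdy ac))).
exists (`|B1| + `|B2| + 1); first by rewrite ltr_wpDl// addr_ge0.
have n1 := normr_ge0 B1; have n2 := normr_ge0 B2.
move=> x y.
have far : 1 < `|x| \/ 1 < `|y| -> dx a l x y = 0 /\ dy a l x y = 0.
  move=> xy; split.
    apply: dx_eq; apply: (@near_drv _ (fun=> c0)); last exact: drvC.
    case: xy => [x1|y1]; last by apply: filterE => s; rewrite aout//; right; exact: ltW.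
    by apply: filterS (near_norm_gt1 x1) => s s1; rewrite aout//; left.
  apply: dy_eq; apply: (@near_drv _ (fun=> c0)); last exact: drvC.
  case: xy => [x1|y1]; first by apply: filterE => s; rewrite aout//; left; exact: ltW.
  by apply: filterS (near_norm_gt1 y1) => s s1; rewrite aout//; right.
have [x1|x1] := ltP 1 `|x|.
  by have [-> ->] := far (or_introl x1); rewrite normr0; split; lra.
have [y1|y1] := ltP 1 `|y|.
  by have [-> ->] := far (or_intror y1); rewrite normr0; split; lra.
rewrite !ler_norml in x1 y1.
have h1 := B1P x y x1 y1; have h2 := B2P x y x1 y1.
have h3 := ler_norm B1; have h4 := ler_norm B2.
by split; lra.
Qed.

Lemma box_lipschitz (a : T -> R -> R -> R) (c0 : R) l : cls 1 a ->
  (forall x y, outside x y -> a l x y = c0) ->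
  exists2 L, 0 < L & Lip (a l) L /\ forall x y, `|a l x y| <= L.
Proof.
move=> ac aout.
have [B B0 BP] := box_derivatives ac aout.
have [C CP] := box_bounded (cont_slice (l := l) (cls_cont ac)).
have n1 := normr_ge0 C; have n2 := normr_ge0 c0.
exists (B + `|C| + `|c0|); first lra.
split=> [x y x' y'|x y].
  have [c _ E] := mvt_abs x' x (fun s => cls_dx l s y ac).
  have [c' _ E'] := mvt_abs y' y (fun s => cls_dy l x' s ac).
  rewrite (_ : a l x y - a l x' y' = (a l x y - a l x' y) + (a l x' y - a l x' y')); last by ring.
  rewrite E E'; apply: le_trans (ler_normD _ _) _; rewrite !normrM mulrDr.
  have [b1 _] := BP c y; have [_ b2] := BP x' c'.
  by apply: lerD; apply: ler_wpM2r => //; lra.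
case: (insideP x y) => [/aout ->|[x1 y1]]; first lra.
by have := CP x y x1 y1; have := ler_norm C; lra.
Qed.

End BoxLipschitz.

(** * The flow of a standard field and its variation *)

Section Flow.
Variables (R : realType) (T : topologicalType).
Implicit Types (l : T) (x y c t s : R).

Definition standard_field (W1 W2 : T -> R -> R -> R) :=
  [/\ Cinf W1, Cinf W2,
      forall l x y, outside x y -> W1 l x y = 0 /\ W2 l x y = 1 &
      forall l x y, 0 < W1 l x y ^+ 2 + W2 l x y ^+ 2].

Definition solution (W1 W2 : R -> R -> R) (g1 g2 : R -> R) :=
  (forall t, drv g1 t (W1 (g1 t) (g2 t))) /\ (forall t, drv g2 t (W2 (g1 t) (g2 t))).

Variables W1 W2 : T -> R -> R -> R.
Hypothesis SW : standard_field W1 W2.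

Let W1c : Cinf W1. Proof. by case: SW. Qed.
Let W2c : Cinf W2. Proof. by case: SW. Qed.

Lemma field_lipschitz l : exists2 L, 0 < L &
  [/\ Lip (W1 l) L, Lip (W2 l) L, forall x y, `|W1 l x y| <= L & forall x y, `|W2 l x y| <= L].
Proof.
have [_ _ Wo _] := SW.
have [L1 L10 [H1 B1]] := box_lipschitz (W1c 1%N) (fun x y h => (Wo l x y h).1).
have [L2 L20 [H2 B2]] := box_lipschitz (W2c 1%N) (fun x y h => (Wo l x y h).2).
exists (L1 + L2); first lra.
split.
- by move=> x y x' y'; apply: le_trans (H1 x y x' y') _; rewrite ler_wpM2r ?addr_ge0//; lra.
- by move=> x y x' y'; apply: le_trans (H2 x y x' y') _; rewrite ler_wpM2r ?addr_ge0//; lra.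
- by move=> x y; apply: le_trans (B1 x y) _; lra.
- by move=> x y; apply: le_trans (B2 x y) _; lra.
Qed.

Lemma orbit_exists l x y t0 : exists g1 g2 : R -> R,
  [/\ g1 t0 = x, g2 t0 = y & solution (W1 l) (W2 l) g1 g2].
Proof.
have [L L0 [H1 H2 B1 B2]] := field_lipschitz l.
have [g1 [g2 [i1 i2 D1 D2]]] := picard x y L0 H1 H2 B1 B2.
exists (fun t => g1 (t - t0)), (fun t => g2 (t - t0)).
have sh (f : R -> R) (t a : R) : drv f (t - t0) a -> drv (fun t => f (t - t0)) t a.
  move=> fa; apply: drv_eq (@drv_comp _ f (fun t => t - t0) t _ _ fa (drvB (drvI t) (drvC t0 t))) _.
  by rewrite subr0 mulr1.
by split; [rewrite subrr|rewrite subrr|split=> t; exact: sh].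
Qed.

(** The fields of all parameters coincide outside the box, so closeness on a compact square is
    closeness on the whole plane. *)
Lemma near_field l0 (e : R) : 0 < e -> \forall l \near l0, forall x y,
  `|W1 l x y - W1 l0 x y| <= e /\ `|W2 l x y - W2 l0 x y| <= e.
Proof.
move=> e0; have [_ _ Wo _] := SW.
have K : compact (`[(-1 : R), 1] `*` `[(-1 : R), 1]).
  by apply: compact_setX; exact: segment_compact.
have tb (a : T -> R -> R -> R) : Cinf a -> \forall l \near l0, forall p : R * R,
    (`[(-1 : R), 1] `*` `[(-1 : R), 1]) p -> `|a l p.1 p.2 - a l0 p.1 p.2| < e.
  move=> ac; apply: (@compact_tube R T (R * R)%type _ (fun l p => a l p.1 p.2) l0 K) => // p _.
  exact: (cls_cont (ac 0%N)).
apply: filterS2 (tb W1 W1c) (tb W2 W2c) => l H1 H2 x y.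
case: (insideP x y) => [xyo|[x1 y1]].
  by have [-> ->] := Wo l x y xyo; have [-> ->] := Wo l0 x y xyo; rewrite !subrr normr0 ltW.
have xy : (`[(-1 : R), 1] `*` `[(-1 : R), 1]) (x, y) by split; rewrite /= in_itv.
by split; apply: ltW; [exact: (H1 (x, y))|exact: (H2 (x, y))].
Qed.

Section GivenFlow.
Variables phi1 phi2 : T -> R -> R -> R.
Hypothesis phi10 : forall l c, phi1 l c (-1) = c.
Hypothesis phi20 : forall l c, phi2 l c (-1) = -1.
Hypothesis phiS : forall l c, solution (W1 l) (W2 l) (phi1 l c) (phi2 l c).

Let D1 l c t : drv (phi1 l c) t (W1 l (phi1 l c t) (phi2 l c t)).
Proof. by have [] := phiS l c. Qed.

Let D2 l c t : drv (phi2 l c) t (W2 l (phi1 l c t) (phi2 l c t)).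
Proof. by have [] := phiS l c. Qed.

Lemma flow_near l0 c0 B (e : R) : 0 < e -> exists2 d, 0 < d &
  \forall l \near l0, forall c, `|c - c0| < d -> forall t, `|t + 1| <= B ->
    `|phi1 l c t - phi1 l0 c0 t| <= e /\ `|phi2 l c t - phi2 l0 c0 t| <= e.
Proof.
move=> e0.
have [L L0 [H1 H2 _ _]] := field_lipschitz l0.
set E := expR ((4 * L + 1) * B).
have E0 : 0 < E by exact: expR_gt0.
(* Initial points and fields both differ by at most [eps], so Gronwall bounds the squared distance
   by [3 * eps ^+ 2 * E], and [eps <= 1] turns this into [3 * eps * E <= e ^+ 2]. *)
pose eps := Num.min 1 (e ^+ 2 / (3 * E)).
have s0 : 0 < e ^+ 2 by rewrite exprn_gt0.
have eps0 : 0 < eps by rewrite lt_min ltr01 divr_gt0// mulr_gt0.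
have eps1 : eps <= 1 by rewrite ge_min lexx.
have epsE : eps * (3 * E) <= e ^+ 2.
  by rewrite -ler_pdivlMr ?mulr_gt0// ge_min lexx orbT.
exists eps => //; apply: filterS (near_field l0 eps0) => l Hl c cc0 t tB.
have bnd (Wa Wb : R -> R -> R) x y x' y' : Lip Wb L ->
    `|Wa x y - Wb x y| <= eps -> `|Wa x y - Wb x' y'| <= L * (`|x - x'| + `|y - y'|) + eps.
  move=> WL Wab; rewrite -(subrKA (Wb x y)); apply: le_trans (ler_normD _ _) _.
  by rewrite addrC lerD.
have B' s : `|s - -1| <= B -> `|s + 1| <= B by rewrite opprK.
have := @gronwall2 R (fun t => phi1 l c t - phi1 l0 c0 t) (fun t => phi2 l c t - phi2 l0 c0 t)
  _ _ (-1) B L eps (ltW L0) (ltW eps0) (fun t => drvB (D1 l c t) (D1 l0 c0 t))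
  (fun t => drvB (D2 l c t) (D2 l0 c0 t)) _ _ t.
rewrite !phi10 !phi20 subrr expr0n /= addr0 opprK => H.
have {}H : (phi1 l c t - phi1 l0 c0 t) ^+ 2 + (phi2 l c t - phi2 l0 c0 t) ^+ 2 <=
    ((c - c0) ^+ 2 + 2 * eps ^+ 2) * E.
  apply: H => // s _; apply: bnd => //.
    by have [] := Hl (phi1 l c s) (phi2 l c s).
  by have [] := Hl (phi1 l c s) (phi2 l c s).
have c2 : (c - c0) ^+ 2 <= eps ^+ 2.
  by rewrite -real_normK ?num_real// ler_pXn2r// ?nnegrE ltW.
have F : ((c - c0) ^+ 2 + 2 * eps ^+ 2) * E <= e ^+ 2.
  apply: le_trans epsE; rewrite [leRHS](_ : _ = (3 * eps) * E); last by ring.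
  apply: ler_wpM2r; first exact: ltW.
  have : eps ^+ 2 <= eps by rewrite expr2 ler_piMr// ltW.
  lra.
have sq1 := sqr_ge0 (phi1 l c t - phi1 l0 c0 t).
have sq2 := sqr_ge0 (phi2 l c t - phi2 l0 c0 t).
by split; apply: norm_le_sq; [exact: ltW|lra|exact: ltW|lra].
Qed.

Lemma flow_cont : continuous (unc phi1) /\ continuous (unc phi2).
Proof.
suff H l0 c0 t0 (e : R) : 0 < e -> \forall q \near (l0, (c0, t0)),
    `|unc phi1 (l0, (c0, t0)) - unc phi1 q| < e /\ `|unc phi2 (l0, (c0, t0)) - unc phi2 q| < e.
  split=> -[l0 [c0 t0]]; apply/cvgrPdist_lt => e e0;
    by apply: filterS (H l0 c0 t0 e e0) => q [].
move=> e0; set B := `|t0 + 1| + 1.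
have e3 : 0 < e / 3 by rewrite divr_gt0.
have [d d0 N1] := flow_near l0 c0 B e3.
have C1 : {for t0, continuous (phi1 l0 c0)} by exact: drv_cont (D1 l0 c0 t0).
have C2 : {for t0, continuous (phi2 l0 c0)} by exact: drv_cont (D2 l0 c0 t0).
have [d1 d10 E1] : exists2 d, 0 < d & forall t, `|t - t0| < d -> `|phi1 l0 c0 t0 - phi1 l0 c0 t| < e / 3.
  move/cvgrPdist_lt : C1 => /(_ _ e3) /nbhs_ballP [r r0 rP]; exists r => // t.
  by rewrite distrC; exact: rP.
have [d2 d20 E2] : exists2 d, 0 < d & forall t, `|t - t0| < d -> `|phi2 l0 c0 t0 - phi2 l0 c0 t| < e / 3.
  move/cvgrPdist_lt : C2 => /(_ _ e3) /nbhs_ballP [r r0 rP]; exists r => // t.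
  by rewrite distrC; exact: rP.
have nc (z r : R) (f : T * (R * R) -> R) : 0 < r -> {for (l0, (c0, t0)), continuous f} ->
    f (l0, (c0, t0)) = z -> \forall q \near (l0, (c0, t0)), `|f q - z| < r.
  move=> r0 /cvgrPdist_lt /(_ _ r0) + fz; rewrite fz; apply: filterS => q.
  by rewrite distrC.
near=> q.
have q1 : `|q.2.1 - c0| < d by near: q; exact: (nc c0 _ (fun q => q.2.1) d0 (@cont_x R T _) erefl).
have q2 : `|q.2.2 - t0| < d1 by near: q; exact: (nc t0 _ (fun q => q.2.2) d10 (@cont_y R T _) erefl).
have q3 : `|q.2.2 - t0| < d2 by near: q; exact: (nc t0 _ (fun q => q.2.2) d20 (@cont_y R T _) erefl).
have q4 : `|q.2.2 - t0| < 1 by near: q; exact: (nc t0 _ (fun q => q.2.2) ltr01 (@cont_y R T _) erefl).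
have qB : `|q.2.2 + 1| <= B.
  rewrite (_ : q.2.2 + 1 = (t0 + 1) + (q.2.2 - t0)); last by ring.
  by apply: le_trans (ler_normD _ _) _; rewrite /B lerD2l ltW.
have H : forall c, `|c - c0| < d -> forall t, `|t + 1| <= B ->
    `|phi1 q.1 c t - phi1 l0 c0 t| <= e / 3 /\ `|phi2 q.1 c t - phi2 l0 c0 t| <= e / 3.
  by near: q; exact: (cvg_fst N1).
have [h1 h2] := H _ q1 _ qB.
have h3 := E1 _ q2; have h4 := E2 _ q3.
rewrite /unc /=; move: h1 h2 h3 h4; rewrite !ler_norml !ltr_norml; lra.
Unshelve. all: by end_near. Qed.


Let along (a : T -> R -> R -> R) l c t := a l (phi1 l c t) (phi2 l c t).

Let N l x y : R := W1 l x y ^+ 2 + W2 l x y ^+ 2.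
(** With W^perp = [(W2, - W1)], the vector [(E1, E2)] is DW applied to W^perp minus the derivative
    of W^perp along the orbit, and [Q1], [Q2] are its coordinates in the frame (W, W^perp). Since W
    itself solves the variational equation, the combination [al] W + [be] W^perp does so when
    [al' = be * Q1] and [be' = be * Q2]. *)
Let E1 l x y : R := dx W1 l x y * W2 l x y - dy W1 l x y * W1 l x y
  - dx W2 l x y * W1 l x y - dy W2 l x y * W2 l x y.
Let E2 l x y : R := dx W2 l x y * W2 l x y - dy W2 l x y * W1 l x y
  + dx W1 l x y * W1 l x y + dy W1 l x y * W2 l x y.
Let Q1 l x y : R := (W1 l x y * E1 l x y + W2 l x y * E2 l x y) * (N l x y)^-1.
Let Q2 l x y : R := (W2 l x y * E1 l x y - W1 l x y * E2 l x y) * (N l x y)^-1.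

Let N0 l x y : N l x y != 0.
Proof. by have [_ _ _ H] := SW; rewrite gt_eqF//; exact: H. Qed.

Let QE1 l x y : Q1 l x y * W1 l x y + Q2 l x y * W2 l x y = E1 l x y.
Proof. by have := N0 l x y; rewrite /Q1 /Q2 /N => H; field. Qed.

Let QE2 l x y : Q1 l x y * W2 l x y - Q2 l x y * W1 l x y = E2 l x y.
Proof. by have := N0 l x y; rewrite /Q1 /Q2 /N => H; field. Qed.

Let Qc : Cinf Q1 /\ Cinf Q2.
Proof.
have W1x k : cls k (dx W1) by exact: clsdx (W1c _).
have W1y k : cls k (dy W1) by exact: clsdy (W1c _).
have W2x k : cls k (dx W2) by exact: clsdx (W2c _).
have W2y k : cls k (dy W2) by exact: clsdy (W2c _).
have E1c k : cls k E1.
  by apply: clsB; [apply: clsB; [apply: clsB|]|]; apply: clsM;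
    first [exact: W1x|exact: W1y|exact: W2x|exact: W2y|exact: W1c|exact: W2c].
have E2c k : cls k E2.
  by apply: clsD; [apply: clsD; [apply: clsB|]|]; apply: clsM;
    first [exact: W1x|exact: W1y|exact: W2x|exact: W2y|exact: W1c|exact: W2c].
have Nc k : cls k (fun l x y => (N l x y)^-1).
  apply: clsV; first exact: N0.
  apply: (@cls_ext _ _ _ (fun l x y => W1 l x y * W1 l x y + W2 l x y * W2 l x y)).
    by move=> l x y; rewrite /N !expr2.
  by apply: clsD; apply: clsM; first [exact: W1c|exact: W2c].
split=> k; apply: clsM => //.
  by apply: clsD; apply: clsM; first [exact: W1c|exact: W2c|exact: E1c|exact: E2c].
by apply: clsB; apply: clsM; first [exact: W1c|exact: W2c|exact: E1c|exact: E2c].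
Qed.

(* In the frame (W, W^perp) the variational equation along an orbit is triangular
   and solved by two quadratures: (y1, y2) = al W + be W^perp. *)
Let be l c t : R := expR (prim (along Q2 l c) (-1) t).
Let al l c t : R := prim (fun s => be l c s * along Q1 l c s) (-1) t.
Let y1 l c t : R := al l c t * along W1 l c t + be l c t * along W2 l c t.
Let y2 l c t : R := al l c t * along W2 l c t - be l c t * along W1 l c t.

Let y_cls k : cls k phi1 -> cls k phi2 -> cls k y1 /\ cls k y2.
Proof.
move=> p1 p2; have [Q1c Q2c] := Qc.
have ac a : Cinf a -> cls k (along a) by move=> ac; exact: cls_subst (ac k) p1 p2.
have bc : cls k be by apply: cls_exp; apply: cls_prim; exact: ac.
have alc : cls k al by apply: (@cls_prim R T k _ (-1)); apply: clsM => //; exact: ac.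
by split; [apply: clsD|apply: clsB]; apply: clsM => //; exact: ac.
Qed.

Let phi_cls0 : cls 0 phi1 /\ cls 0 phi2.
Proof. by have [] := flow_cont. Qed.

Let y_cont : continuous (unc y1) /\ continuous (unc y2).
Proof.
have [p1 p2] := phi_cls0; have [h1 h2] := y_cls p1 p2.
by split; [exact: cls_cont h1|exact: cls_cont h2].
Qed.

Let along_cont (a : T -> R -> R -> R) l c : Cinf a -> continuous (along a l c).
Proof.
move=> ac; have [p1 p2] := phi_cls0.
by apply: unc_sect; exact: cls_cont (cls_subst (ac 0%N) p1 p2).
Qed.

Let along_drv (a : T -> R -> R -> R) l c t : Cinf a ->
  drv (along a l c) t (along (dx a) l c t * along W1 l c t + along (dy a) l c t * along W2 l c t).
Proof. by move=> ac; exact: cls_drv (ac 1%N) (D1 l c t) (D2 l c t). Qed.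

Let be_drv l c t : drv (be l c) t (be l c t * along Q2 l c t).
Proof.
have [_ Q2c] := Qc.
by apply: drv_expf; apply: drv_prim; exact: along_cont.
Qed.

Let al_drv l c t : drv (al l c) t (be l c t * along Q1 l c t).
Proof.
have [Q1c _] := Qc.
apply: (@drv_prim R (fun s => be l c s * along Q1 l c s)) => s.
by apply: continuousM; [exact: drv_cont (be_drv l c s)|exact: along_cont].
Qed.

Let y1_drv l c t :
  drv (y1 l c) t (along (dx W1) l c t * y1 l c t + along (dy W1) l c t * y2 l c t).
Proof.
apply: drv_eq (drvD (drvM (al_drv l c t) (along_drv l c t W1c))
                    (drvM (be_drv l c t) (along_drv l c t W2c))) _.
have := QE1 l (phi1 l c t) (phi2 l c t).
rewrite /y1 /y2 /along /E1.
set q1 := Q1 _ _ _; set q2 := Q2 _ _ _; set b := be _ _ _; set a := al _ _ _ => E.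
transitivity (b * (q1 * W1 l (phi1 l c t) (phi2 l c t) + q2 * W2 l (phi1 l c t) (phi2 l c t)) +
  a * (dx W1 l (phi1 l c t) (phi2 l c t) * W1 l (phi1 l c t) (phi2 l c t) +
       dy W1 l (phi1 l c t) (phi2 l c t) * W2 l (phi1 l c t) (phi2 l c t)) +
  b * (dx W2 l (phi1 l c t) (phi2 l c t) * W1 l (phi1 l c t) (phi2 l c t) +
       dy W2 l (phi1 l c t) (phi2 l c t) * W2 l (phi1 l c t) (phi2 l c t))); first by ring.
by rewrite E; ring.
Qed.

Let y2_drv l c t :
  drv (y2 l c) t (along (dx W2) l c t * y1 l c t + along (dy W2) l c t * y2 l c t).
Proof.
apply: drv_eq (drvB (drvM (al_drv l c t) (along_drv l c t W2c))
                    (drvM (be_drv l c t) (along_drv l c t W1c))) _.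
have := QE2 l (phi1 l c t) (phi2 l c t).
rewrite /y1 /y2 /along /E2.
set q1 := Q1 _ _ _; set q2 := Q2 _ _ _; set b := be _ _ _; set a := al _ _ _ => E.
transitivity (b * (q1 * W2 l (phi1 l c t) (phi2 l c t) - q2 * W1 l (phi1 l c t) (phi2 l c t)) +
  a * (dx W2 l (phi1 l c t) (phi2 l c t) * W1 l (phi1 l c t) (phi2 l c t) +
       dy W2 l (phi1 l c t) (phi2 l c t) * W2 l (phi1 l c t) (phi2 l c t)) -
  b * (dx W1 l (phi1 l c t) (phi2 l c t) * W1 l (phi1 l c t) (phi2 l c t) +
       dy W1 l (phi1 l c t) (phi2 l c t) * W2 l (phi1 l c t) (phi2 l c t))); first by ring.
by rewrite E; ring.
Qed.

Let y_init l c : y1 l c (-1) = 1 /\ y2 l c (-1) = 0.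
Proof.
have [_ _ Wo _] := SW.
rewrite /y1 /y2 /al /be /along !prim0 expR0 phi10 phi20.
have oc : outside c (-1) by right; rewrite normrN1.
have [-> ->] := Wo l c (-1) oc.
by rewrite !mul0r !mul1r !add0r oppr0.
Qed.

(** The error of the linearisation in [c] vanishes at time -1 and obeys a Gronwall inequality whose
    forcing is [|h|] times the oscillation of [G] near [s = 0]. The tube lemma makes this
    oscillation small on the whole time interval. *)
Lemma flow_variation l c t :
  drv (fun s => phi1 l s t) c (y1 l c t) /\ drv (fun s => phi2 l s t) c (y2 l c t).
Proof.
have [L L0 [H1 H2 _ _]] := field_lipschitz l.
pose D := `|t + 1| + 1.
set Ex := expR ((4 * L + 1) * D).
have Ex0 : 0 < Ex by exact: expR_gt0.
have D0 : 0 <= D by rewrite addr_ge0.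
have Ex1 : 1 <= Ex.
  by rewrite -expR0 ler_expR mulr_ge0// addr_ge0// mulr_ge0// ltW.
pose G (W : T -> R -> R -> R) (s tau : R) : R :=
  dx W l (phi1 l c tau + s * y1 l c tau) (phi2 l c tau + s * y2 l c tau) * y1 l c tau +
  dy W l (phi1 l c tau + s * y1 l c tau) (phi2 l c tau + s * y2 l c tau) * y2 l c tau.
have Gc W : Cinf W -> continuous (fun q : R * R => G W q.1 q.2).
  move=> Wc q; have [c1 c2] := y_cont; have [p1 p2] := flow_cont.
  have f2 (a : T -> R -> R -> R) : continuous (unc a) ->
      {for q, continuous (fun q : R * R => a l c q.2)}.
    move=> ac; apply: (@continuous_comp _ _ _ snd (a l c)); first exact: cvg_snd.
    exact: unc_sect.
  have pp (a b : T -> R -> R -> R) : continuous (unc a) -> continuous (unc b) ->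
      {for q, continuous (fun q : R * R => a l c q.2 + q.1 * b l c q.2)}.
    move=> ac bc; apply: atD; first exact: f2.
    by apply: atM; [exact: cvg_fst|exact: f2].
  apply: (@atD _ _
    (fun q : R * R => dx W l (phi1 l c q.2 + q.1 * y1 l c q.2) (phi2 l c q.2 + q.1 * y2 l c q.2) * y1 l c q.2)
    (fun q : R * R => dy W l (phi1 l c q.2 + q.1 * y1 l c q.2) (phi2 l c q.2 + q.1 * y2 l c q.2) * y2 l c q.2));
    apply: atM; try exact: f2.
    apply: (@unc_comp R T _ (fun=> l) _ _ (dx W) q); [exact: cvg_cst|exact: pp|exact: pp|].
    exact: cls_cont (clsdx (Wc 1%N)) _.
  apply: (@unc_comp R T _ (fun=> l) _ _ (dy W) q); [exact: cvg_cst|exact: pp|exact: pp|].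
  exact: cls_cont (clsdy (Wc 1%N)) _.
have Gd W s tau : Cinf W ->
    drv (fun s => W l (phi1 l c tau + s * y1 l c tau) (phi2 l c tau + s * y2 l c tau)) s (G W s tau).
  move=> Wc; apply: (cls_drv (b := fun s => phi1 l c tau + s * y1 l c tau)
    (c := fun s => phi2 l c tau + s * y2 l c tau) l (Wc 1%N)).
    by apply: drv_eq (drvD (drvC _ s) (drvM (drvI s) (drvC _ s))) _; ring.
  by apply: drv_eq (drvD (drvC _ s) (drvM (drvI s) (drvC _ s))) _; ring.
have key e : 0 < e -> \forall h \near 0,
    `|phi1 l (c + h) t - phi1 l c t - h * y1 l c t| <= e * `|h| /\
    `|phi2 l (c + h) t - phi2 l c t - h * y2 l c t| <= e * `|h|.
  move=> e0; pose eps := e / (2 * Ex).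
  have eps0 : 0 < eps by rewrite divr_gt0// mulr_gt0.
  have unif W : Cinf W -> exists2 d, 0 < d & forall s, `|s| < d ->
      forall tau, `|tau - -1| <= D -> `|G W s tau - G W 0 tau| < eps.
    move=> Wc.
    have := @segment_tube R R (G W) 0 (- 1 - D) (- 1 + D) (fun y _ => Gc W Wc (0, y)) eps eps0.
    move=> /nbhs_ballP [d d0 dP]; exists d => // s sd tau tD.
    apply: dP; first by rewrite /ball /= sub0r normrN.
    by move: tD; rewrite ler_norml; lra.
  have [r1 r10 U1] := unif W1 W1c; have [r2 r20 U2] := unif W2 W2c.
  apply/nbhs_ballP; exists (Num.min r1 r2); first by rewrite /= lt_min r10.
  move=> h; rewrite /ball /= sub0r normrN lt_min => /andP[h1 h2].
  have epsh : 0 <= `|h| * eps by rewrite mulr_ge0// ltW.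
  pose d1 tau := phi1 l (c + h) tau - phi1 l c tau - h * y1 l c tau.
  pose d2 tau := phi2 l (c + h) tau - phi2 l c tau - h * y2 l c tau.
  pose e1 tau := along W1 l (c + h) tau - along W1 l c tau - h * G W1 0 tau.
  pose e2 tau := along W2 l (c + h) tau - along W2 l c tau - h * G W2 0 tau.
  have dd1 tau : drv d1 tau (e1 tau).
    apply: drv_eq (drvB (drvB (D1 l (c + h) tau) (D1 l c tau)) (drvZ h (y1_drv l c tau))) _.
    by rewrite /e1 /G !mul0r !addr0.
  have dd2 tau : drv d2 tau (e2 tau).
    apply: drv_eq (drvB (drvB (D2 l (c + h) tau) (D2 l c tau)) (drvZ h (y2_drv l c tau))) _.
    by rewrite /e2 /G !mul0r !addr0.
  have est W r tau : Cinf W -> Lip (W l) L -> `|h| < r ->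
      (forall s, `|s| < r -> forall tau, `|tau - -1| <= D -> `|G W s tau - G W 0 tau| < eps) ->
      `|tau - -1| <= D ->
      `|along W l (c + h) tau - along W l c tau - h * G W 0 tau| <=
        L * (`|d1 tau| + `|d2 tau|) + `|h| * eps.
    move=> Wc WL hr U tD.
    have [xi xih] := mvt_abs 0 h (fun s => Gd W s tau Wc).
    rewrite !subr0 !mul0r !addr0 in xih * => E.
    rewrite (_ : _ - _ = (along W l (c + h) tau -
        W l (phi1 l c tau + h * y1 l c tau) (phi2 l c tau + h * y2 l c tau)) +
        (G W xi tau - G W 0 tau) * h); last by rewrite /along mulrBl -E; ring.
    apply: le_trans (ler_normD _ _) _; apply: lerD.
      apply: le_trans (WL _ _ _ _) _.
      rewrite /d1 /d2 !opprD !addrA; exact: lexx.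
    rewrite normrM mulrC ler_wpM2l// ltW//.
    by apply: U => //; exact: le_lt_trans hr.
  have := @gronwall2 R d1 d2 e1 e2 (-1) D L (`|h| * eps) (ltW L0) epsh dd1 dd2 _ _ t.
  have -> : d1 (-1) = 0.
    by rewrite /d1 !phi10 (y_init l c).1; ring.
  have -> : d2 (-1) = 0.
    by rewrite /d2 !phi20 (y_init l c).2; ring.
  rewrite expr0n /= !add0r -/Ex => H.
  have {}H : d1 t ^+ 2 + d2 t ^+ 2 <= 2 * (`|h| * eps) ^+ 2 * Ex.
    apply: H.
    - by move=> tau tD; apply: (est W1 r1).
    - by move=> tau tD; apply: (est W2 r2).
    - by rewrite opprK /D lerDl.
  have F : 2 * (`|h| * eps) ^+ 2 * Ex <= (e * `|h|) ^+ 2.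
    rewrite (_ : 2 * (`|h| * eps) ^+ 2 * Ex = (e * `|h|) ^+ 2 * (2 * Ex)^-1).
      rewrite ler_piMr ?sqr_ge0// invf_le1; first by lra.
      by rewrite mulr_gt0.
    by rewrite /eps; field; rewrite gt_eqF.
  have s1 := sqr_ge0 (d1 t); have s2 := sqr_ge0 (d2 t).
  have eh : 0 <= e * `|h| by rewrite mulr_ge0// ltW.
  split.
    by apply: (norm_le_sq (x := d1 t)) => //; lra.
  by apply: (norm_le_sq (x := d2 t)) => //; lra.
split; apply: drv_quot => e e0; apply: (@cvg_within _ (nbhs 0));
  apply: filterS (key e e0) => h [] //.
Qed.

(** The exchange of the two derivatives is read off the variational equation: [dx phi1] is [y1],
    whose time derivative is known. *)
Lemma flow_mixed l c t : drv (fun t => dx phi1 l c t) t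
  (dx (fun l c t => W1 l (phi1 l c t) (phi2 l c t)) l c t).
Proof.
have e : (fun t => dx phi1 l c t) = y1 l c.
  by apply/funext => s; apply: dx_eq; have [] := flow_variation l c s.
rewrite e; apply: drv_eq (y1_drv l c t) _; apply/esym/dx_eq.
have [v1 v2] := flow_variation l c t.
exact: (cls_drv (b := fun s => phi1 l s t) (c := fun s => phi2 l s t) l (W1c 1%N) v1 v2).
Qed.

(** [y1] and [y2] arise by quadrature from [phi1] and [phi2], so they have the class of the flow;
    being its derivatives in [c], they raise that class by one. *)
Lemma flow_Cinf : Cinf phi1 /\ Cinf phi2.
Proof.
suff H k : cls k phi1 /\ cls k phi2 by split=> k; have [] := H k.
elim: k => [|k [p1 p2]]; first exact: phi_cls0.
have [c1 c2] := y_cls p1 p2; have [f1 f2] := flow_cont.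
split.
- apply: (cls_intro f1 _ _ c1 (cls_subst (W1c k) p1 p2)).
    by move=> l x y; have [] := flow_variation l x y.
  by move=> l x y; exact: D1.
- apply: (cls_intro f2 _ _ c2 (cls_subst (W2c k) p1 p2)).
    by move=> l x y; have [] := flow_variation l x y.
  by move=> l x y; exact: D2.
Qed.

(** In the frame (W, W^perp) the determinant is [be] times the squared speed, and [be] is an
    exponential. *)
Lemma flow_jacobian l c t :
  0 < dx phi1 l c t * dy phi2 l c t - dy phi1 l c t * dx phi2 l c t.
Proof.
have [v1 v2] := flow_variation l c t.
rewrite (dx_eq v1) (dx_eq v2) (dy_eq (D1 l c t)) (dy_eq (D2 l c t)).
rewrite (_ : _ - _ = be l c t * N l (phi1 l c t) (phi2 l c t)).
  by rewrite mulr_gt0 ?expR_gt0//; have [_ _ _ H] := SW; exact: H.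
by rewrite /y1 /y2 /along /N; ring.
Qed.

End GivenFlow.
End Flow.

(** * Angles with the vertical *)

Section Polar.
Variable R : realType.
Implicit Types (a b u v t x y : R).

(* u is the angle of the nonzero vector (a, b) with the vertical axis. *)
Definition polar a b u := a * cos u + b * sin u = 0 /\ 0 < b * cos u - a * sin u.

Lemma polarE a b u : polar a b u ->
  a = - (b * cos u - a * sin u) * sin u /\ b = (b * cos u - a * sin u) * cos u.
Proof.
move=> [p _]; have cs := cos2Dsin2 u; split.
  rewrite (_ : - _ * _ = a * (cos u ^+ 2 + sin u ^+ 2) - cos u * (a * cos u + b * sin u)).
    by rewrite p cs mulr1 mulr0 subr0.
  by ring.
rewrite (_ : _ * _ = b * (cos u ^+ 2 + sin u ^+ 2) - sin u * (a * cos u + b * sin u)).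
  by rewrite p cs mulr1 mulr0 subr0.
by ring.
Qed.

(** The vectors are positive multiples of [(- sin u, cos u)] and [(- sin u', cos u')], so their
    inner product is a positive multiple of [cos (u - u')]. *)
Lemma polar_inner a b u a' b' u' : polar a b u -> polar a' b' u' ->
  0 < cos (u - u') -> 0 < a * a' + b * b'.
Proof.
move=> p p' c0; have [ea eb] := polarE p; have [ea' eb'] := polarE p'.
have r := p.2; have r' := p'.2.
set rho := b * cos u - a * sin u in ea eb r.
set rho' := b' * cos u' - a' * sin u' in ea' eb' r'.
rewrite ea eb ea' eb' (_ : _ + _ = rho * rho' * cos (u - u')).
  by rewrite !mulr_gt0.
by rewrite cosB; ring.
Qed.

Lemma ivt (f : R -> R) a b v : a <= b -> continuous f ->
  Num.min (f a) (f b) <= v <= Num.max (f a) (f b) -> exists2 c, a <= c <= b & f c = v.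
Proof.
move=> ab fc fv.
have [c] := IVT ab (continuous_subspaceT fc) fv.
by rewrite in_itv /= => cab <-; exists c.
Qed.

Lemma mid_minmax a b : Num.min a b <= (a + b) / 2 <= Num.max a b.
Proof. by rewrite ge_min le_max; case: (leP a b) => ab; lra. Qed.

Lemma continuous_neq0_gt0 (f : R -> R) a : continuous f -> (forall t, f t != 0) ->
  0 < f a -> forall t, 0 < f t.
Proof.
move=> fc f0 fa t; rewrite lt_neqAle eq_sym f0 /= leNgt; apply/negP => ft.
have H x y : x <= y -> Num.min (f x) (f y) <= 0 <= Num.max (f x) (f y) -> False.
  by move=> xy h; have [c _ /eqP] := ivt xy fc h; exact/negP.
have [ta|/ltW at_] := leP t a.
  by apply: (H t a ta); rewrite ge_min le_max (ltW ft) (ltW fa) orbT.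
by apply: (H a t at_); rewrite ge_min le_max (ltW ft) (ltW fa) orbT.
Qed.

(* Uniqueness of the lift: the angle form of (Q1, Q2) integrates to an angle. *)
Lemma polar_transport (Q1 Q2 dQ1 dQ2 psi : R -> R) t0 :
  (forall t, drv Q1 t (dQ1 t)) -> (forall t, drv Q2 t (dQ2 t)) ->
  (forall t, Q1 t ^+ 2 + Q2 t ^+ 2 != 0) ->
  (forall t, drv psi t ((Q1 t * dQ2 t - dQ1 t * Q2 t) * (Q1 t ^+ 2 + Q2 t ^+ 2)^-1)) ->
  polar (Q1 t0) (Q2 t0) (psi t0) -> forall t, polar (Q1 t) (Q2 t) (psi t).
Proof.
move=> D1 D2 N0 Dp [p1 p2].
pose N t := Q1 t ^+ 2 + Q2 t ^+ 2.
pose om t := (Q1 t * dQ2 t - dQ1 t * Q2 t) * (N t)^-1.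
pose A t := Q1 t * cos (psi t) + Q2 t * sin (psi t).
pose B t := Q2 t * cos (psi t) - Q1 t * sin (psi t).
have dc t : drv (fun s => cos (psi s)) t (- sin (psi t) * om t) by exact: drv_cosf (Dp t).
have ds t : drv (fun s => sin (psi s)) t (cos (psi t) * om t) by exact: drv_sinf (Dp t).
have dA t : drv A t ((Q1 t * dQ1 t + Q2 t * dQ2 t) * (N t)^-1 * A t).
  apply: drv_eq (drvD (drvM (D1 t) (dc t)) (drvM (D2 t) (ds t))) _.
  by have := N0 t; rewrite /om /A /N => h; field.
have dB t : drv B t ((dQ2 t * cos (psi t) + Q2 t * (- sin (psi t) * om t)) -
    (dQ1 t * sin (psi t) + Q1 t * (cos (psi t) * om t))).
  exact: drvB (drvM (D2 t) (dc t)) (drvM (D1 t) (ds t)).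
have dN t : drv (fun s => (Q1 s * Q1 s + Q2 s * Q2 s)^-1) t
    (- (2 * (Q1 t * dQ1 t + Q2 t * dQ2 t)) * (N t)^-1 * (N t)^-1).
  apply: drv_eq (drvV _ (drvD (drvM (D1 t) (D1 t)) (drvM (D2 t) (D2 t)))) _.
    by rewrite -!expr2.
  by rewrite -!expr2 /N; congr (- _ * _ * _); ring.
(* The quotient of [A ^+ 2] by the squared length of [(Q1, Q2)] is constant, so [A] vanishes
   everywhere as it does at [t0]. Then [B ^+ 2] is the squared length, and [B] keeps its sign. *)
have A0 t : A t = 0.
  have e : A t * A t * (Q1 t * Q1 t + Q2 t * Q2 t)^-1 =
      A t0 * A t0 * (Q1 t0 * Q1 t0 + Q2 t0 * Q2 t0)^-1.
    apply: (@drv0_cst _ (fun t => A t * A t * (Q1 t * Q1 t + Q2 t * Q2 t)^-1)) => s.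
    apply: drv_eq (drvM (drvM (dA s) (dA s)) (dN s)) _.
    by rewrite -!expr2 -/(N s); ring.
  move: e; rewrite {2 3}/A p1 !mul0r => /eqP.
  rewrite mulf_eq0 invr_eq0 -!expr2 (negbTE (N0 t)) orbF expf_eq0 /=.
  by move/eqP.
have B0 t : B t != 0.
  apply/eqP => b0; have := N0 t; rewrite (_ : _ + _ = A t ^+ 2 + B t ^+ 2).
    by rewrite A0 b0 expr0n addr0 eqxx.
  have cs := cos2Dsin2 (psi t).
  rewrite /A /B (_ : _ + _ = (Q1 t ^+ 2 + Q2 t ^+ 2) * 1); last by rewrite mulr1.
  by rewrite -cs; ring.
move=> t; split; first exact: A0.
exact: (continuous_neq0_gt0 (drv_continuous dB) B0 p2).
Qed.

Lemma drv_ge0_right (f : R -> R) x l d : drv f x l -> 0 < d ->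
  (forall h, 0 < h < d -> f x <= f (x + h)) -> 0 <= l.
Proof.
move=> fl d0 H; rewrite leNgt; apply/negP => l0.
have e0 : 0 < - l / 2 by rewrite divr_gt0// oppr_gt0.
have /nbhs_ballP [r r0 rP] := drv_approx fl e0.
pose h := Num.min r d / 2.
have m0 : 0 < Num.min r d by rewrite lt_min r0.
have h0 : 0 < h by rewrite divr_gt0.
have mr : Num.min r d <= r by rewrite ge_min lexx.
have md : Num.min r d <= d by rewrite ge_min lexx orbT.
have hr : h < r by rewrite /h; lra.
have hd : h < d by rewrite /h; lra.
have : `|f (x + h) - f x - h * l| <= - l / 2 * `|h|.
  by apply: rP; rewrite /ball /= sub0r normrN gtr0_norm.
rewrite (gtr0_norm h0) ler_norml => /andP[_ K].
have := H h; rewrite h0 hd => /(_ isT).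
have : h * l < 0 by rewrite nmulr_llt0.
lra.
Qed.

Lemma drv_le0_left (f : R -> R) x l d : drv f x l -> 0 < d ->
  (forall h, 0 < h < d -> f x <= f (x - h)) -> l <= 0.
Proof.
move=> fl d0 H; rewrite -oppr_ge0.
have D : drv (fun t => f (- t)) (- x) (l * - 1).
  apply: (@drv_comp _ f (fun t => - t) (- x) l (- 1)); last exact: drvN (drvI _).
  by rewrite opprK.
rewrite -(mulrN1 l); apply: (drv_ge0_right D d0) => h hd.
by rewrite opprK opprD opprK; exact: H.
Qed.

End Polar.

(** * Orbits outside the box *)

Section Confinement.
Variables (R : realType) (T : topologicalType).
Implicit Types (l : T) (x y c t s : R).

(** The half-turn of the plane combined with time reversal carries orbits to orbits of a field of
    the same kind, still pointing upwards outside the box. Statements about the past are deduced in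
    this way from those about the future. *)
Lemma standard_reverse (W1 W2 : T -> R -> R -> R) : standard_field W1 W2 ->
  standard_field (fun l x y => W1 l (- x) (- y)) (fun l x y => W2 l (- x) (- y)).
Proof.
have rc (a : T -> R -> R -> R) : Cinf a -> Cinf (fun l x y => a l (- x) (- y)).
  by move=> ac k; apply: cls_subst => //; apply: clsN; [exact: clsX|exact: clsY].
move=> [c1 c2 Wo W0]; split.
- exact: rc.
- exact: rc.
- by move=> l x y h; apply: Wo; rewrite /outside !normrN.
- by move=> l x y; exact: W0.
Qed.

Lemma solution_reverse (W1 W2 : R -> R -> R) g1 g2 : solution W1 W2 g1 g2 ->
  solution (fun x y => W1 (- x) (- y)) (fun x y => W2 (- x) (- y))
    (fun t => - g1 (- t)) (fun t => - g2 (- t)).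
Proof.
have rd (f : R -> R) (t a : R) : drv f (- t) a -> drv (fun t => - f (- t)) t a.
  move=> fa; apply: drv_eq (drvN (@drv_comp _ f (fun t => - t) t _ _ fa (drvN (drvI t)))) _.
  by rewrite mulrN1 opprK.
by move=> [D1 D2]; split=> t; apply: rd; rewrite !opprK.
Qed.

Variables W1 W2 : T -> R -> R -> R.
Hypothesis SW : standard_field W1 W2.

(** The vertical ray above such a point avoids the open box, so it is a solution, and uniqueness
    identifies it with the orbit. *)
Lemma vertical_up l g1 g2 t0 : solution (W1 l) (W2 l) g1 g2 ->
  1 <= `|g1 t0| \/ 1 <= g2 t0 ->
  forall t, t0 <= t -> g1 t = g1 t0 /\ g2 t = g2 t0 + (t - t0).
Proof.
move=> [D1 D2] o0 t tt.
have [L L0 [H1 H2 _ _]] := field_lipschitz SW l.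
have [_ _ Wo _] := SW.
have oo s : t0 <= s <= t -> outside (g1 t0) (g2 t0 + (s - t0)).
  move=> /andP[ts _]; case: o0 => o0; first by left.
  by right; apply: le_trans (ler_norm _); lra.
apply: (@ode_unique R (W1 l) (W2 l) L g1 g2 (fun=> g1 t0) (fun s => g2 t0 + (s - t0)) t0 t
  (ltW L0) H1 H2).
- by move=> s _; exact: D1.
- by move=> s _; exact: D2.
- by move=> s ts; have [-> _] := Wo l _ _ (oo s ts); exact: drvC.
- move=> s ts; have [_ ->] := Wo l _ _ (oo s ts).
  by apply: drv_eq (drvD (drvC (g2 t0) s) (drvB (drvI s) (drvC t0 s))) _; ring.
- by [].
- by rewrite subrr addr0.
- by rewrite tt lexx.
Qed.

End Confinement.

Section ConfinementBackward.
Variables (R : realType) (T : topologicalType).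
Implicit Types (l : T) (x y c t s : R).
Variables W1 W2 : T -> R -> R -> R.
Hypothesis SW : standard_field W1 W2.

Lemma vertical_down l g1 g2 t0 : solution (W1 l) (W2 l) g1 g2 ->
  1 <= `|g1 t0| \/ g2 t0 <= -1 ->
  forall t, t <= t0 -> g1 t = g1 t0 /\ g2 t = g2 t0 + (t - t0).
Proof.
move=> S o0 t tt.
have := @vertical_up R T _ _ (standard_reverse SW) l _ _ (- t0) (solution_reverse S) _ (- t).
rewrite !opprK !normrN lerNr lerN2 => H.
have [e1 e2] := H o0 tt.
by split; [apply: oppr_inj|apply: oppr_inj; rewrite e2; ring].
Qed.

(** At [|x| >= 1] the orbit would rise forever, against the bound. A point of height at most -1 has
    been reached by rising vertically since time 0, so it is not lower than the starting point. *)
Lemma confined l g1 g2 : solution (W1 l) (W2 l) g1 g2 ->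
  (forall t, 0 <= t -> g2 t <= 1) ->
  forall t, 0 <= t -> `|g1 t| < 1 /\ - (1 + `|g2 0|) <= g2 t.
Proof.
move=> S tr t t0; split.
  rewrite ltNge; apply/negP => g1t.
  have n0 := normr_ge0 (g2 t).
  have tt : t <= t + (`|g2 t| + 2) by lra.
  have [_ e] := vertical_up SW S (or_introl g1t) tt.
  have : g2 (t + (`|g2 t| + 2)) <= 1 by apply: tr; lra.
  by rewrite e; have := ler_norm (- g2 t); rewrite normrN; lra.
have n0 := normr_ge0 (g2 0).
have [g2t|] := leP (g2 t) (-1); last lra.
have [_ e] := vertical_down S (or_intror g2t) t0.
by have := ler_norm (- g2 0); rewrite normrN; lra.
Qed.

End ConfinementBackward.

(** * No orbit is trapped *)

Section NoTrapping.
Variables (R : realType) (T : topologicalType).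
Implicit Types (l : T) (x y c t s r : R).
Variables W1 W2 th : T -> R -> R -> R.
Hypothesis SW : standard_field W1 W2.
Hypothesis thc : Cinf th.
Hypothesis tho : forall l x y, outside x y -> th l x y = 0.
Hypothesis pol : forall l x y, polar (W1 l x y) (W2 l x y) (th l x y).
Variable l : T.
Variables g1 g2 : R -> R.
Hypothesis S : solution (W1 l) (W2 l) g1 g2.

Let D1 t : drv g1 t (W1 l (g1 t) (g2 t)). Proof. by have [] := S. Qed.
Let D2 t : drv g2 t (W2 l (g1 t) (g2 t)). Proof. by have [] := S. Qed.

Let sqd s t : R := (g1 t - g1 s) ^+ 2 + (g2 t - g2 s) ^+ 2.

Let sqdC s t : sqd s t = sqd t s. Proof. by rewrite /sqd; ring. Qed.

Lemma speed_lower_bound : exists2 m : R, 0 < m & forall x y, m <= W1 l x y ^+ 2 + W2 l x y ^+ 2.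
Proof.
have [W1c W2c Wo W0] := SW.
pose N (l : T) x y : R := (W1 l x y * W1 l x y + W2 l x y * W2 l x y)^-1.
have N0 l' x y : W1 l' x y * W1 l' x y + W2 l' x y * W2 l' x y != 0.
  by rewrite gt_eqF// -!expr2; exact: W0.
have Nc : cls 0 N by apply: clsV => //; apply: clsD; apply: clsM.
have [B BP] := box_bounded (cont_slice (l := l) (cls_cont Nc)).
have B1 : 0 < `|B| + 1 by rewrite ltr_wpDl.
exists (`|B| + 1)^-1; first by rewrite invr_gt0.
move=> x y; case: (insideP x y) => [xyo|[x1 y1]].
  have [-> ->] := Wo l x y xyo; rewrite expr0n expr1n add0r.
  by rewrite invf_le1// lerDr.
have := BP x y x1 y1; rewrite /N.
have Np := W0 l x y; rewrite -!expr2 gtr0_norm ?invr_gt0// => H.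
rewrite -[leRHS]invrK lef_pV2 ?posrE ?invr_gt0//.
by apply: le_trans H _; apply: le_trans (ler_norm B) _; rewrite lerDl.
Qed.

(** During a time [eta] the velocity keeps an inner product at least [m / 2] with its initial value,
    and Cauchy-Schwarz makes the chord grow linearly. This tells genuine returns from small time
    differences. *)
Lemma orbit_straight : exists eta k : R, [/\ 0 < eta, 0 < k &
  forall s t, s <= t -> t <= s + eta -> (k * (t - s)) ^+ 2 <= sqd s t].
Proof.
have [L L0 [H1 H2 B1 B2]] := field_lipschitz SW l.
have [m m0 mN] := speed_lower_bound.
(* Within time [eta] each coordinate moves by at most [L * eta], so each component of the field
   varies by at most [2 * L ^+ 2 * eta = m / (4 * L)], which costs at most [m / 4] in each term of
   the inner product. *)
pose eta := m / (8 * L ^+ 3).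
have eta0 : 0 < eta by rewrite divr_gt0// mulr_gt0// exprn_gt0.
exists eta, (m / (4 * L)); split=> // [|s t st tse]; first by rewrite divr_gt0// mulr_gt0.
pose w1 := W1 l (g1 s) (g2 s); pose w2 := W2 l (g1 s) (g2 s).
have inner r : s <= r <= t -> m / 2 <= W1 l (g1 r) (g2 r) * w1 + W2 l (g1 r) (g2 r) * w2.
  move=> /andP[sr rt].
  have dist (g : R -> R) (W : R -> R -> R) : (forall t, drv g t (W (g1 t) (g2 t))) ->
      (forall x y, `|W x y| <= L) -> `|g r - g s| <= L * eta.
    move=> gd WB; have [c _ ->] := mvt_abs s r gd.
    rewrite normrM; apply: ler_pM => //.
    by rewrite ger0_norm ?subr_ge0//; lra.
  have d1 := dist g1 _ D1 B1; have d2 := dist g2 _ D2 B2.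
  have close (W : R -> R -> R) : Lip W L ->
      `|W (g1 r) (g2 r) - W (g1 s) (g2 s)| <= m / (4 * L).
    move=> WL; apply: le_trans (WL _ _ _ _) _.
    apply: (@le_trans _ _ (L * (L * eta + L * eta))); first by rewrite ler_pM2l// lerD.
    by rewrite le_eqVlt; apply/orP; left; apply/eqP; rewrite /eta; field; rewrite gt_eqF.
  have c1 := close _ H1; have c2 := close _ H2.
  have p (a w : R) : `|a| <= m / (4 * L) -> `|w| <= L -> - (m / 4) <= a * w.
    move=> aL wL; rewrite lerNl; apply: le_trans (ler_norm _) _.
    rewrite normrN normrM [leRHS](_ : _ = m / (4 * L) * L); last by field; rewrite gt_eqF.
    exact: ler_pM.
  have p1 := p _ _ c1 (B1 (g1 s) (g2 s)); have p2 := p _ _ c2 (B2 (g1 s) (g2 s)).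
  have := mN (g1 s) (g2 s); rewrite -/w1 -/w2 in p1 p2 *.
  by move: p1 p2; rewrite !mulrBl; lra.
pose F r := g1 r * w1 + g2 r * w2.
have FD r : drv F r (W1 l (g1 r) (g2 r) * w1 + W2 l (g1 r) (g2 r) * w2).
  apply: drv_eq (drvD (drvM (D1 r) (drvC w1 r)) (drvM (D2 r) (drvC w2 r))) _; ring.
have [c cst E] := mvt st (fun r _ => FD r).
have Fl : m / 2 * (t - s) <= F t - F s.
  by rewrite E ler_wpM2r ?subr_ge0//; exact: inner.
set u1 := g1 t - g1 s; set u2 := g2 t - g2 s.
have Fu : F t - F s = u1 * w1 + u2 * w2 by rewrite /F /u1 /u2; ring.
have sq (W : R) : `|W| <= L -> W ^+ 2 <= L ^+ 2.
  move=> WL; rewrite -real_normK ?num_real//.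
  by rewrite ler_pXn2r// nnegrE// ltW.
have w1L : w1 ^+ 2 <= L ^+ 2 by exact: (sq _ (B1 _ _)).
have w2L : w2 ^+ 2 <= L ^+ 2 by exact: (sq _ (B2 _ _)).
have CS : (u1 * w1 + u2 * w2) ^+ 2 <= (u1 ^+ 2 + u2 ^+ 2) * (w1 ^+ 2 + w2 ^+ 2).
  rewrite -subr_ge0 (_ : _ - _ = (u1 * w2 - u2 * w1) ^+ 2); first exact: sqr_ge0.
  by ring.
have U0 : 0 <= u1 ^+ 2 + u2 ^+ 2 by rewrite addr_ge0 ?sqr_ge0.
have Lsq : 0 < L ^+ 2 by rewrite exprn_gt0.
have lo0 : 0 <= m / 2 * (t - s) by rewrite mulr_ge0 ?subr_ge0// divr_ge0// ltW.
have K : (m / 2 * (t - s)) ^+ 2 <= (u1 ^+ 2 + u2 ^+ 2) * (2 * L ^+ 2).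
  apply: (@le_trans _ _ ((u1 * w1 + u2 * w2) ^+ 2)).
    by rewrite -Fu ler_pXn2r ?nnegrE// (le_trans lo0).
  by apply: le_trans CS _; apply: ler_wpM2l => //; lra.
rewrite -(ler_pM2r (_ : 0 < 2 * L ^+ 2)) ?mulr_gt0//.
apply: le_trans K; rewrite (_ : (m / (4 * L) * (t - s)) ^+ 2 * (2 * L ^+ 2) =
  (m / 2 * (t - s)) ^+ 2 * 2^-1); last by field; rewrite gt_eqF.
by rewrite ler_piMr ?sqr_ge0// invf_le1// ler1n.
Qed.

(** Sampled at the multiples of [h], the orbit stays in a compact rectangle, and two samples of
    different indices lie close to a cluster point. *)
Lemma near_return (y0 : R) :
  (forall t, 0 <= t -> `|g1 t| <= 1 /\ y0 <= g2 t <= 1) ->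
  forall h rho : R, 0 < h -> 0 < rho ->
  exists s t, [/\ 0 <= s, s + h <= t & sqd s t <= rho ^+ 2].
Proof.
move=> conf h rho h0 rho0.
have K : compact (`[(-1 : R), 1] `*` `[y0, 1]).
  by apply: compact_setX; exact: segment_compact.
pose u (n : nat) : R * R := (g1 (n%:R * h), g2 (n%:R * h)).
have uK : (u @ \oo) (`[(-1 : R), 1] `*` `[y0, 1]).
  exists 0%N => // n _; have nh : 0 <= n%:R * h by rewrite mulr_ge0// ltW.
  have [a b] := conf _ nh.
  by split; rewrite /= in_itv //= -ler_norml.
have [q [_ qc]] := K (u @ \oo) _ uK.
have r3 : 0 < rho / 3 by rewrite divr_gt0.
have pick (N : nat) : exists2 n, (N <= n)%N & `|q.1 - (u n).1| < rho / 3 /\ `|q.2 - (u n).2| < rho / 3.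
  have tail : (u @ \oo) [set u n | n in [set n | (N <= n)%N]].
    by exists N => // n Nn; exists n.
  have [_ [[n Nn <-] [b1 b2]]] := qc _ _ tail (nbhsx_ballx q _ r3).
  by exists n.
have [n _ [n1 n2]] := pick 0%N; have [k nk [k1 k2]] := pick n.+1.
exists (n%:R * h), (k%:R * h); split.
- by rewrite mulr_ge0// ltW.
- rewrite (_ : n%:R * h + h = n.+1%:R * h); first by rewrite ler_pM2r// ler_nat.
  by rewrite -natr1; ring.
have sq (a b qq : R) : `|qq - a| < rho / 3 -> `|qq - b| < rho / 3 -> (b - a) ^+ 2 <= (2 * (rho / 3)) ^+ 2.
  move=> ha hb; rewrite -real_normK ?num_real//.
  have r0 : 0 <= 2 * (rho / 3) by rewrite mulr_ge0// ltW.
  rewrite ler_pXn2r ?nnegrE//.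
  rewrite (_ : b - a = (qq - a) - (qq - b)); last by ring.
  by apply: le_trans (ler_normB _ _) _; lra.
have := sq _ _ _ n1 k1; have := sq _ _ _ n2 k2; rewrite /sqd /u /=.
have : 2 * (2 * (rho / 3)) ^+ 2 <= rho ^+ 2.
  rewrite (_ : 2 * (2 * (rho / 3)) ^+ 2 = rho ^+ 2 * (8 / 9)); last by field.
  by rewrite ler_piMr ?sqr_ge0//; lra.
lra.
Qed.

Let sqd_cont2 : continuous (fun p : R * R => sqd p.1 p.2).
Proof.
move=> p.
have c1 : continuous g1 := drv_continuous D1.
have c2 : continuous g2 := drv_continuous D2.
have sub (g : R -> R) : continuous g -> {for p, continuous (fun p : R * R => g p.2 - g p.1)}.
  move=> gc; apply: (@atD _ _ (fun p : R * R => g p.2) (fun p : R * R => - g p.1)).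
    by apply: at_fun; [exact: gc|exact: cvg_snd].
  by apply: atN; apply: at_fun; [exact: gc|exact: cvg_fst].
apply: (@atD _ _ (fun p : R * R => (g1 p.2 - g1 p.1) ^+ 2) (fun p : R * R => (g2 p.2 - g2 p.1) ^+ 2)).
  by apply: (@atM _ _ (fun p : R * R => g1 p.2 - g1 p.1)); exact: sub.
by apply: (@atM _ _ (fun p : R * R => g2 p.2 - g2 p.1)); exact: sub.
Qed.

(** The end time is minimised over the compact set of near-returns within [0, t0] with delay at
    least [h]; the delay constraint keeps the diagonal out. *)
Lemma first_return (h rho s0 t0 : R) : 0 < h -> 0 <= s0 -> s0 + h <= t0 -> sqd s0 t0 <= rho ^+ 2 ->
  exists a b, [/\ 0 <= a, a + h <= b, sqd a b <= rho ^+ 2 &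
    forall s t, 0 <= s -> s + h <= t -> t < b -> rho ^+ 2 < sqd s t].
Proof.
move=> h0 s00 st0 d0.
pose Z := (`[(0 : R), t0] `*` `[(0 : R), t0]) `&`
  ([set p : R * R | p.1 - p.2 + h <= 0] `&` [set p : R * R | sqd p.1 p.2 <= rho ^+ 2]).
have Zc : compact Z.
  apply: compact_closedI; first by apply: compact_setX; exact: segment_compact.
  apply: closedI.
    have fc : continuous (fun p : R * R => p.1 - p.2 + h).
      move=> p; apply: (@atD _ _ (fun p : R * R => p.1 - p.2) (fun=> h)); last exact: cvg_cst.
      apply: (@atD _ _ (fun p : R * R => p.1) (fun p : R * R => - p.2)); first exact: cvg_fst.
      by apply: atN; exact: cvg_snd.
    exact: ((continuous_closedP _).1 fc _ (@closed_le R 0)).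
  exact: ((continuous_closedP _).1 sqd_cont2 _ (@closed_le R (rho ^+ 2))).
have Z0 : Z !=set0.
  exists (s0, t0); split; last by split=> /=; lra.
  by split; rewrite /= in_itv /=; lra.
have [|[a b]] := compact_EVT_min Z0 Zc (_ : {within Z, continuous (fun p : R * R => p.2)}).
  by apply: continuous_subspaceT => p; exact: cvg_snd.
rewrite inE => -[[/=]]; rewrite !in_itv /= => /andP[a0 at0] /andP[b0 bt0] [hab dab] min.
exists a, b; split=> //; first lra.
move=> s t s_0 st tb; rewrite ltNge; apply/negP => dst.
have : (s, t) \in Z.
  rewrite inE; split; last by split=> /=; lra.
  by split; rewrite /= in_itv /=; lra.
by move/min => /=; lra.
Qed.

Let w (W : T -> R -> R -> R) t : R := W l (g1 t) (g2 t).

Let w_cont (W : T -> R -> R -> R) : continuous (unc W) -> continuous (w W).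
Proof.
move=> Wc t; apply: (@unc_comp R T _ (fun=> l) g1 g2 W t).
- exact: cvg_cst.
- exact: drv_cont (D1 t).
- exact: drv_cont (D2 t).
- exact: Wc.
Qed.

Let w_cls (W : T -> R -> R -> R) : Cinf W -> cls 1 (fun (_ : R) x (_ : R) => w W x).
Proof.
move=> Wc.
pose dw t := w (dx W) t * w W1 t + w (dy W) t * w W2 t.
have dwD t : drv (w W) t (dw t) by exact: cls_drv (Wc 1%N) (D1 t) (D2 t).
have [W1c W2c _ _] := SW.
have dwc : continuous dw.
  move=> t; apply: (@atD _ _ (fun t => w (dx W) t * w W1 t) (fun t => w (dy W) t * w W2 t)); apply: atM.
  - exact: w_cont (cls_cont (clsdx (Wc 1%N))) _.
  - exact: w_cont (cls_cont (W1c 0%N)) _.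
  - exact: w_cont (cls_cont (clsdy (Wc 1%N))) _.
  - exact: w_cont (cls_cont (W2c 0%N)) _.
have cx (f : R -> R) : continuous f -> continuous (unc (fun (_ : R) x (_ : R) => f x)).
  by move=> fc z; apply: (@at_fun _ _ (fun z : R * (R * R) => z.2.1)); [exact: fc|exact: cont_x].
apply: (@cls_intro R R 0 _ (fun _ x _ => dw x) (fun _ _ _ => 0)).
- by apply: cx; exact: drv_continuous dwD.
- by move=> _ x _; exact: dwD.
- by move=> _ x y; exact: drvC.
- by split => //; exact: cx.
- exact: clsC.
Qed.

(* Otherwise there is a first near-return, a chord from time a to time b of length
   at most rho.  The secants between times of [a, b], extended by the velocity on
   the diagonal, have a continuous angle psi.  Minimality makes the secants from a
   to r and from r to b form a non-acute angle for all r; but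
   D r = psi r b - psi a r takes the value (D a + D b) / 2 = (th b - th a) / 2,
   which is small as rho is.  The times of [a, b] are parametrized by
   ka t = mid + rad * sin t, so that no boundary has to be dealt with. *)
Theorem escape : exists2 t, 0 <= t & 1 < g2 t.
Proof.
apply: contrapT => ntr.
have tr t : 0 <= t -> g2 t <= 1.
  by move=> t0; rewrite leNgt; apply/negP => gt; apply: ntr; exists t.
have conf t : 0 <= t -> `|g1 t| <= 1 /\ - (1 + `|g2 0|) <= g2 t <= 1.
  move=> t0; have [h1 h2] := confined SW S tr t0.
  by split; [exact: ltW|rewrite h2 tr].
have [eta [k [eta0 k0 str]]] := orbit_straight.
have [Lt Lt0 [LtL _]] := box_lipschitz (thc 1%N) (@tho l).
(* The first bound makes the angles at the two ends of the chord differ by at most 1/2. The second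
   makes chords of delay between [eta / 2] and [eta] longer than [rho], since [orbit_straight] gives
   them length at least [k * eta / 2]. *)
pose rho := Num.min (4 * Lt)^-1 (k * eta / 4).
have rho0 : 0 < rho by rewrite lt_min invr_gt0 divr_gt0 ?mulr_gt0.
have rhoLt : rho <= (4 * Lt)^-1 by rewrite ge_min lexx.
have rhok : rho <= k * eta / 4 by rewrite ge_min lexx orbT.
have ke0 : 0 < k * eta by rewrite mulr_gt0.
have h0 : 0 < eta / 2 by rewrite divr_gt0.
have [s0 [t0 [s00 st0 d0]]] := near_return conf h0 rho0.
have [a [b [a0 hab dab F1]]] := first_return h0 s00 st0 d0.
have big s t : s + eta / 2 <= t -> t <= s + eta -> rho ^+ 2 < sqd s t.
  move=> st ts; have st' : s <= t by lra.
  apply: lt_le_trans (str s t st' ts).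
  have kk : k * (eta / 2) <= k * (t - s) by rewrite ler_pM2l//; lra.
  by rewrite ltr_pXn2r// ?nnegrE; lra.
have F2 : eta < b - a.
  rewrite ltNge; apply/negP => H; have : rho ^+ 2 < sqd a b by apply: big; lra.
  by rewrite ltNge dab.
(* Minimality concerns chords ending strictly before [b]; continuity carries it to chords ending at
   [b], with a weak inequality and for delays exceeding [eta / 2]. *)
have F3 s : 0 <= s -> s + eta / 2 < b -> rho ^+ 2 <= sqd s b.
  move=> s_0 sb; rewrite leNgt; apply/negP => H.
  have sc : {for b, continuous (sqd s)}.
    apply: (@continuous_comp _ _ _ (fun t => (s, t)) (fun p : R * R => sqd p.1 p.2)).
      by apply: continuous_pair_at; [exact: cvg_cst|exact: cvg_id].
    exact: sqd_cont2.
  have /nbhs_ballP [r r0 rP] : \forall t \near b, sqd s t < rho ^+ 2.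
    exact: (cvgr_lt _ sc).
  pose e := Num.min r (b - s - eta / 2) / 2.
  have m0 : 0 < Num.min r (b - s - eta / 2) by rewrite lt_min r0; lra.
  have mr : Num.min r (b - s - eta / 2) <= r by rewrite ge_min lexx.
  have ms : Num.min r (b - s - eta / 2) <= b - s - eta / 2 by rewrite ge_min lexx orbT.
  have : sqd s (b - e) < rho ^+ 2.
    by apply: rP; rewrite /ball /= subKr ger0_norm /e; lra.
  have : rho ^+ 2 < sqd s (b - e) by apply: F1; rewrite /e; lra.
  by move=> /lt_trans h /h; rewrite ltxx.
have db : 0 < b - a - eta / 2 by lra.
have F4 : (g1 b - g1 a) * w W1 a + (g2 b - g2 a) * w W2 a <= 0.
  have D : drv (fun s => sqd s b) a (2 * ((g1 b - g1 a) * - w W1 a + (g2 b - g2 a) * - w W2 a)).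
    have d1 := drvB (drvC (g1 b) a) (D1 a); have d2 := drvB (drvC (g2 b) a) (D2 a).
    by apply: drv_eq (drvD (drvM d1 d1) (drvM d2 d2)) _; rewrite /w; ring.
  have := drv_ge0_right D db _.
  have H h : 0 < h < b - a - eta / 2 -> sqd a b <= sqd (a + h) b.
    by move=> /andP[h_0 hd]; apply: le_trans dab (F3 _ _ _); lra.
  by move=> /(_ H); lra.
have F5 : (g1 b - g1 a) * w W1 b + (g2 b - g2 a) * w W2 b <= 0.
  have D : drv (sqd a) b (2 * ((g1 b - g1 a) * w W1 b + (g2 b - g2 a) * w W2 b)).
    have d1 := drvB (D1 b) (drvC (g1 a) b); have d2 := drvB (D2 b) (drvC (g2 a) b).
    by apply: drv_eq (drvD (drvM d1 d1) (drvM d2 d2)) _; rewrite /w; ring.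
  have := drv_le0_left D db _.
  have H h : 0 < h < b - a - eta / 2 -> sqd a b <= sqd a (b - h).
    by move=> /andP[h_0 hd]; apply: le_trans dab (ltW (F1 _ _ _ _ _)); lra.
  by move=> /(_ H); lra.
(* This keeps the secants from vanishing: straightness excludes a crossing with a short delay,
   minimality one with a long delay. *)
have inj s t : a <= s -> s < t -> t <= b -> 0 < sqd s t.
  move=> sa st tb; have [ts|ts] := leP t (s + eta).
    apply: lt_le_trans (str s t (ltW st) ts).
    by rewrite exprn_gt0// mulr_gt0// subr_gt0.
  apply: lt_le_trans (_ : rho ^+ 2 <= _); first by rewrite exprn_gt0.
  have [tb'|bt] := ltP t b; first by apply/ltW/F1; lra.
  have -> : t = b by apply/eqP; rewrite eq_le tb bt.
  by apply: F3; lra.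
have [W1c W2c _ W0] := SW.
pose mid := (a + b) / 2; pose rad := (b - a) / 2.
have rad0 : 0 < rad by rewrite /rad; lra.
pose ka t := mid + rad * sin t.
have ka_in t : a <= ka t <= b.
  have r1 : rad * sin t <= rad by rewrite ger_pMr// sin_le1.
  have r2 : - rad <= rad * sin t by rewrite -mulrN1 ler_pM2l// sin_geN1.
  by rewrite /ka /mid; move: r1 r2; rewrite /rad; lra.
pose A : R := - (pi / 2); pose B : R := pi / 2.
have AB : A <= B by rewrite /A /B; have := pi_gt0 R; lra.
have kA : ka A = a by rewrite /ka /A sinN sin_pihalf mulrN1 /mid /rad; lra.
have kB : ka B = b by rewrite /ka /B sin_pihalf mulr1 /mid /rad; lra.
have ka_c : continuous ka.
  move=> t; apply: (@atD _ _ (fun=> mid) (fun t => rad * sin t)); first exact: cvg_cst.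
  by apply: (@atM _ _ (fun=> rad)); [exact: cvg_cst|exact: continuous_sin].
(* The secant divided by its delay is written as the mean over [0, 1] of the velocity. Unlike the
   quotient, this mean is of class C^1 across the diagonal, where it equals the velocity. *)
pose aa (W : T -> R -> R -> R) (s t r : R) : R := w W (ka s + r * (ka t - ka s)).
have aac W : Cinf W -> cls 1 (aa W).
  move=> Wc; apply: (cls_fun1 (w_cls Wc)).
  have c1 : cls 1 (fun (s _ _ : R) => ka s) by exact: cls_param.
  have c2 : cls 1 (fun (_ t _ : R) => ka t).
    by apply: clsD; [exact: clsC|apply: clsM; [exact: clsC|apply: cls_sin; exact: clsX]].
  by apply: (clsD c1); apply: clsM; [exact: clsY|exact: (clsB c2 c1)].
have aas W s t : Cinf W -> continuous (aa W s t).
  by move=> Wc; apply: unc_sect; exact: cls_cont (aac W Wc).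
pose Qh W := fun s t r : R => prim (aa W s t) 0 r.
have Qhc W : Cinf W -> cls 1 (Qh W) by move=> Wc; apply: cls_prim; exact: aac.
pose Q W s t : R := Qh W s t 1.
pose dQ W s t : R := dx (Qh W) s t 1.
have QD W s t : Cinf W -> drv (Q W s) t (dQ W s t).
  by move=> Wc; exact: cls_dx (Qhc W Wc).
have at1 (f : R -> R -> R -> R) : continuous (unc f) -> continuous (fun p : R * R => f p.1 p.2 1).
  move=> fc p; apply: (@unc_comp R R _ fst snd (fun=> 1) f p).
  - exact: cvg_fst.
  - exact: cvg_snd.
  - exact: cvg_cst.
  - exact: fc.
have Qc W : Cinf W -> continuous (fun p : R * R => Q W p.1 p.2).
  by move=> Wc; apply: at1; exact: cls_cont (Qhc W Wc).
have dQc W : Cinf W -> continuous (fun p : R * R => dQ W p.1 p.2).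
  by move=> Wc; apply: at1; exact: cls_cont (clsdx (Qhc W Wc)).
have Qsec W (g : R -> R) s t : Cinf W -> (forall t, drv g t (w W t)) ->
    Q W s t * (ka t - ka s) = g (ka t) - g (ka s).
  move=> Wc gw.
  have D r : drv (fun r => prim (aa W s t) 0 r * (ka t - ka s) - g (ka s + r * (ka t - ka s))) r 0.
    have i : drv (fun r => ka s + r * (ka t - ka s)) r (ka t - ka s).
      by apply: drv_eq (drvD (drvC _ r) (drvM (drvI r) (drvC _ r))) _; ring.
    have j := @drv_comp _ g (fun r => ka s + r * (ka t - ka s)) r _ _ (gw _) i.
    by apply: drv_eq (drvB (drvM (drv_prim 0 r (aas W s t Wc)) (drvC _ r)) j) _; rewrite /aa; ring.
  have := drv0_cst D 1 0; rewrite prim0 !mul0r addr0 mul1r /Q /Qh.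
  by rewrite (addrC (ka s)) subrK; lra.
have Qdiag W s t : Cinf W -> ka t = ka s -> Q W s t = w W (ka s).
  move=> Wc kk; rewrite /Q /Qh (@prim_eq _ _ (fun r => r * w W (ka s))).
  - by rewrite mul1r mul0r subr0.
  - exact: aas.
  - move=> r; rewrite /aa kk subrr mulr0 addr0.
    by apply: drv_eq (drvM (drvI r) (drvC _ r)) _; ring.
have N0 s t : Q W1 s t ^+ 2 + Q W2 s t ^+ 2 != 0.
  have [kk|kk] := eqVneq (ka t) (ka s).
    by rewrite !Qdiag// gt_eqF//; exact: W0.
  have e1 := Qsec W1 g1 s t W1c D1; have e2 := Qsec W2 g2 s t W2c D2.
  apply/eqP => z.
  have sz : sqd (ka s) (ka t) = 0.
    by rewrite /sqd -e1 -e2 !exprMn -mulrDl z mul0r.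
  have [as_ sb] := andP (ka_in s); have [at_ tb] := andP (ka_in t).
  have [st|ts|e] := ltgtP (ka s) (ka t).
  - by have := inj _ _ as_ st tb; rewrite sz ltxx.
  - by have := inj _ _ at_ ts sb; rewrite sqdC sz ltxx.
  - by move: kk; rewrite e eqxx.
pose om s t := (Q W1 s t * dQ W2 s t - dQ W1 s t * Q W2 s t) * (Q W1 s t ^+ 2 + Q W2 s t ^+ 2)^-1.
have omc : continuous (fun p : R * R => om p.1 p.2).
  have q1 := Qc W1 W1c; have q2 := Qc W2 W2c; have dq1 := dQc W1 W1c; have dq2 := dQc W2 W2c.
  move=> p; apply: (@atM _ _
    (fun p : R * R => Q W1 p.1 p.2 * dQ W2 p.1 p.2 - dQ W1 p.1 p.2 * Q W2 p.1 p.2)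
    (fun p : R * R => (Q W1 p.1 p.2 ^+ 2 + Q W2 p.1 p.2 ^+ 2)^-1)).
    apply: (@atD _ _ (fun p : R * R => Q W1 p.1 p.2 * dQ W2 p.1 p.2)
      (fun p : R * R => - (dQ W1 p.1 p.2 * Q W2 p.1 p.2))).
      by apply: atM; [exact: q1|exact: dq2].
    by apply: atN; apply: atM; [exact: dq1|exact: q2].
  apply: (@continuousV _ _ (fun p : R * R => Q W1 p.1 p.2 ^+ 2 + Q W2 p.1 p.2 ^+ 2)).
    exact: N0.
  apply: (@atD _ _ (fun p : R * R => Q W1 p.1 p.2 ^+ 2) (fun p : R * R => Q W2 p.1 p.2 ^+ 2)).
    by apply: (@atM _ _ (fun p : R * R => Q W1 p.1 p.2)); exact: q1.
  by apply: (@atM _ _ (fun p : R * R => Q W2 p.1 p.2)); exact: q2.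
have oms s : continuous (om s).
  move=> t; apply: (@continuous_comp _ _ _ (fun t => (s, t)) (fun p : R * R => om p.1 p.2)).
    by apply: continuous_pair_at; [exact: cvg_cst|exact: cvg_id].
  exact: omc.
(* The lift starts from the angle [th] of the velocity on the diagonal and integrates the angle form
   in [t], with [s] fixed. *)
pose psi s t := w th (ka s) + prim (om s) s t.
have psid s : psi s s = w th (ka s) by rewrite /psi prim0 addr0.
have ppol s t : polar (Q W1 s t) (Q W2 s t) (psi s t).
  apply: (@polar_transport R (Q W1 s) (Q W2 s) (dQ W1 s) (dQ W2 s) (psi s) s).
  - by move=> r; exact: QD.
  - by move=> r; exact: QD.
  - by move=> r; exact: N0.
  - move=> r; apply: drv_eq (drvD (drvC (w th (ka s)) r) (drv_prim s r (oms s))) _.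
    by rewrite add0r.
  - by rewrite !Qdiag// psid; exact: pol.
(* When [ka r] is an end, one secant is the velocity there and [F4] or [F5] applies. Otherwise a
   positive product would give [sqd a b > sqd a (ka r) + sqd (ka r) b]; as [b - a > eta], one of the
   legs has delay at least [eta / 2] and is therefore not shorter than [rho]. *)
have IP r : Q W1 r B * Q W1 A r + Q W2 r B * Q W2 A r <= 0.
  rewrite leNgt; apply/negP => ip.
  have e1 := Qsec W1 g1 r B W1c D1; have e2 := Qsec W2 g2 r B W2c D2.
  have f1 := Qsec W1 g1 A r W1c D1; have f2 := Qsec W2 g2 A r W2c D2.
  rewrite kB in e1 e2; rewrite kA in f1 f2.
  have [ar rb] := andP (ka_in r).
  have ba0 : 0 < b - a by lra.
  have [qa|qa] := eqVneq (ka r) a.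
    have : 0 < (b - a) * (Q W1 r B * Q W1 A r + Q W2 r B * Q W2 A r) by rewrite mulr_gt0.
    rewrite (Qdiag W1 A r) ?kA// (Qdiag W2 A r) ?kA//.
    by rewrite qa in e1 e2; move: F4; rewrite -e1 -e2; lra.
  have [qb|qb] := eqVneq (ka r) b.
    have : 0 < (b - a) * (Q W1 r B * Q W1 A r + Q W2 r B * Q W2 A r) by rewrite mulr_gt0.
    rewrite (Qdiag W1 r B) ?kB ?qb// (Qdiag W2 r B) ?kB ?qb//.
    by rewrite qb in f1 f2; move: F5; rewrite -f1 -f2; lra.
  have ar' : a < ka r by rewrite lt_neqAle eq_sym qa.
  have rb' : ka r < b by rewrite lt_neqAle qb.
  have pp : 0 < (g1 b - g1 (ka r)) * (g1 (ka r) - g1 a) + (g2 b - g2 (ka r)) * (g2 (ka r) - g2 a).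
    rewrite -e1 -e2 -f1 -f2 [ltRHS](_ : _ = (b - ka r) * (ka r - a) *
      (Q W1 r B * Q W1 A r + Q W2 r B * Q W2 A r)); last by ring.
    by rewrite !mulr_gt0 ?subr_gt0.
  have dd : sqd a b = sqd a (ka r) + sqd (ka r) b + 2 *
    ((g1 b - g1 (ka r)) * (g1 (ka r) - g1 a) + (g2 b - g2 (ka r)) * (g2 (ka r) - g2 a)).
    by rewrite /sqd; ring.
  have n1 : 0 <= sqd a (ka r) by rewrite addr_ge0 ?sqr_ge0.
  have n2 : 0 <= sqd (ka r) b by rewrite addr_ge0 ?sqr_ge0.
  have short : ka r < a + eta / 2.
    rewrite ltNge; apply/negP => H; have := F1 a (ka r) a0 H rb'; lra.
  have := F3 (ka r) _ _; lra.
pose D r := psi r B - psi A r.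
have Dc : continuous D.
  have pc : continuous (fun r => psi r B).
    move=> r; apply: (@atD _ _ (fun r => w th (ka r)) (fun r => prim (om r) r B)).
      apply: (@at_fun _ _ ka r (w th)) => //; last exact: ka_c.
      by apply: w_cont; exact: cls_cont (thc 0%N).
    (* Base point and integrand both move with [r]; rebasing at 0 separates them, so that
       [prim_cont] applies. *)
    have pe r' : prim (om r') r' B = prim (om r') 0 B - prim (om r') 0 r'.
      by rewrite /prim; ring.
    rewrite (_ : (fun r => prim (om r) r B) = (fun r => prim (om r) 0 B - prim (om r) 0 r)).
      have P := @prim_cont R R om 0 omc.
      apply: (@atD _ _ (fun r => prim (om r) 0 B) (fun r => - prim (om r) 0 r)).
        apply: (@continuous_comp _ _ _ (fun r => (r, B)) (fun q : R * R => prim (om q.1) 0 q.2)).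
          by apply: continuous_pair_at; [exact: cvg_id|exact: cvg_cst].
        exact: P.
      apply: atN.
      apply: (@continuous_comp _ _ _ (fun r => (r, r)) (fun q : R * R => prim (om q.1) 0 q.2)).
        by apply: continuous_pair_at; exact: cvg_id.
      exact: P.
    by apply/funext => r'.
  move=> r; apply: (@atD _ _ (fun r => psi r B) (fun r => - psi A r)); first exact: pc.
  apply: atN; apply: (@atD _ _ (fun=> w th (ka A)) (fun r => prim (om A) A r)); first exact: cvg_cst.
  exact: drv_cont (drv_prim A r (oms A)).
(* [psi A B] occurs in [D A] and in [D B] with opposite signs; only the diagonal values, those of
   [th], remain. *)
have DD : D A + D B = w th b - w th a.
  by rewrite /D !psid kA kB; ring.
have [r _ Dr] : exists2 r, A <= r <= B & D r = (D A + D B) / 2.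
  exact: (ivt AB Dc (mid_minmax _ _)).
have small : `|w th b - w th a| <= 2^-1.
  apply: le_trans (LtL _ _ _ _) _.
  have s1 := sqr_ge0 (g1 b - g1 a); have s2 := sqr_ge0 (g2 b - g2 a).
  have x1 : `|g1 b - g1 a| <= rho by apply: norm_le_sq; [exact: ltW|move: dab; rewrite /sqd; lra].
  have x2 : `|g2 b - g2 a| <= rho by apply: norm_le_sq; [exact: ltW|move: dab; rewrite /sqd; lra].
  apply: (@le_trans _ _ (Lt * ((4 * Lt)^-1 + (4 * Lt)^-1))).
    by rewrite ler_pM2l//; lra.
  by rewrite le_eqVlt; apply/orP; left; apply/eqP; field; rewrite gt_eqF.
have c0 : 0 < cos (psi r B - psi A r).
  rewrite -/(D r) Dr DD; apply: cos_gt0_pihalf.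
  by have := pi_ge2 R; move: small; rewrite ler_norml; lra.
have := polar_inner (ppol r B) (ppol A r) c0.
by have := IP r; lra.
Qed.

End NoTrapping.

Section SolutionShift.
Variables (R : realType) (T : topologicalType).
Implicit Types (l : T) (x y c t s r : R).

Lemma solution_shift W1 W2 l (g1 g2 h1 h2 : R -> R) t t' :
  @standard_field R T W1 W2 ->
  solution (W1 l) (W2 l) g1 g2 -> solution (W1 l) (W2 l) h1 h2 ->
  g1 t = h1 t' -> g2 t = h2 t' ->
  forall s, 0 <= s -> g1 (t + s) = h1 (t' + s) /\ g2 (t + s) = h2 (t' + s).
Proof.
move=> SW [G1 G2] [H1 H2] e1 e2 s s0.
have [L L0 [L1 L2 _ _]] := field_lipschitz SW l.
have sh (f : R -> R) (u z a : R) : drv f (u + z) a -> drv (fun z => f (u + z)) z a.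
  move=> fa; apply: drv_eq (@drv_comp _ f (fun z => u + z) z _ _ fa (drvD (drvC u z) (drvI z))) _.
  by rewrite add0r mulr1.
apply: (@ode_unique R (W1 l) (W2 l) L (fun s => g1 (t + s)) (fun s => g2 (t + s))
  (fun s => h1 (t' + s)) (fun s => h2 (t' + s)) 0 s (ltW L0) L1 L2).
- by move=> r _; exact: sh.
- by move=> r _; exact: sh.
- by move=> r _; exact: sh.
- by move=> r _; exact: sh.
- by rewrite !addr0.
- by rewrite !addr0.
- by rewrite s0 lexx.
Qed.

Lemma solution_shift_back W1 W2 l (g1 g2 h1 h2 : R -> R) t t' :
  @standard_field R T W1 W2 ->
  solution (W1 l) (W2 l) g1 g2 -> solution (W1 l) (W2 l) h1 h2 ->
  g1 t = h1 t' -> g2 t = h2 t' ->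
  forall s, 0 <= s -> g1 (t - s) = h1 (t' - s) /\ g2 (t - s) = h2 (t' - s).
Proof.
move=> SW G H e1 e2 s s0.
have [] := @solution_shift _ _ l _ _ _ _ (- t) (- t') (standard_reverse SW)
  (solution_reverse G) (solution_reverse H) _ _ s s0.
- by rewrite !opprK e1.
- by rewrite !opprK e2.
by rewrite !opprD !opprK => /oppr_inj -> /oppr_inj ->.
Qed.

End SolutionShift.

(** * The chart swept by the orbits *)

Section Chart.
Variables (R : realType) (T : topologicalType).
Implicit Types (l : T) (x y c t s r v : R).
Variables W1 W2 th : T -> R -> R -> R.
Hypothesis SW : standard_field W1 W2.
Hypothesis thc : Cinf th.
Hypothesis tho : forall l x y, outside x y -> th l x y = 0.
Hypothesis pol : forall l x y, polar (W1 l x y) (W2 l x y) (th l x y).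
Variables phi1 phi2 : T -> R -> R -> R.
Hypothesis phi10 : forall l c, phi1 l c (-1) = c.
Hypothesis phi20 : forall l c, phi2 l c (-1) = -1.
Hypothesis phiS : forall l c, solution (W1 l) (W2 l) (phi1 l c) (phi2 l c).

Lemma phi_below l c t : t <= -1 -> phi1 l c t = c /\ phi2 l c t = t.
Proof.
move=> t1; have [|e1 e2] := @vertical_down R T W1 W2 SW l _ _ (-1) (phiS l c) _ t t1.
  by right; rewrite phi20.
by rewrite e1 e2 phi10 phi20; split=> //; ring.
Qed.

Lemma phi_side l c t : 1 <= `|c| -> phi1 l c t = c /\ phi2 l c t = t.
Proof.
move=> c1; have [/(phi_below l c) //|/ltW t1] := leP t (-1).
have [|e1 e2] := @vertical_up R T W1 W2 SW l _ _ (-1) (phiS l c) _ t t1.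
  by left; rewrite phi10.
by rewrite e1 e2 phi10 phi20; split=> //; ring.
Qed.

Lemma phi_above l c t t' : 1 <= phi2 l c t -> t <= t' ->
  phi1 l c t' = phi1 l c t /\ phi2 l c t' = phi2 l c t + (t' - t).
Proof. by move=> h tt; exact: (@vertical_up R T W1 W2 SW l _ _ t (phiS l c) (or_intror h) t' tt). Qed.

(** Far enough in the past both orbits are on vertical lines below the box, where [(c, t)] can be
    read off the point. *)
Lemma phi_injective l c t c' t' :
  phi1 l c t = phi1 l c' t' -> phi2 l c t = phi2 l c' t' -> c = c' /\ t = t'.
Proof.
move=> e1 e2; pose s := `|t| + `|t'| + 1.
have s0 : 0 <= s by rewrite !addr_ge0.
have [h1 h2] := solution_shift_back SW (phiS l c) (phiS l c') e1 e2 s0.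
have n1 := ler_norm t; have n2 := ler_norm t'.
have m1 := normr_ge0 t; have m2 := normr_ge0 t'.
have [a1 a2] : phi1 l c (t - s) = c /\ phi2 l c (t - s) = t - s.
  by apply: phi_below; rewrite /s; lra.
have [b1 b2] : phi1 l c' (t' - s) = c' /\ phi2 l c' (t' - s) = t' - s.
  by apply: phi_below; rewrite /s; lra.
by split; [rewrite -a1 h1|move: h2; rewrite a2 b2 => /addIr].
Qed.

(** By [escape] for the reversed field, the past of any point goes below [y = -1], where it is a
    vertical line of the chart. *)
Lemma phi_surjective l x y : exists c t, phi1 l c t = x /\ phi2 l c t = y.
Proof.
have [g1 [g2 [gx gy G]]] := orbit_exists SW l x y 0.
have thc' : Cinf (fun l x y => th l (- x) (- y)).
  by move=> k; apply: cls_subst (thc k) _ _; apply: clsN; [exact: clsX|exact: clsY].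
have tho' l' x' y' : outside x' y' -> th l' (- x') (- y') = 0.
  by move=> h; apply: tho; rewrite /outside !normrN.
have [s s0 gs] := escape (standard_reverse SW) thc' tho' (fun l x y => pol l (- x) (- y))
  (solution_reverse G).
have [a1 a2] : phi1 l (g1 (- s)) (g2 (- s)) = g1 (- s) /\ phi2 l (g1 (- s)) (g2 (- s)) = g2 (- s).
  by apply: phi_below; lra.
exists (g1 (- s)), (g2 (- s) + s).
have [-> ->] := solution_shift SW (phiS l (g1 (- s))) G a1 a2 s0.
by rewrite addNr.
Qed.

Let phic : Cinf phi1 /\ Cinf phi2.
Proof. by have := flow_Cinf SW phi10 phi20 phiS. Qed.

(** Each [c] has an escape time that is valid for nearby [l] and [c], and at all later times because
    an orbit above the box keeps rising. Compactness of [-1, 1], with later times as a filter at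
    infinity, yields a common one; for [|c| >= 1] the orbit is explicit. *)
Lemma exit_time l0 : exists t0, \forall l \near l0, forall c, 1 < phi2 l c t0.
Proof.
have /compact_near_coveringP cK := @segment_compact R (-1) 1.
have [_ p2c] := phic.
have : \forall i \near filter_prod (nbhs l0) (+oo : set_system R),
    `[(-1 : R), 1] `<=` (fun c => 1 < phi2 i.1 c i.2).
  apply: (cK _ _ (fun (i : T * R) c => 1 < phi2 i.1 c i.2)) => c _.
  have [tc tc0 esc] := escape SW thc tho pol (phiS l0 c).
  have cc : {for (l0, c), continuous (fun q : T * R => phi2 q.1 q.2 tc)}.
    apply: (@unc_comp R T _ fst snd (fun=> tc) phi2 (l0, c)).
    - exact: cvg_fst.
    - exact: cvg_snd.
    - exact: cvg_cst.
    - exact: cls_cont (p2c 0%N) _.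
  have [[U V] /= [Ul Vc] UV] : \forall q \near (l0, c), 1 < phi2 q.1 q.2 tc.
    exact: (cvgr_gt _ cc).
  exists (V, U `*` [set t | tc < t]) => /=.
    split=> //; exists (U, [set t | tc < t]) => //=; split=> //.
    by exists tc; split => //; exact: num_real.
  move=> [c' [l t]] /= [Vc' [Ul' tct]].
  have h : 1 < phi2 l c' tc by exact: (UV (l, c')).
  have [_ ->] := phi_above (ltW h) (ltW tct); lra.
move=> [[U V]] /= [Ul [M [Mr MV]]] UV.
pose t0 := `|M| + 2.
have n0 := normr_ge0 M; have n1 := ler_norm M.
exists t0; apply: filterS Ul => l Ul c.
have [c1|c1] := leP 1 `|c|.
  by have [_ ->] := phi_side l t0 c1; rewrite /t0; lra.
apply: (UV (l, t0)); last by rewrite /= in_itv /= -ler_norml ltW.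
by split=> //=; apply: MV; rewrite /t0; lra.
Qed.

Definition jac l c t := dx phi1 l c t * dy phi2 l c t - dy phi1 l c t * dx phi2 l c t.

(* The area swept up to time t by the orbits of the points near (c, -1), per unit
   of c: with it as second coordinate instead of t, the chart preserves the area. *)
Definition area_coord l c t := -1 + prim (jac l c) (-1) t.

Let S := area_coord.

Lemma jac_Cinf : Cinf jac.
Proof.
have [p1 p2] := phic; move=> k; apply: clsB; apply: clsM.
- exact: clsdx (p1 _).
- exact: clsdy (p2 _).
- exact: clsdy (p1 _).
- exact: clsdx (p2 _).
Qed.

Lemma jac_gt0 l c t : 0 < jac l c t.
Proof. exact: (flow_jacobian SW phi10 phi20 phiS). Qed.

Lemma area_coord_Cinf : Cinf S.
Proof.
by move=> k; apply: clsD; [exact: clsC|apply: cls_prim; exact: jac_Cinf].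
Qed.

Lemma area_coord_drv l c t : drv (S l c) t (jac l c t).
Proof.
have jc : continuous (jac l c) by apply: unc_sect; exact: cls_cont (jac_Cinf 0%N).
by apply: drv_eq (drvD (drvC (-1) t) (drv_prim (-1) t jc)) _; rewrite add0r.
Qed.

Let dyphi l c t : dy phi1 l c t = W1 l (phi1 l c t) (phi2 l c t) /\
  dy phi2 l c t = W2 l (phi1 l c t) (phi2 l c t).
Proof. by have [D1 D2] := phiS l c; split; apply: dy_eq. Qed.

Lemma jac_dx l c t : outside (phi1 l c t) (phi2 l c t) -> jac l c t = dx phi1 l c t.
Proof.
move=> h; have [_ _ Wo _] := SW; have [d1 d2] := dyphi l c t.
by rewrite /jac d1 d2; have [-> ->] := Wo l _ _ h; rewrite mulr1 mul0r subr0.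
Qed.

Let out_y x y : 1 <= y -> outside x y.
Proof. by move=> y1; right; exact: le_trans (ler_norm y). Qed.

(** A derivative can be computed where a formula holds on a neighbourhood, hence for [1 < |x|]; this
    reaches the boundary by continuity. *)
Lemma closure_gt1 (f : R -> R) v : continuous f -> (forall x, 1 < `|x| -> f x = v) ->
  forall x, 1 <= `|x| -> f x = v.
Proof.
move=> fc fv x; rewrite le_eqVlt => /predU1P[x1|]; last exact: fv.
apply/eqP; rewrite -subr_eq0 -normr_le0; apply/ler_addgt0Pr => e e0; rewrite add0r.
have /cvgrPdist_lt /(_ _ e0) /nbhs_ballP [d d0 dP] := fc x.
pose z := x + (d / 2) * x.
have d2 : 0 < d / 2 by rewrite divr_gt0.
have z1 : 1 < `|z|.
  rewrite /z -{1}(mul1r x) -mulrDl normrM -x1 mulr1 gtr0_norm; lra.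
have := dP z; rewrite (fv z z1) => H; apply/ltW/H.
rewrite /ball /= /z opprD addrA subrr sub0r normrN normrM -x1 mulr1 gtr0_norm//; lra.
Qed.

Lemma jac_side l c t : 1 <= `|c| -> jac l c t = 1.
Proof.
apply: (@closure_gt1 (fun c => jac l c t)) => [z|z z1].
  apply: (@unc_comp R T _ (fun=> l) id (fun=> t) jac z).
  - exact: cvg_cst.
  - exact: cvg_id.
  - exact: cvg_cst.
  - exact: cls_cont (jac_Cinf 0%N) _.
rewrite jac_dx; last by left; have [-> _] := phi_side l t (ltW z1); exact: ltW.
apply: dx_eq; apply: (@near_drv _ id); last exact: drvI.
by apply: filterS (near_norm_gt1 z1) => s s1; have [-> _] := phi_side l t s1.
Qed.

Lemma jac_below l c t : t <= -1 -> jac l c t = 1.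
Proof.
move=> t1; have [_ p2] := phi_below l c t1.
rewrite jac_dx; last by right; rewrite p2 ler0_norm; lra.
rewrite (@dx_congr R T T phi1 (fun _ x _ => x) l l c t t).
  exact: dx_eq (drvI c).
by move=> s; have [-> _] := phi_below l s t1.
Qed.

Lemma area_coord_side l c t : 1 <= `|c| -> S l c t = t.
Proof.
move=> c1; rewrite /S /area_coord (_ : jac l c = fun=> 1).
  rewrite (@prim_eq _ (fun=> 1) id) => [|z|z]; first by ring.
    exact: cvg_cst.
  exact: drvI.
by apply/funext => s; exact: jac_side.
Qed.

Lemma area_coord_below l c t : t <= -1 -> S l c t = t.
Proof.
move=> t1.
have S1 : S l c (-1) = -1 by rewrite /S /area_coord prim0 addr0.
have D s : t <= s <= -1 -> drv (fun s => S l c s - s) s 0.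
  move=> /andP[_ s1]; apply: drv_eq (drvB (area_coord_drv l c s) (drvI s)) _.
  by rewrite jac_below// subrr.
by have := drv0_cst_in t1 D; rewrite S1; lra.
Qed.

Lemma jac_above l c t t' : (forall s, 1 <= phi2 l s t) -> t <= t' -> jac l c t' = jac l c t.
Proof.
move=> h tt.
rewrite !jac_dx; [|by apply: out_y|].
- by apply: dx_congr => s; have [-> _] := phi_above (h s) tt.
- by apply: out_y; have [_ ->] := phi_above (h c) tt; have := h c; lra.
Qed.

Lemma area_coord_above l c t t' : (forall s, 1 <= phi2 l s t) -> t <= t' ->
  S l c t' = S l c t + jac l c t * (t' - t).
Proof.
move=> h tt.
have := @drv0_cst_in R (fun s => S l c s - jac l c t * s) t t' tt _.
have H0 s : t <= s <= t' -> drv (fun s => S l c s - jac l c t * s) s 0.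
  move=> /andP[ts _].
  apply: drv_eq (drvB (area_coord_drv l c s) (drvZ (jac l c t) (drvI s))) _.
  by rewrite (jac_above c h ts); ring.
by move=> /(_ H0); lra.
Qed.

(** The area coordinate is the time below the box and affine with positive slope after the exit
    time; in between, the intermediate value theorem applies. *)
Lemma area_coord_surj l c v : exists t, S l c t = v.
Proof.
have [v1|/ltW v1] := leP v (-1); first by exists v; exact: area_coord_below.
have [t0 /nbhs_singleton h] := exit_time l.
have h' s : 1 <= phi2 l s t0 by exact: ltW.
have j0 := jac_gt0 l c t0.
pose d := `|v - S l c t0| / jac l c t0.
have d0 : 0 <= d by rewrite divr_ge0// ltW.
pose m := Num.max t0 (-1).
have e1 : S l c (t0 + d) = S l c t0 + `|v - S l c t0|.
  rewrite (area_coord_above c h') ?lerDl// (addrC t0) addrK /d mulrC divfK//.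
  by rewrite gt_eqF.
have vS : v <= S l c (t0 + d) by rewrite e1; have := ler_norm (v - S l c t0); lra.
have S1 : S l c (-1) = -1 by exact: area_coord_below.
have Scont : continuous (S l c) := drv_continuous (area_coord_drv l c).
have [td|/ltW td] := leP (-1) (t0 + d).
  have mm : Num.min (S l c (-1)) (S l c (t0 + d)) <= v <= Num.max (S l c (-1)) (S l c (t0 + d)).
    by rewrite S1 ge_min le_max v1 vS orbT.
  by have [t _ <-] := ivt td Scont mm; exists t.
exists v; apply: area_coord_below; apply: le_trans vS _.
by rewrite area_coord_below.
Qed.

(** Chosen without any continuity in [l]: what is built on it does not depend on the choice, by
    [exit_at_indep], and is smooth by [cls_local]. The default 0 is never reached, by
    [exit_time]. *)
Definition exit_at l : R := xget 0 [set t | forall c, 1 < phi2 l c t].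

Lemma exit_atP l c : 1 <= phi2 l c (exit_at l).
Proof.
rewrite /exit_at; case: xgetP => [t _ tP|H]; first exact: ltW (tP c).
by have [t /nbhs_singleton tP] := exit_time l; have := H t; case.
Qed.

Definition exit_map l c := phi1 l c (exit_at l).
(** Minus the intercept of the area coordinate as an affine function of the height above the box;
    the slope is the Jacobian there, which is also the derivative of [exit_map]. *)
Definition exit_shift l c := jac l c (exit_at l) * phi2 l c (exit_at l) - S l c (exit_at l).

Lemma exit_at_indep l c t : (forall s, 1 <= phi2 l s t) ->
  [/\ exit_map l c = phi1 l c t, jac l c (exit_at l) = jac l c t &
      exit_shift l c = jac l c t * phi2 l c t - S l c t].
Proof.
move=> h; rewrite /exit_map /exit_shift.
have gen a b : (forall s, 1 <= phi2 l s a) -> a <= b ->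
  [/\ phi1 l c b = phi1 l c a, jac l c b = jac l c a &
      jac l c b * phi2 l c b - S l c b = jac l c a * phi2 l c a - S l c a].
  move=> ha ab; have [-> ->] := phi_above (ha c) ab.
  rewrite (jac_above c ha ab) (area_coord_above c ha ab); split=> //; ring.
have [le|/ltW le] := leP t (exit_at l); first exact: gen.
by have [-> -> ->] := gen _ _ (fun s => exit_atP l s) le.
Qed.

Lemma exit_map_Cinf : Cinf (fun l x (_ : R) => exit_map l x).
Proof.
move=> k; apply: cls_local => l0; have [t0 tP] := exit_time l0.
exists (fun l x _ => phi1 l x t0).
  have [p1 _] := phic.
  exact: (cls_subst (p1 k) (clsX R T k) (clsC T k t0)).
apply: filterS tP => l lP x _.
by have [] := @exit_at_indep l x t0 (fun s => ltW (lP s)).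
Qed.

Lemma exit_shift_Cinf : Cinf (fun l x (_ : R) => exit_shift l x).
Proof.
move=> k; apply: cls_local => l0; have [t0 tP] := exit_time l0.
exists (fun l x _ => jac l x t0 * phi2 l x t0 - S l x t0).
  have [_ p2] := phic.
  have sub a : Cinf a -> cls k (fun l x (_ : R) => a l x t0).
    by move=> ac; exact: (cls_subst (ac k) (clsX R T k) (clsC T k t0)).
  apply: clsB; first by apply: clsM; apply: sub => //; exact: jac_Cinf.
  by apply: sub; exact: area_coord_Cinf.
apply: filterS tP => l lP x _.
by have [] := @exit_at_indep l x t0 (fun s => ltW (lP s)).
Qed.

Lemma exit_map_drv l c : drv (exit_map l) c (jac l c (exit_at l)).
Proof.
rewrite jac_dx; last by apply: out_y; exact: exit_atP.
by have [p1 _] := phic; exact: cls_dx (p1 1%N).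
Qed.

Lemma exit_map_side l c : 1 <= `|c| -> exit_map l c = c.
Proof. by move=> c1; have [] := phi_side l (exit_at l) c1. Qed.

Lemma exit_shift_side l c : 1 <= `|c| -> exit_shift l c = 0.
Proof.
move=> c1; rewrite /exit_shift jac_side// area_coord_side//.
by have [_ ->] := phi_side l (exit_at l) c1; rewrite mul1r subrr.
Qed.

(** The orbit of [c] may leave the box before the common exit time. In that interval only the orbits
    of neighbouring [c'] are known to be above the box, which is enough to compute the derivative in
    [c]. *)
Lemma exit_relation l c t : 1 < phi2 l c t ->
  phi1 l c t = exit_map l c /\
  S l c t = jac l c (exit_at l) * phi2 l c t - exit_shift l c.
Proof.
move=> h1; have h := ltW h1; rewrite /exit_map /exit_shift; set t0 := exit_at l.
have [le|/ltW le] := leP t0 t.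
  have [-> ->] := phi_above (exit_atP l c) le.
  rewrite (area_coord_above c (fun s => exit_atP l s) le); split=> //; rewrite -/t0; ring.
have [e1 e2] := phi_above h le; split=> //.
have [p1 p2] := phic.
have nb : \forall c' \near c, 1 < phi2 l c' t.
  have cc : {for c, continuous (fun c => phi2 l c t)}.
    exact: drv_cont (cls_dx l c t (p2 1%N)).
  exact: (cvgr_gt _ cc).
have D s : t <= s <= t0 -> drv (fun s => S l c s - jac l c t0 * phi2 l c s) s 0.
  move=> /andP[ts st0].
  have [_ D2] := phiS l c.
  apply: drv_eq (drvB (area_coord_drv l c s) (drvZ (jac l c t0) (D2 s))) _.
  have [_ _ Wo _] := SW.
  have os : 1 <= phi2 l c s by have [_ ->] := phi_above h ts; lra.
  have [_ ->] := Wo l _ _ (out_y (phi1 l c s) os).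
  rewrite !jac_dx; [|exact: out_y (exit_atP l c)|exact: out_y].
  rewrite mulr1; apply/eqP; rewrite subr_eq0; apply/eqP; apply: dx_eq.
  apply: near_drv (cls_dx l c t0 (p1 1%N)).
  apply: filterS nb => c' /ltW h'.
  have [-> _] := phi_above h' le; by have [-> _] := phi_above h' ts.
have := drv0_cst_in le D; lra.
Qed.

(** Enters the generating function of the correction, which is the identity for [|c| >= 1] thanks to
    the vanishing of this primitive there. *)
Definition exit_area l c := prim (exit_shift l) (-1) c.

Let exit_shift_cont l : continuous (exit_shift l).
Proof.
move=> c; apply: (@unc_comp R T _ (fun=> l) id (fun=> 0) (fun l x _ => exit_shift l x) c).
- exact: cvg_cst.
- exact: cvg_id.
- exact: cvg_cst.
- exact: cls_cont (exit_shift_Cinf 0%N) _.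
Qed.

Lemma exit_area_drv l c : drv (exit_area l) c (exit_shift l c).
Proof. by apply: drv_prim; exact: exit_shift_cont. Qed.

Lemma exit_area_Cinf : Cinf (fun l x (_ : R) => exit_area l x).
Proof. by move=> k; exact: (cls_prim1 (-1) (exit_shift_Cinf k)). Qed.

(* The integral of phi1_c phi2 - S over c in [-1, 1] at time t has derivative
   [W1 phi2] in t, and W1 vanishes where |c| = 1. *)
Lemma exit_area_total l : exit_area l 1 = 0.
Proof.
have [p1 p2] := phic; have [W1c _ Wo _] := SW.
pose Wp l c t := W1 l (phi1 l c t) (phi2 l c t).
pose a l c t := dx phi1 l c t * phi2 l c t - S l c t.
have ac : Cinf a.
  move=> k; apply: clsB; last exact: area_coord_Cinf.
  by apply: clsM => //; exact: clsdx (p1 _).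
have Wpc : Cinf Wp by move=> k; exact: cls_subst (W1c k) (p1 k) (p2 k).
pose I t := prim (fun s => a l s t) (-1) 1.
have dya s t : dy a l s t = dx Wp l s t * phi2 l s t + Wp l s t * dx phi2 l s t.
  apply: dy_eq; have [D1 D2] := phiS l s.
  apply: drv_eq (drvB (drvM (flow_mixed SW phi10 phi20 phiS l s t) (D2 t)) (area_coord_drv l s t)) _.
  by have [d1 d2] := dyphi l s t; rewrite /jac d1 d2 /Wp; ring.
have I0 t : drv I t 0.
  apply: drv_eq (drv_param_prim1 (-1) l 1 t (ac 1%N)) _.
  rewrite (@prim_eq _ _ (fun s => Wp l s t * phi2 l s t)).
  - have n1 : `|1 : R| = 1 by rewrite normr1.
    have s1 : 1 <= `|1 : R| by rewrite normr1.
    have s2 : 1 <= `|-1 : R| by rewrite normrN1.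
    have [a1 _] := phi_side l t s1; have [b1 _] := phi_side l t s2.
    have z1 : Wp l 1 t = 0.
      by rewrite /Wp; have [] := Wo l (phi1 l 1 t) (phi2 l 1 t) (or_introl (_ : 1 <= `|phi1 l 1 t|)); rewrite ?a1.
    have z2 : Wp l (-1) t = 0.
      by rewrite /Wp; have [] := Wo l (phi1 l (-1) t) (phi2 l (-1) t) (or_introl (_ : 1 <= `|phi1 l (-1) t|)); rewrite ?b1.
    by rewrite z1 z2 !mul0r subrr.
  - move=> c; apply: (@unc_comp R T _ (fun=> l) id (fun=> t) (dy a) c).
    + exact: cvg_cst.
    + exact: cvg_id.
    + exact: cvg_cst.
    + exact: cls_cont (clsdy (ac 1%N)) _.
  - move=> s; rewrite dya; apply: drvM; first exact: cls_dx (Wpc 1%N).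
    exact: cls_dx (p2 1%N).
have := drv0_cst I0 (exit_at l) (-1); rewrite /I /exit_area.
have -> : (fun s => a l s (exit_at l)) = exit_shift l.
  apply/funext => s; rewrite /a /exit_shift jac_dx//.
  by apply: out_y; exact: exit_atP.
move=> ->.
have -> : (fun s => a l s (-1)) = fun=> 0.
  apply/funext => s; have m1 : (-1 : R) <= -1 by [].
  have d1 : dx phi1 l s (-1) = 1.
    rewrite (@dx_congr R T T phi1 (fun _ x _ => x) l l s (-1) (-1)); first exact: dx_eq (drvI s).
    by move=> z; rewrite phi10.
  by rewrite /a d1 phi20 area_coord_below// mul1r subrr.
by rewrite (@prim_eq _ (fun=> 0) (fun=> 0)) ?subrr// => [z|z]; [exact: cvg_cst|exact: drvC].
Qed.

Lemma exit_area_side l c : 1 <= `|c| -> exit_area l c = 0.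
Proof.
have e1 : exit_area l (-1) = 0 by rewrite /exit_area prim0.
rewrite ler_normr => /orP[c1|c1].
  rewrite -(exit_area_total l); apply/esym; apply: (drv0_cst_in c1) => z /andP[z1 _].
  apply: drv_eq (exit_area_drv l z) _; apply: exit_shift_side.
  by rewrite ler_normr z1.
rewrite -e1; have c1' : c <= -1 by lra.
apply: (drv0_cst_in c1') => z /andP[_ z1].
apply: drv_eq (exit_area_drv l z) _; apply: exit_shift_side.
by rewrite ler_normr; apply/orP; right; lra.
Qed.

End Chart.

(** * A smooth step function *)

Section Bump.
Variable R : realType.
Implicit Types (x y t : R) (p : {poly R}).

Definition flat p x : R := if 0 < x then p.[x^-1] * expR (- x^-1) else 0.

(** [expR y] is the power [n.+1] of a number at least 1 and at least [y / (n%:R + 1)]; [n] of the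
    factors are bounded below by the latter. *)
Lemma exp_dominates n y : 0 < y -> y ^+ n * expR (- y) <= (n%:R + 1) ^+ n.
Proof.
move=> y0; rewrite expRN ler_pdivrMr ?expR_gt0//.
have n0 : 0 < n%:R + 1 :> R by rewrite ltr_wpDl.
have yn : 0 < y / (n%:R + 1) by rewrite divr_gt0.
have e : y / (n%:R + 1) <= expR (y / (n%:R + 1)).
  by apply: le_trans (expR_ge1Dx _); rewrite lerDr.
have e1 : 1 <= expR (y / (n%:R + 1)) by apply: le_trans (expR_ge1Dx _); rewrite lerDl ltW.
have -> : expR y = expR (y / (n%:R + 1)) ^+ n.+1.
  rewrite -expRM_natl; congr expR.
  by rewrite -natr1; field; rewrite gt_eqF.
have -> : y ^+ n = (n%:R + 1) ^+ n * (y / (n%:R + 1)) ^+ n.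
  by rewrite -exprMn mulrC divfK// gt_eqF.
rewrite ler_pM2l ?exprn_gt0//.
apply: (@le_trans _ _ (expR (y / (n%:R + 1)) ^+ n)).
  by apply: lerXn2r; rewrite ?nnegrE ?expR_ge0 ?(ltW yn).
by rewrite exprSr ler_peMr// exprn_ge0// expR_ge0.
Qed.

Lemma poly_exp_bound p : exists2 C, 0 < C & forall y, 0 < y -> `|p.[y]| * expR (- y) <= C.
Proof.
exists (\sum_(i < size p) `|p`_i| * (i%:R + 1) ^+ i + 1).
  by rewrite ltr_wpDl// sumr_ge0// => i _; rewrite mulr_ge0// exprn_ge0// addr_ge0.
move=> y y0; rewrite horner_coef.
apply: (@le_trans _ _ (\sum_(i < size p) `|p`_i| * (i%:R + 1) ^+ i)); last by rewrite lerDl.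
apply: (@le_trans _ _ ((\sum_(i < size p) `|p`_i * y ^+ i|) * expR (- y))).
  by rewrite ler_wpM2r ?expR_ge0// ler_norm_sum.
rewrite mulr_suml; apply: ler_sum => i _.
rewrite normrM -mulrA (ger0_norm (exprn_ge0 i (ltW y0))) ler_wpM2l//.
exact: exp_dominates.
Qed.

(** Gives the derivative 0 at the origin; the factor [x ^+ 2] comes from applying the exponential
    bound to [p * 'X^2]. *)
Lemma flat_quadratic p : exists2 C, 0 < C & forall x, `|flat p x| <= C * x ^+ 2.
Proof.
have [C C0 CP] := poly_exp_bound (p * 'X^2).
exists C => // x; rewrite /flat; case: ifPn => [x0|_]; last first.
  by rewrite normr0 mulr_ge0 ?sqr_ge0// ltW.
have := CP x^-1; rewrite invr_gt0 => /(_ x0).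
rewrite hornerM hornerXn normrM (ger0_norm (exprn_ge0 _ (ltW _))) ?invr_gt0// => H.
rewrite normrM (ger0_norm (expR_ge0 _)) -ler_pdivrMr ?exprn_gt0//.
by rewrite mulrAC -exprVn.
Qed.

Lemma flat_drv p x : drv (flat p) x (flat ('X^2 * (p - p^`())) x).
Proof.
have [x0|x0|x0] := ltgtP 0 x.
- have e : \forall t \near x, p.[t^-1] * expR (- t^-1) = flat p t.
    near=> t; have t0 : 0 < t by near: t; exact: lt_nbhsr.
    by rewrite /flat t0.
  apply: (near_drv e).
  have xn : x != 0 by rewrite gt_eqF.
  have iv : drv (fun t => t^-1) x (- 1 * x^-1 * x^-1) by exact: drvV xn (drvI x).
  have dp : drv (fun t => p.[t]) x^-1 (p^`()).[x^-1].
    by rewrite /drv; exact: is_derive_poly.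
  apply: drv_eq (drvM (@drv_comp _ (fun t => p.[t]) (fun t => t^-1) x _ _ dp iv)
    (drv_expf (drvN iv))) _.
  by rewrite /flat x0 hornerM hornerD hornerN hornerXn /=; ring.
- have e : \forall t \near x, 0 = flat p t.
    near=> t; have t0 : t < 0 by near: t; exact: lt_nbhsl.
    by rewrite /flat ltNge (ltW t0).
  by apply: (near_drv e); rewrite /flat ltNge (ltW x0) /=; exact: drvC.
- rewrite -x0 {2}/flat ltxx.
  have [C C0 CP] := flat_quadratic p.
  apply: drv_quot => e e0; apply: (@cvg_within _ (nbhs 0)).
  apply/nbhs_ballP; exists (e / C) => /=; first by rewrite divr_gt0.
  move=> h; rewrite /ball /= sub0r normrN => hd.
  rewrite add0r mulr0 subr0 {2}/flat ltxx subr0.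
  apply: le_trans (CP h) _; rewrite -real_normK ?num_real// expr2 mulrA.
  by rewrite ler_wpM2r// mulrC -ler_pdivlMr// ltW.
Unshelve. all: by end_near. Qed.

Lemma flat_cls (T : topologicalType) k p : cls k (fun (_ : T) x (_ : R) => flat p x).
Proof.
apply: (@cls_fun_set R T (fun g => exists p, g = flat p)); last by exists p.
move=> g [q ->]; exists (flat ('X^2 * (q - q^`()))); first by eexists.
by move=> x; exact: flat_drv.
Qed.

Definition bump_density x := flat 1 (x - 1) * flat 1 (2 - x).

Lemma flat1_ge0 x : 0 <= flat 1 x.
Proof. by rewrite /flat; case: ifP => // _; rewrite hornerE mul1r expR_ge0. Qed.

Lemma flat1_gt0 x : 0 < x -> 0 < flat 1 x.
Proof. by move=> x0; rewrite /flat x0 hornerE mul1r expR_gt0. Qed.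

Lemma flat1_le1 x : flat 1 x <= 1.
Proof.
rewrite /flat; case: ifP => // x0; rewrite hornerE mul1r -expR0 ler_expR.
by rewrite oppr_le0 invr_ge0 ltW.
Qed.

Lemma bump_cls (T : topologicalType) k : cls k (fun (_ : T) x (_ : R) => bump_density x).
Proof.
have fc (b : T -> R -> R -> R) : cls k b -> cls k (fun l x y => flat 1 (b l x y)).
  by apply: cls_fun1; exact: flat_cls.
apply: clsM; apply: fc; apply: clsB; first [exact: clsX|exact: clsC].
Qed.

Lemma bump_ge0 x : 0 <= bump_density x.
Proof. by rewrite mulr_ge0// flat1_ge0. Qed.

Lemma bump_le1 x : bump_density x <= 1.
Proof. by rewrite mulr_ile1 ?flat1_ge0 ?flat1_le1. Qed.

Lemma bump_out x : x <= 1 \/ 2 <= x -> bump_density x = 0.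
Proof.
rewrite /bump_density /flat; case=> h.
  by rewrite (ltNge 0 (x - 1)) (_ : x - 1 <= 0) ?mul0r//; lra.
by rewrite (ltNge 0 (2 - x)) (_ : 2 - x <= 0) ?mulr0//; lra.
Qed.

Let bump_cont : continuous bump_density.
Proof.
move=> x; apply: (@unc_comp R R _ id id id (fun _ x _ => bump_density x) x); try exact: cvg_id.
exact: cls_cont (bump_cls R 0%N) _.
Qed.

Let mass := prim bump_density 1 2.

Let pd x : drv (prim bump_density 1) x (bump_density x). Proof. exact: drv_prim. Qed.

Let mass_gt0 : 0 < mass.
Proof.
have h1 : prim bump_density 1 1 <= prim bump_density 1 (5 / 4).
  by apply: le_drv (fun x _ => pd x) (fun x _ => bump_ge0 x); lra.
have h2 : prim bump_density 1 (5 / 4) < prim bump_density 1 (7 / 4).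
  apply: lt_drv (fun x _ => pd x) _; first by lra.
  by move=> x xx; rewrite mulr_gt0// flat1_gt0//; lra.
have h3 : prim bump_density 1 (7 / 4) <= prim bump_density 1 2.
  by apply: le_drv (fun x _ => pd x) (fun x _ => bump_ge0 x); lra.
by move: h1; rewrite prim0 /mass; lra.
Qed.

Definition dstep x := bump_density x / mass.
Definition step x := prim bump_density 1 x / mass.

Lemma step_drv x : drv step x (dstep x).
Proof.
by apply: drv_eq (drvM (pd x) (drvC mass^-1 x)) _; rewrite mulr0 addr0.
Qed.

Lemma dstep_cls (T : topologicalType) k : cls k (fun (_ : T) x (_ : R) => dstep x).
Proof. by apply: clsM; [exact: bump_cls|exact: clsC]. Qed.

Lemma step_cls (T : topologicalType) k : cls k (fun (_ : T) x (_ : R) => step x).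
Proof. by apply: clsM; [exact: cls_prim1 (bump_cls T k)|exact: clsC]. Qed.

Lemma dstep_ge0 x : 0 <= dstep x.
Proof. by rewrite divr_ge0 ?bump_ge0// ltW. Qed.

Definition step_slope : R := mass^-1.

Lemma step_slope_gt0 : 0 < step_slope.
Proof. by rewrite invr_gt0. Qed.

Lemma dstep_le x : dstep x <= step_slope.
Proof. by rewrite ler_piMl ?bump_le1// invr_ge0 ltW. Qed.

Lemma dstep_out x : x <= 1 \/ 2 <= x -> dstep x = 0.
Proof. by move=> h; rewrite /dstep bump_out// mul0r. Qed.

Lemma step_below x : x <= 1 -> step x = 0.
Proof.
move=> x1; rewrite (_ : 0 = step 1); last by rewrite /step prim0 mul0r.
apply: (drv0_cst_in x1) => z /andP[_ z1].
by apply: drv_eq (step_drv z) _; apply: dstep_out; left.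
Qed.

Lemma step_above x : 2 <= x -> step x = 1.
Proof.
move=> x2; rewrite (_ : 1 = step 2); last by rewrite /step divff// gt_eqF.
apply/esym; apply: (drv0_cst_in x2) => z /andP[z2 _].
by apply: drv_eq (step_drv z) _; apply: dstep_out; right.
Qed.

Lemma step_itv x : 0 <= step x <= 1.
Proof.
have mono a b : a <= b -> step a <= step b.
  by move=> ab; apply: le_drv ab (fun x _ => step_drv x) (fun x _ => dstep_ge0 x).
apply/andP; split.
  have [x1|/ltW x1] := leP x 1; first by rewrite step_below.
  by rewrite -(step_below (lexx 1)); exact: mono.
have [x1|/ltW x1] := leP 2 x; first by rewrite step_above.
by rewrite -(step_above (lexx 2)); exact: mono.
Qed.

End Bump.

(** * Jacobian determinants *)

Section Jacobian.
Variables (R : realType) (T : topologicalType).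
Implicit Types (a b : T -> R -> R -> R) (l : T) (x y : R).

Definition jacdet a1 a2 l x y :=
  dx a1 l x y * dy a2 l x y - dy a1 l x y * dx a2 l x y.

Lemma jacdet_comp a1 a2 b1 b2 l x y : cls 1 a1 -> cls 1 a2 -> cls 1 b1 -> cls 1 b2 ->
  jacdet (fun l x y => a1 l (b1 l x y) (b2 l x y)) (fun l x y => a2 l (b1 l x y) (b2 l x y)) l x y =
  jacdet a1 a2 l (b1 l x y) (b2 l x y) * jacdet b1 b2 l x y.
Proof.
move=> a1c a2c b1c b2c; rewrite /jacdet.
have dxc a : cls 1 a -> dx (fun l x y => a l (b1 l x y) (b2 l x y)) l x y =
    dx a l (b1 l x y) (b2 l x y) * dx b1 l x y + dy a l (b1 l x y) (b2 l x y) * dx b2 l x y.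
  move=> ac; apply: dx_eq.
  exact: (cls_drv (b := fun s => b1 l s y) (c := fun s => b2 l s y) l ac
    (cls_dx l x y b1c) (cls_dx l x y b2c)).
have dyc a : cls 1 a -> dy (fun l x y => a l (b1 l x y) (b2 l x y)) l x y =
    dx a l (b1 l x y) (b2 l x y) * dy b1 l x y + dy a l (b1 l x y) (b2 l x y) * dy b2 l x y.
  move=> ac; apply: dy_eq.
  exact: (cls_drv (b := b1 l x) (c := b2 l x) l ac (cls_dy l x y b1c) (cls_dy l x y b2c)).
by rewrite !dxc// !dyc//; ring.
Qed.

Lemma dx_X l x y : dx (fun (_ : T) x (_ : R) => x) l x y = 1.
Proof. exact: dx_eq (drvI x). Qed.

Lemma dy_X l x y : dy (fun (_ : T) x (_ : R) => x) l x y = 0.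
Proof. exact: dy_eq (drvC x y). Qed.

Lemma dx_Y l x y : dx (fun (_ : T) (_ : R) y => y) l x y = 0.
Proof. exact: dx_eq (drvC y x). Qed.

Lemma dy_Y l x y : dy (fun (_ : T) (_ : R) y => y) l x y = 1.
Proof. exact: dy_eq (drvI y). Qed.

End Jacobian.

(** * Correction above the box *)

Section Correction.
Variables (R : realType) (T : topologicalType).
Implicit Types (l : T) (x y c v C Y X : R).
Variables h hp K Kp : T -> R -> R.
Hypothesis hc : Cinf (fun l x (_ : R) => h l x).
Hypothesis hpc : Cinf (fun l x (_ : R) => hp l x).
Hypothesis Kc : Cinf (fun l x (_ : R) => K l x).
Hypothesis Kpc : Cinf (fun l x (_ : R) => Kp l x).
Hypothesis hd : forall l c, drv (h l) c (hp l c).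
Hypothesis Kd : forall l c, drv (K l) c (Kp l c).
Hypothesis hp0 : forall l c, 0 < hp l c.
Hypothesis h_side : forall l c, 1 <= `|c| -> h l c = c.
Hypothesis hp_side : forall l c, 1 <= `|c| -> hp l c = 1.
Hypothesis K_side : forall l c, 1 <= `|c| -> K l c = 0.
Hypothesis Kp_side : forall l c, 1 <= `|c| -> Kp l c = 0.

Let om Y := prim (@step R) 1 Y.
Let r0 : R := 2 - om 2.

Let step_cont : continuous (@step R).
Proof. exact: drv_continuous (@step_drv R). Qed.

Let om_drv Y : drv om Y (step Y).
Proof. exact: drv_prim. Qed.

Let om_below Y : Y <= 1 -> om Y = 0.
Proof.
move=> Y1; rewrite -(prim0 (@step R) 1); apply: (drv0_cst_in Y1) => z /andP[_ z1].
by apply: drv_eq (om_drv z) _; exact: step_below.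
Qed.

Let om_above Y : 2 <= Y -> om Y = Y - r0.
Proof.
move=> Y2; have D z : 2 <= z <= Y -> drv (fun z => om z - z) z 0.
  move=> /andP[z2 _]; apply: drv_eq (drvB (om_drv z) (drvI z)) _.
  by rewrite step_above// subrr.
by have := drv0_cst_in Y2 D; rewrite /r0; lra.
Qed.

Let om_cls k : cls k (fun (_ : T) x (_ : R) => om x).
Proof. exact: cls_prim1 (step_cls R T k). Qed.

(** The correction has the generating function [C * Y + om Y * (h l C - C) - eta l Y * Kt l C],
    whose derivatives in [Y] and in [C] are [corr_g] and [corr_v]. Above the transition [om Y] is
    [Y - r0] and not [Y]; the term in [r0] compensates for this, leaving exactly [hp * Y - Kp]. *)
Let Kt l c := K l c - r0 * (h l c - c).
Let Ktp l c := Kp l c - r0 * (hp l c - 1).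

Let Kt_drv l c : drv (Kt l) c (Ktp l c).
Proof. exact: drvB (Kd l c) (drvZ r0 (drvB (hd l c) (drvI c))). Qed.

Let Kt_side l c : 1 <= `|c| -> Kt l c = 0 /\ Ktp l c = 0.
Proof.
move=> c1; rewrite /Kt /Ktp K_side// h_side// Kp_side// hp_side//.
by rewrite !subrr mulr0 subrr.
Qed.

Let Ktp_cls k : cls k (fun l x (_ : R) => Ktp l x).
Proof.
apply: (clsB (Kpc k)); apply: clsM; first exact: clsC.
exact: (clsB (hpc k) (clsC T k 1)).
Qed.

Let Kt_cls k : cls k (fun l x (_ : R) => Kt l x).
Proof.
apply: (clsB (Kc k)); apply: clsM; first exact: clsC.
exact: (clsB (hc k) (clsX R T k)).
Qed.

Lemma majorant_of_slice (q : T -> R -> R) : Cinf (fun l x (_ : R) => q l x) ->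
  exists2 M : T -> R, continuous M & forall l x, -1 <= x <= 1 -> `|q l x| <= M l.
Proof.
move=> qc; apply: continuous_majorant => z.
apply: (@unc_comp R T _ fst snd (fun=> 0) (fun l x (_ : R) => q l x) z).
- exact: cvg_fst.
- exact: cvg_snd.
- exact: cvg_cst.
- exact: cls_cont (qc 0%N) _.
Qed.

Let hpV_cls k : cls k (fun l x (_ : R) => (hp l x)^-1).
Proof. by apply: (clsV _ (hpc k)) => l x _; rewrite gt_eqF. Qed.

Let slope : {M : T -> R | continuous M & forall l x, -1 <= x <= 1 -> `|Ktp l x / hp l x| <= M l}.
Proof.
apply: cid2; apply: majorant_of_slice => k.
exact: clsM (Ktp_cls k) (hpV_cls k).
Qed.

(** The width of the second transition: [deta] is at most [step_slope R / N l], and [N l] exceeds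
    [step_slope R] times a bound of [|Ktp / hp|] on [-1, 1], so that [deta * |Ktp| < hp]. *)
Let N l := 1 + step_slope R * s2val slope l.

Let N_cont : continuous N.
Proof.
move=> l; apply: (@atD _ _ (fun=> 1) (fun l => step_slope R * s2val slope l)); first exact: cvg_cst.
apply: (@atM _ _ (fun=> step_slope R)); first exact: cvg_cst.
exact: (s2valP slope).
Qed.

Let slope_ge0 l : 0 <= s2val slope l.
Proof.
have z : -1 <= (0 : R) <= 1 by lra.
by have := s2valP' slope l 0 z; apply: le_trans.
Qed.

Let N0 l : 0 < N l.
Proof. by rewrite /N ltr_pwDl// mulr_ge0// ltW// step_slope_gt0. Qed.

(** Places the second transition on [[2, 2 + N l]], where [step] is already 1. *)
Let etaarg l Y := (Y - 2) / N l + 1.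
Let eta l Y := step (etaarg l Y).
Let deta l Y := dstep (etaarg l Y) / N l.

Let etaarg_cls k : cls k (fun l (_ : R) y => etaarg l y).
Proof.
apply: clsD; last exact: clsC.
apply: clsM; first exact: (clsB (clsY R T k) (clsC T k 2)).
apply: clsV; first by move=> l _ _; rewrite gt_eqF.
by apply: cls_param.
Qed.

Let eta_cls k : cls k (fun l (_ : R) y => eta l y).
Proof. exact: (cls_fun1 (step_cls R T k) (etaarg_cls k)). Qed.

Let deta_cls k : cls k (fun l (_ : R) y => deta l y).
Proof.
apply: clsM; first exact: (cls_fun1 (dstep_cls R T k) (etaarg_cls k)).
apply: clsV; first by move=> l _ _; rewrite gt_eqF.
by apply: cls_param.
Qed.

Let eta_drv l Y : drv (eta l) Y (deta l Y).
Proof.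
have i : drv (etaarg l) Y (N l)^-1.
  by apply: drv_eq (drvD (drvM (drvB (drvI Y) (drvC 2 Y)) (drvC (N l)^-1 Y)) (drvC 1 Y)) _; ring.
exact: (@drv_comp _ (@step R) (etaarg l) Y _ _ (step_drv _) i).
Qed.

Let eta_below l Y : Y <= 2 -> eta l Y = 0 /\ deta l Y = 0.
Proof.
move=> Y2; have a1 : etaarg l Y <= 1.
  by rewrite /etaarg gerDr pmulr_lle0 ?invr_gt0//; lra.
by rewrite /eta /deta step_below// dstep_out ?mul0r//; left.
Qed.

Let eta_above l Y : 2 + N l <= Y -> eta l Y = 1 /\ deta l Y = 0.
Proof.
move=> Y2; have a1 : 2 <= etaarg l Y.
  have : 1 <= (Y - 2) / N l by rewrite ler_pdivlMr// mul1r; lra.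
  by rewrite /etaarg; lra.
by rewrite /eta /deta step_above// dstep_out ?mul0r//; right.
Qed.

(* The derivative of corr_g in C is that of corr_v in Y, namely corr_dg, so that
   (corr_g, Y) |-> (C, corr_v) preserves the area.  The step eta is so slow
   (N is large) that corr_dg > 0. *)
Definition corr_g l C Y := C + step Y * (h l C - C) - deta l Y * Kt l C.
Definition corr_dg l C Y := 1 + step Y * (hp l C - 1) - deta l Y * Ktp l C.
Definition corr_v l C Y := Y + (hp l C - 1) * om Y - eta l Y * Ktp l C.

Let Ysub k (f : R -> R) : cls k (fun (_ : T) x (_ : R) => f x) -> cls k (fun (_ : T) (_ : R) y => f y).
Proof. by move=> fc; exact: (cls_fun1 fc (clsY R T k)). Qed.

Lemma corr_g_Cinf : Cinf corr_g.
Proof.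
move=> k; apply: clsB.
  apply: clsD; first exact: clsX.
  apply: clsM; first by apply: Ysub; exact: step_cls.
  exact: (clsB (hc k) (clsX R T k)).
exact: (clsM (deta_cls k) (Kt_cls k)).
Qed.

Lemma corr_v_Cinf : Cinf corr_v.
Proof.
move=> k; apply: clsB.
  apply: clsD; first exact: clsY.
  apply: clsM; first exact: (clsB (hpc k) (clsC T k 1)).
  by apply: (@Ysub k om); exact: om_cls.
exact: (clsM (eta_cls k) (Ktp_cls k)).
Qed.

Lemma corr_g_drv l C Y : drv (fun C => corr_g l C Y) C (corr_dg l C Y).
Proof.
by apply: drv_eq (drvB (drvD (drvI C) (drvZ (step Y) (drvB (hd l C) (drvI C))))
  (drvZ (deta l Y) (Kt_drv l C))) _.
Qed.

Lemma corr_v_drv l C Y : drv (corr_v l C) Y (corr_dg l C Y).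
Proof.
apply: drv_eq (drvB (drvD (drvI Y) (drvZ (hp l C - 1) (om_drv Y)))
  (drvM (eta_drv l Y) (drvC (Ktp l C) Y))) _.
by rewrite /corr_dg; ring.
Qed.

(** Up to height 2 this is a convex combination of 1 and [hp]; beyond, it is [hp - deta * Ktp], and
    [N] is large enough. *)
Lemma corr_dg_gt0 l C Y : 0 < corr_dg l C Y.
Proof.
rewrite /corr_dg; have [Y2|/ltW Y2] := leP Y 2.
  have [_ ->] := eta_below l Y2; rewrite mul0r subr0.
  have /andP[s0 s1] := step_itv Y.
  have [->|sn] := eqVneq (step Y) 0; first by rewrite mul0r addr0.
  rewrite (_ : 1 + _ = (1 - step Y) + step Y * hp l C); last by ring.
  by apply: ltr_wpDl; [rewrite subr_ge0|rewrite mulr_gt0// lt_neqAle eq_sym sn].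
rewrite step_above// mul1r (addrC 1) subrK.
have [c1|c1] := leP 1 `|C|.
  by have [_ ->] := Kt_side l c1; rewrite mulr0 subr0.
have Cin : -1 <= C <= 1 by rewrite -ler_norml ltW.
have M := s2valP' slope l C Cin.
have KM : `|Ktp l C| <= s2val slope l * hp l C.
  by move: M; rewrite normrM normfV (gtr0_norm (hp0 l C)) ler_pdivrMr.
have d0 : 0 <= deta l Y by rewrite divr_ge0 ?dstep_ge0// ltW.
have dN : deta l Y * N l <= step_slope R by rewrite /deta divfK ?gt_eqF// dstep_le.
rewrite subr_gt0; apply: le_lt_trans (_ : deta l Y * (s2val slope l * hp l C) < _).
  by rewrite ler_wpM2l// (le_trans (ler_norm _)).
rewrite -(ltr_pM2l (N0 l)) [ltLHS](_ : _ = deta l Y * N l * (s2val slope l * hp l C)); last by ring.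
apply: le_lt_trans (_ : step_slope R * (s2val slope l * hp l C) < _).
  by apply: ler_wpM2r => //; apply: mulr_ge0 => //; exact: ltW.
by rewrite /N mulrDl mul1r mulrA ltrDr.
Qed.

Lemma corr_below l C Y : Y <= 1 -> corr_g l C Y = C /\ corr_v l C Y = Y.
Proof.
move=> Y1; have Y2 : Y <= 2 by lra.
have [e1 e2] := eta_below l Y2.
by rewrite /corr_g /corr_v e1 e2 step_below// om_below// !mul0r mulr0 !subr0 !addr0.
Qed.

Lemma corr_side l C Y : 1 <= `|C| -> corr_g l C Y = C /\ corr_v l C Y = Y.
Proof.
move=> c1; have [k1 k2] := Kt_side l c1.
by rewrite /corr_g /corr_v k1 k2 h_side// hp_side// !subrr mul0r !mulr0 !subr0 !addr0.
Qed.

Definition corr_top l := 2 + N l.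

Lemma corr_top_cont : continuous corr_top.
Proof.
move=> l; apply: (@atD _ _ (fun=> 2) N); first exact: cvg_cst.
exact: N_cont.
Qed.

Lemma corr_top_gt1 l : 1 < corr_top l.
Proof. by have := N0 l; rewrite /corr_top; lra. Qed.

Lemma corr_above l C Y : corr_top l <= Y ->
  corr_g l C Y = h l C /\ corr_v l C Y = hp l C * Y - Kp l C.
Proof.
move=> Y1; have [e1 e2] := eta_above Y1.
have Y2 : 2 <= Y by have := N0 l; move: Y1; rewrite /corr_top; lra.
rewrite /corr_g /corr_v e1 e2 step_above// om_above// /Ktp; split; ring.
Qed.

Lemma corr_trivial l : (forall c, h l c = c) -> (forall c, hp l c = 1) ->
  (forall c, K l c = 0) -> (forall c, Kp l c = 0) ->
  forall C Y, corr_g l C Y = C /\ corr_v l C Y = Y.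
Proof.
move=> e1 e2 e3 e4 C Y; rewrite /corr_g /corr_v /Kt /Ktp e1 e2 e3 e4.
by rewrite !subrr !mulr0 mul0r !subrr !mulr0 !subr0 !addr0.
Qed.

Lemma corr_g_surj l Y X : exists C, corr_g l C Y = X.
Proof.
have [X1|X1] := leP 1 `|X|; first by exists X; have [] := corr_side l Y X1.
have s1 : 1 <= `|1 : R| by rewrite normr1.
have s2 : 1 <= `|-1 : R| by rewrite normrN1.
have [e1 _] := corr_side l Y s1; have [e2 _] := corr_side l Y s2.
have gc : continuous (fun C => corr_g l C Y) := drv_continuous (fun C => corr_g_drv l C Y).
have le11 : (-1 : R) <= 1 by lra.
have mm : Num.min (corr_g l (-1) Y) (corr_g l 1 Y) <= X <= Num.max (corr_g l (-1) Y) (corr_g l 1 Y).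
  rewrite e1 e2 ge_min le_max; move: X1; rewrite ltr_norml => /andP[a b].
  by rewrite (ltW a) (ltW b) orbT.
by have [C _ <-] := ivt le11 gc mm; exists C.
Qed.

Lemma corr_v_surj l C v : exists Y, corr_v l C Y = v.
Proof.
have [v1|/ltW v1] := leP v 1; first by exists v; have [] := corr_below l C v1.
have [e1 e2] := corr_below l C (lexx 1).
pose Y := corr_top l + (`|v| + `|Kp l C|) / hp l C.
have d0 : 0 <= (`|v| + `|Kp l C|) / hp l C by rewrite divr_ge0 ?addr_ge0// ltW.
have tY : corr_top l <= Y by rewrite /Y lerDl.
have Y1 : 1 <= Y by have := corr_top_gt1 l; lra.
have [_ eY] := corr_above C tY.
have vY : v <= corr_v l C Y.
  rewrite eY /Y mulrDr (mulrC (hp l C) (_ / _)) divfK ?gt_eqF//.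
  have : 0 <= hp l C * corr_top l by rewrite mulr_ge0 ?ltW// (lt_trans _ (corr_top_gt1 l)).
  have := ler_norm v; have := ler_norm (Kp l C); lra.
have vc : continuous (corr_v l C) := drv_continuous (corr_v_drv l C).
have mm : Num.min (corr_v l C 1) (corr_v l C Y) <= v <= Num.max (corr_v l C 1) (corr_v l C Y).
  by rewrite e2 ge_min le_max v1 vY orbT.
by have [Z _ <-] := ivt Y1 vc mm; exists Z.
Qed.

Lemma corr_v_inj l C Y Y' : corr_v l C Y = corr_v l C Y' -> Y = Y'.
Proof.
have mono a b : a < b -> corr_v l C a < corr_v l C b.
  by move=> ab; apply: lt_drv ab (fun x _ => corr_v_drv l C x) (fun x _ => corr_dg_gt0 l C x).
by move=> e; have [/mono|/mono|//] := ltgtP Y Y'; rewrite e ltxx.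
Qed.

(** [X = corr_g l C Y] is solved for [C] by monotonicity, and [corr_v] then gives the second
    coordinate. As functions of [(C, Y)], both [(X, Y)] and [(C, corr_v)] have Jacobian [corr_dg],
    so passing from one to the other preserves the area. *)
Theorem correction : exists (P1 P2 : T -> R -> R -> R) (top : T -> R),
  [/\ Cinf P1 /\ Cinf P2, continuous top /\ (forall l, 1 < top l),
      forall l x y, jacdet P1 P2 l x y = 1,
      (forall l x y x' y', P1 l x y = P1 l x' y' -> P2 l x y = P2 l x' y' -> x = x' /\ y = y') /\
      (forall l x y, exists x' y', P1 l x' y' = x /\ P2 l x' y' = y) &
   [/\ forall l x y, 1 <= `|x| \/ y <= 1 -> P1 l x y = x /\ P2 l x y = y,
      forall l c y, top l <= y -> P1 l (h l c) y = c /\ P2 l (h l c) y = hp l c * y - Kp l c &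
      forall l, (forall c, h l c = c) -> (forall c, hp l c = 1) ->
        (forall c, K l c = 0) -> (forall c, Kp l c = 0) ->
        forall x y, P1 l x y = x /\ P2 l x y = y]].
Proof.
(* The variables are exchanged because [cls_inverse1] inverts in the second one. *)
pose S l Y C := corr_g l C Y.
have Sc : Cinf S by move=> k; exact: (cls_subst (corr_g_Cinf k) (clsY R T k) (clsX R T k)).
have Sd l Y C : dy S l Y C = corr_dg l C Y by apply: dy_eq; exact: corr_g_drv.
have [] := @cls_inverse1 R T S Sc.
- by move=> l Y C; rewrite Sd corr_dg_gt0.
- by move=> l Y X; exact: corr_g_surj.
move=> Cc [Ccc SC CS].
pose P1 l X Y := Cc l Y X.
pose P2 l X Y := corr_v l (P1 l X Y) Y.
have P1c : Cinf P1 by move=> k; exact: (cls_subst (Ccc k) (clsY R T k) (clsX R T k)).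
have P2c : Cinf P2 by move=> k; exact: (cls_subst (corr_v_Cinf k) (P1c k) (clsY R T k)).
have P1g l C Y : P1 l (corr_g l C Y) Y = C by exact: CS.
have gP1 l X Y : corr_g l (P1 l X Y) Y = X by exact: SC.
have PG l C Y : P1 l (corr_g l C Y) Y = C /\ P2 l (corr_g l C Y) Y = corr_v l C Y.
  by rewrite /P2 P1g.
exists P1, P2, corr_top; split.
- by [].
- by split; [exact: corr_top_cont|exact: corr_top_gt1].
- move=> l x y; rewrite -{1}(gP1 l x y); set C := P1 l x y.
  have := @jacdet_comp R T P1 P2 corr_g (fun _ _ y => y) l C y (P1c 1%N) (P2c 1%N)
    (corr_g_Cinf 1%N) (clsY R T 1).
  have -> : (fun l x y => P1 l (corr_g l x y) y) = (fun _ x _ => x).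
    by apply/funext => l'; apply/funext => x'; apply/funext => y'; exact: P1g.
  have -> : (fun l x y => P2 l (corr_g l x y) y) = corr_v.
    by apply/funext => l'; apply/funext => x'; apply/funext => y'; rewrite /P2 P1g.
  rewrite {1 3}/jacdet dx_X dy_X dx_Y dy_Y mul1r mul0r subr0 mulr1 mulr0 subr0.
  rewrite (dy_eq (corr_v_drv l C y)) (dx_eq (corr_g_drv l C y)) => e.
  have g0 := corr_dg_gt0 l C y.
  by apply: (mulIf (lt0r_neq0 g0)); rewrite -e mul1r.
- split.
    move=> l x y x' y' e1; rewrite /P2 e1 => /corr_v_inj yy.
    by split=> //; rewrite -(gP1 l x y) e1 yy gP1.
  move=> l x y; have [Y YP] := corr_v_surj l x y.
  by exists (corr_g l x Y), Y; rewrite /P2 P1g.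
- split.
  + move=> l x y xy; have [e1 e2] : corr_g l x y = x /\ corr_v l x y = y.
      by case: xy => ?; [exact: corr_side|exact: corr_below].
    by have := PG l x y; rewrite e1 e2.
  + move=> l c y ty; have [e1 e2] := corr_above c ty.
    by have := PG l c y; rewrite e1 e2.
  + move=> l h1 h2 h3 h4 x y; have [e1 e2] := corr_trivial h1 h2 h3 h4 x y.
    by have := PG l x y; rewrite e1 e2.
Qed.

End Correction.

(** * The area-preserving straightening map *)

Section Straightening.
Variables (R : realType) (T : topologicalType).
Implicit Types (l : T) (x y c t s r v : R).
Variables W1 W2 th : T -> R -> R -> R.
Hypothesis SW : standard_field W1 W2.
Hypothesis thc : Cinf th.
Hypothesis tho : forall l x y, outside x y -> th l x y = 0.
Hypothesis pol : forall l x y, polar (W1 l x y) (W2 l x y) (th l x y).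

Theorem area_straightening : exists (G1 G2 : T -> R -> R -> R) (M : T -> R),
  [/\ Cinf G1 /\ Cinf G2, continuous M,
      forall l x y, jacdet G1 G2 l x y = 1,
      (forall l x y x' y', G1 l x y = G1 l x' y' -> G2 l x y = G2 l x' y' -> x = x' /\ y = y')
      /\ (forall l x y, exists x' y', G1 l x' y' = x /\ G2 l x' y' = y) &
   [/\ forall l c v, [\/ 1 <= `|c|, v <= -1 | M l <= v] -> G1 l c v = c /\ G2 l c v = v,
      forall l, (forall x y, W1 l x y = 0) -> forall c v, G1 l c v = c /\ G2 l c v = v &
      forall l (F1 F2 : T -> R -> R -> R), Cinf F1 -> Cinf F2 ->
        (forall x y, jacdet F1 F2 l x y = 1) ->
        (forall x y, W1 l x y = - dy F1 l x y) -> (forall x y, W2 l x y = dx F1 l x y) ->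
        (forall x y, outside x y -> F1 l x y = x /\ F2 l x y = y) ->
        forall c v, F1 l (G1 l c v) (G2 l c v) = c /\ F2 l (G1 l c v) (G2 l c v) = v]].
Proof.
have orb l c : exists g : (R -> R) * (R -> R),
    [/\ g.1 (-1) = c, g.2 (-1) = -1 & solution (W1 l) (W2 l) g.1 g.2].
  by have [g1 [g2 H]] := orbit_exists SW l c (-1) (-1); exists (g1, g2).
pose phi1 l c := (projT1 (cid (orb l c))).1.
pose phi2 l c := (projT1 (cid (orb l c))).2.
have phi10 l c : phi1 l c (-1) = c by rewrite /phi1; case: cid => g /= [].
have phi20 l c : phi2 l c (-1) = -1 by rewrite /phi2; case: cid => g /= [].
have phiS l c : solution (W1 l) (W2 l) (phi1 l c) (phi2 l c).
  by rewrite /phi1 /phi2; case: cid => g /= [].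
have [p1c p2c] := flow_Cinf SW phi10 phi20 phiS.
pose J := jac phi1 phi2; pose S := area_coord phi1 phi2.
pose te := exit_at phi2.
pose h := exit_map phi1 phi2; pose Kp := exit_shift phi1 phi2; pose K := exit_area phi1 phi2.
pose hp l c := J l c (te l).
have J0 l c t : 0 < J l c t by exact: (jac_gt0 SW phi10 phi20 phiS).
have Sd l c t : drv (S l c) t (J l c t) by exact: (area_coord_drv SW phi10 phi20 phiS).
have Sc : Cinf S by exact: (area_coord_Cinf SW phi10 phi20 phiS).
have hc : Cinf (fun l x (_ : R) => h l x) by exact: (exit_map_Cinf SW thc tho pol phi10 phi20 phiS).
have hd l c : drv (h l) c (hp l c) by exact: (exit_map_drv SW thc tho pol phi10 phi20 phiS).
have hpc : Cinf (fun l x (_ : R) => hp l x).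
  move=> k; apply: (cls_ext _ (clsdx (hc k.+1))) => l x y.
  exact: dx_eq (hd l x).
have Kpc : Cinf (fun l x (_ : R) => Kp l x).
  exact: (exit_shift_Cinf SW thc tho pol phi10 phi20 phiS).
have Kc : Cinf (fun l x (_ : R) => K l x) by exact: (exit_area_Cinf SW thc tho pol phi10 phi20 phiS).
have Kd l c : drv (K l) c (Kp l c) by exact: (exit_area_drv SW thc tho pol phi10 phi20 phiS).
have hp0 l c : 0 < hp l c by exact: J0.
have h_side l c : 1 <= `|c| -> h l c = c by exact: (exit_map_side SW phi10 phi20 phiS).
have hp_side l c : 1 <= `|c| -> hp l c = 1 by exact: (jac_side SW phi10 phi20 phiS).
have K_side l c : 1 <= `|c| -> K l c = 0 by exact: (exit_area_side SW thc tho pol phi10 phi20 phiS).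
have Kp_side l c : 1 <= `|c| -> Kp l c = 0 by exact: (exit_shift_side SW phi10 phi20 phiS).
have [P1 [P2 [top [[P1c P2c] [topc top1] PJ [Pinj Psurj] [Pid Ptop Ptriv]]]]] :=
  correction hc hpc Kc Kpc hd Kd hp0 h_side hp_side K_side Kp_side.
have Sdy l c t : 0 < dy S l c t by rewrite (dy_eq (Sd l c t)).
have Ssurj l c v : exists t, S l c t = v by exact: (area_coord_surj SW thc tho pol phi10 phi20 phiS).
(* [sg] turns the swept area back into time; in the coordinates [(c, v)] the chart has Jacobian
   [J / dy S = 1]. *)
have [sg [sgc Ssg sgS]] := cls_inverse1 Sc Sdy Ssurj.
have Smono l c t t' : S l c t <= S l c t' -> t <= t'.
  move=> SS; rewrite leNgt; apply/negP => tt; move: SS.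
  by rewrite leNgt (increasing_of_dy Sc Sdy l c tt).
pose A1 l c v := phi1 l c (sg l c v); pose A2 l c v := phi2 l c (sg l c v).
have A1c : Cinf A1 by move=> k; exact: (cls_subst (p1c k) (clsX R T k) (sgc k)).
have A2c : Cinf A2 by move=> k; exact: (cls_subst (p2c k) (clsX R T k) (sgc k)).
have AJ l c v : jacdet A1 A2 l c v = 1.
  have Xc := clsX R T 1.
  have := @jacdet_comp R T A1 A2 (fun _ x _ => x) S l c (sg l c v) (A1c 1%N) (A2c 1%N) Xc (Sc 1%N).
  rewrite Ssg.
  have -> : (fun l x y => A1 l x (S l x y)) = phi1.
    by apply/funext => l'; apply/funext => x'; apply/funext => y'; rewrite /A1 sgS.
  have -> : (fun l x y => A2 l x (S l x y)) = phi2.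
    by apply/funext => l'; apply/funext => x'; apply/funext => y'; rewrite /A2 sgS.
  have -> : jacdet phi1 phi2 l c (sg l c v) = J l c (sg l c v) by [].
  have -> : jacdet (fun _ x _ => x) S l c (sg l c v) = J l c (sg l c v).
    by rewrite /jacdet dx_X dy_X mul1r mul0r subr0 (dy_eq (Sd _ _ _)).
  by move=> e; apply: (mulIf (lt0r_neq0 (J0 l c (sg l c v)))); rewrite -e mul1r.
pose G1 l c v := P1 l (A1 l c v) (A2 l c v); pose G2 l c v := P2 l (A1 l c v) (A2 l c v).
have G1c : Cinf G1 by move=> k; exact: (cls_subst (P1c k) (A1c k) (A2c k)).
have G2c : Cinf G2 by move=> k; exact: (cls_subst (P2c k) (A1c k) (A2c k)).
(* [hp * top - Kp] is the area coordinate at which the orbit of [c] reaches the height [top], where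
   the correction takes its final form. *)
have [M Mc MP] : exists2 M : T -> R, continuous M &
    forall l x, -1 <= x <= 1 -> `|hp l x * top l - Kp l x| <= M l.
  apply: (@majorant_of_slice R T (fun l x => hp l x * top l - Kp l x)) => k.
  by apply: (clsB _ (Kpc k)); apply: (clsM (hpc k)); exact: cls_param.
exists G1, G2, M; split.
- by [].
- exact: Mc.
- move=> l x y; rewrite (jacdet_comp l x y (P1c 1%N) (P2c 1%N) (A1c 1%N) (A2c 1%N)).
  by rewrite PJ AJ mulr1.
- split.
    move=> l c v c' v' e1 e2; have [a1 a2] := Pinj _ _ _ _ _ e1 e2.
    have [cc tt] := phi_injective SW phi10 phi20 phiS a1 a2.
    by split=> //; rewrite -(Ssg l c v) tt cc Ssg.
  move=> l x y; have [x' [y' [e1 e2]]] := Psurj l x y.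
  have [c [t [f1 f2]]] := phi_surjective SW thc tho pol phi10 phi20 phiS l x' y'.
  by exists c, (S l c t); rewrite /G1 /G2 /A1 /A2 sgS f1 f2.
have G_of_A l c v : A1 l c v = c -> A2 l c v = v -> 1 <= `|c| \/ v <= 1 ->
    G1 l c v = c /\ G2 l c v = v.
  by move=> e1 e2 cv; rewrite /G1 /G2 e1 e2; exact: Pid.
(* The other two conditions follow: [hp] is the derivative of the identity, and [K] is constant with
   value 0 at 1. *)
have trivP l : (forall c, phi1 l c (te l) = c) ->
    (forall c, Kp l c = 0) -> forall x y, P1 l x y = x /\ P2 l x y = y.
  move=> e1 e3; apply: Ptriv => //.
    by move=> c; apply: drv_uniq (hd l c) _; rewrite (_ : h l = id); [exact: drvI|apply/funext].
  move=> c; rewrite -(K_side l 1) ?normr1//; apply: (@drv0_cst _ (K l)) => z.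
  by rewrite -(e3 z); exact: Kd.
split.
- move=> l c v; case=> [c1|v1|vM].
  + have sv : sg l c v = v.
      by rewrite -{1}(area_coord_side SW phi10 phi20 phiS l v c1) sgS.
    have [a1 a2] := phi_side SW phi10 phi20 phiS l v c1.
    by apply: G_of_A; [rewrite /A1 sv|rewrite /A2 sv|left].
  + have sv : sg l c v = v.
      by rewrite -{1}(area_coord_below SW phi10 phi20 phiS l c v1) sgS.
    have [a1 a2] := phi_below SW phi10 phi20 phiS l c v1.
    by apply: G_of_A; [rewrite /A1 sv|rewrite /A2 sv|right; lra].
  + have [c1|c1] := leP 1 `|c|.
      have sv : sg l c v = v.
        by rewrite -{1}(area_coord_side SW phi10 phi20 phiS l v c1) sgS.
      have [a1 a2] := phi_side SW phi10 phi20 phiS l v c1.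
      by apply: G_of_A; [rewrite /A1 sv|rewrite /A2 sv|left].
    have cin : -1 <= c <= 1 by rewrite -ler_norml ltW.
    have t1 := top1 l.
    (* Late enough for the orbit to be above [top l], and at least -1, so that the height [top l] is
       attained in between. *)
    pose T0 := te l + (`|te l| + top l).
    have n1 := ler_norm (- te l); rewrite normrN in n1.
    have n2 := normr_ge0 (te l).
    have teT : te l <= T0 by rewrite /T0; lra.
    have ex : 1 <= phi2 l c (te l) by exact: (exit_atP SW thc tho pol phi10 phi20 phiS).
    have [_ eT] := phi_above SW phiS ex teT.
    have D2 : continuous (phi2 l c) by have [_ D] := phiS l c; exact: drv_continuous D.
    have mT : -1 <= T0 by rewrite /T0; lra.
    have mm : Num.min (phi2 l c (-1)) (phi2 l c T0) <= top l <= Num.max (phi2 l c (-1)) (phi2 l c T0).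
      have u1 : phi2 l c (-1) <= top l by rewrite phi20; lra.
      have u2 : top l <= phi2 l c T0 by rewrite eT /T0; lra.
      by rewrite ge_min le_max u1 u2 orbT.
    have [t _ tt] := ivt mT D2 mm.
    have pt1 : 1 < phi2 l c t by rewrite tt.
    have rel u := @exit_relation R T _ _ _ SW thc tho pol _ _ phi10 phi20 phiS l c u.
    have [_ r2] := rel t pt1.
    have MP' := MP l c cin.
    have St : S l c t <= S l c (sg l c v).
      rewrite Ssg; apply: le_trans vM; apply: le_trans MP'; apply: le_trans (ler_norm _).
      by rewrite -tt; rewrite le_eqVlt; apply/orP; left; apply/eqP; exact: r2.
    have tsg := Smono _ _ _ _ St.
    have [_ f2] := phi_above SW phiS (ltW pt1) tsg.
    have A2top : top l <= A2 l c v by rewrite /A2 f2 tt; lra.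
    have [q1 q2] := rel (sg l c v) (lt_le_trans t1 A2top).
    have [z1 z2] := Ptop l c (A2 l c v) A2top.
    have A1h : A1 l c v = h l c by exact: q1.
    rewrite /G1 /G2 A1h z1 z2; split=> //.
    by rewrite -[RHS](Ssg l c v); apply/esym; exact: q2.
(* The orbits are vertical, with a speed that need not be 1; the swept area restores the height,
   [S = phi2], and the chart becomes the identity. *)
- move=> l Wz.
  have [_ _ Wo _] := SW.
  have f1 c t : phi1 l c t = c.
    rewrite -[RHS](phi10 l c); apply: (@drv0_cst _ (phi1 l c)) => z.
    by have [D _] := phiS l c; rewrite -(Wz (phi1 l c z) (phi2 l c z)).
  have d1 c t : dx phi1 l c t = 1.
    by rewrite (@dx_congr R T T phi1 (fun _ x _ => x) l l c t t) ?dx_X.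
  have d2 c t : dy phi1 l c t = 0.
    by have [D _] := phiS l c; rewrite (dy_eq (D t)) Wz.
  have Jd c t : J l c t = dy phi2 l c t by rewrite /J /jac d1 d2 mul1r mul0r subr0.
  have Sphi c t : S l c t = phi2 l c t.
    have D z : drv (fun z => S l c z - phi2 l c z) z 0.
      apply: drv_eq (drvB (Sd l c z) (cls_dy l c z (p2c 1%N))) _.
      by rewrite Jd subrr.
    have m1 : (-1 : R) <= -1 by [].
    have := drv0_cst D t (-1).
    have S1 : S l c (-1) = -1 by exact: (area_coord_below SW phi10 phi20 phiS l c m1).
    by rewrite phi20 S1; lra.
  have Kz c : Kp l c = 0.
    have ex : 1 <= phi2 l c (te l) by exact: (exit_atP SW thc tho pol phi10 phi20 phiS).
    have oo : outside (phi1 l c (te l)) (phi2 l c (te l)).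
      by right; exact: le_trans (ler_norm _).
    rewrite (_ : Kp l c = J l c (te l) * phi2 l c (te l) - S l c (te l)) //.
    by rewrite /J (jac_dx SW phiS oo) d1 Sphi mul1r subrr.
  have Pt := trivP l (fun c => f1 c (te l)) Kz.
  move=> c v; rewrite /G1 /G2; have [-> ->] := Pt (A1 l c v) (A2 l c v).
  by rewrite /A1 /A2 f1 -Sphi Ssg.
(* Along an orbit [F1] is constant and [F2] grows at unit rate, so F inverts the flow chart, whose
   Jacobian is then 1 and whose area coordinate is the time. As F is the identity above the box, the
   exit map and the shift are trivial. *)
- move=> l F1 F2 F1c F2c FJ W1F W2F Fout.
  have m1 : (-1 : R) <= -1 by [].
  have om1 c : outside c (-1 : R) by right; rewrite normrN1.
  have F1phi c t : F1 l (phi1 l c t) (phi2 l c t) = c.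
    have [D1 D2] := phiS l c.
    have D z : drv (fun t => F1 l (phi1 l c t) (phi2 l c t)) z 0.
      apply: drv_eq (cls_drv l (F1c 1%N) (D1 z) (D2 z)) _.
      by rewrite W1F W2F; ring.
    have := drv0_cst D t (-1); rewrite phi10 phi20.
    by have [-> _] := Fout c (-1) (om1 c).
  have F2phi c t : F2 l (phi1 l c t) (phi2 l c t) = t.
    have [D1 D2] := phiS l c.
    have D z : drv (fun t => F2 l (phi1 l c t) (phi2 l c t) - t) z 0.
      apply: drv_eq (drvB (cls_drv l (F2c 1%N) (D1 z) (D2 z)) (drvI z)) _.
      have := FJ (phi1 l c z) (phi2 l c z); rewrite /jacdet W1F W2F => e.
      by rewrite -[X in _ - X]e; ring.
    have := drv0_cst D t (-1); rewrite phi10 phi20.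
    by have [_ ->] := Fout c (-1) (om1 c); lra.
  have J1 c t : J l c t = 1.
    have := @jacdet_comp R T F1 F2 phi1 phi2 l c t (F1c 1%N) (F2c 1%N) (p1c 1%N) (p2c 1%N).
    rewrite FJ mul1r => e; rewrite (_ : J l c t = jacdet phi1 phi2 l c t) // -e /jacdet.
    have -> : dx (fun l x y => F1 l (phi1 l x y) (phi2 l x y)) l c t = 1.
      by rewrite (@dx_congr R T T _ (fun _ x _ => x) l l c t t) ?dx_X.
    have -> : dx (fun l x y => F2 l (phi1 l x y) (phi2 l x y)) l c t = 0.
      by rewrite (@dx_congr R T T _ (fun _ _ y => y) l l c t t) ?dx_Y.
    have -> : dy (fun l x y => F2 l (phi1 l x y) (phi2 l x y)) l c t = 1.
      apply: dy_eq; rewrite (_ : (fun s => _) = id); first exact: drvI.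
      by apply/funext => s; exact: F2phi.
    by rewrite mulr0 subr0 mul1r.
  have St c t : S l c t = t.
    have D z : drv (fun z => S l c z - z) z 0.
      by apply: drv_eq (drvB (Sd l c z) (drvI z)) _; rewrite J1 subrr.
    have := drv0_cst D t (-1).
    have S1 : S l c (-1) = -1 by exact: (area_coord_below SW phi10 phi20 phiS l c m1).
    by rewrite S1; lra.
  have ex c : phi1 l c (te l) = c /\ phi2 l c (te l) = te l.
    have e1 : 1 <= phi2 l c (te l) by exact: (exit_atP SW thc tho pol phi10 phi20 phiS).
    have oo : outside (phi1 l c (te l)) (phi2 l c (te l)).
      by right; exact: le_trans (ler_norm _).
    have [f1 f2] := Fout _ _ oo.
    by split; [rewrite -[LHS]f1 F1phi|rewrite -[LHS]f2 F2phi].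
  have Kz c : Kp l c = 0.
    rewrite (_ : Kp l c = J l c (te l) * phi2 l c (te l) - S l c (te l)) //.
    by rewrite J1 St (ex c).2 mul1r subrr.
  have Pt := trivP l (fun c => (ex c).1) Kz.
  move=> c v; rewrite /G1 /G2; have [-> ->] := Pt (A1 l c v) (A2 l c v).
  have sv : sg l c v = v by rewrite -{1}(St c v) sgS.
  by rewrite /A1 /A2 sv F1phi F2phi.
Qed.

End Straightening.

Lemma sin_gt0_pihalf (R : realType) (x : R) : 0 < x < pi / 2 -> 0 < sin x.
Proof. by have := pi_gt0 R => pi0 /andP[x0 xp]; apply: sin_gt0_pi; lra. Qed.

(** * Contraction of the field and of the diffeomorphism *)

Section Isotopy.
Variables (R : realType) (X : topologicalType).
Implicit Types (f : X) (x y c t s v : R).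
Variables F1 F2 : X -> R -> R -> R.
Hypothesis F1c : Cinf F1.
Hypothesis F2c : Cinf F2.
Hypothesis FJ : forall f x y, jacdet F1 F2 f x y = 1.
Hypothesis Fout : forall f x y, 1 <= x ^+ 2 + y ^+ 2 -> F1 f x y = x /\ F2 f x y = y.

Lemma outside_sq x y : outside x y -> 1 <= x ^+ 2 + y ^+ 2.
Proof.
have sq (a : R) : 1 <= `|a| -> 1 <= a ^+ 2.
  by move=> a1; rewrite -real_normK ?num_real// expr_ge1.
by case=> /sq h; [have := sqr_ge0 y|have := sqr_ge0 x]; lra.
Qed.

Let V1 f x y : R := - dy F1 f x y.
Let V2 f x y : R := dx F1 f x y.

Let V1c : Cinf V1.
Proof. by move=> k; apply: clsN; exact: clsdy (F1c _). Qed.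

Let V2c : Cinf V2.
Proof. by move=> k; exact: clsdx (F1c _). Qed.

Let V_far f x y : 1 < x ^+ 2 + y ^+ 2 -> V1 f x y = 0 /\ V2 f x y = 1.
Proof.
move=> xy.
have sqc (a b : R) : 1 < a ^+ 2 + b -> \forall z \near a, 1 < z ^+ 2 + b.
  move=> ab; have cc : {for a, continuous (fun z : R => z ^+ 2 + b)}.
    apply: (@atD _ _ (fun z : R => z ^+ 2) (fun=> b)); last exact: cvg_cst.
    by apply: (@atM _ _ (fun z : R => z) (fun z : R => z)); exact: cvg_id.
  exact: (cvgr_gt _ cc).
split.
  rewrite /V1 (_ : dy F1 f x y = 0) ?oppr0//; apply: dy_eq.
  apply: (@near_drv _ (fun=> x)); last exact: drvC.
  have : 1 < y ^+ 2 + x ^+ 2 by rewrite addrC.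
  move=> /sqc; apply: filterS => z zx; have h : 1 <= x ^+ 2 + z ^+ 2 by rewrite addrC ltW.
  by have [] := Fout f h.
apply: dx_eq; apply: (@near_drv _ id); last exact: drvI.
by move: xy => /sqc; apply: filterS => z zx; have [-> _] := Fout f (ltW zx).
Qed.

(** Derivatives are under control strictly outside the unit circle; multiples of the point by
    [|s| > 1] lie there, and continuity at [s = 1] brings the result back. *)
Let V_out f x y : outside x y -> V1 f x y = 0 /\ V2 f x y = 1.
Proof.
move=> /outside_sq xy.
have far s : 1 < `|s| -> 1 < (s * x) ^+ 2 + (s * y) ^+ 2.
  move=> s1; rewrite !exprMn -mulrDr.
  have s2 : 1 < s ^+ 2 by rewrite -real_normK ?num_real// expr_gt1.
  by apply: (lt_le_trans s2); rewrite ler_peMr// ltW// (lt_trans _ s2).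
have cl (a : X -> R -> R -> R) : Cinf a -> continuous (fun s => a f (s * x) (s * y)).
  move=> ac s; apply: (@unc_comp R X _ (fun=> f) (fun s => s * x) (fun s => s * y) a s).
  - exact: cvg_cst.
  - by apply: (@atM _ _ id (fun=> x)); [exact: cvg_id|exact: cvg_cst].
  - by apply: (@atM _ _ id (fun=> y)); [exact: cvg_id|exact: cvg_cst].
  - exact: cls_cont (ac 0%N) _.
have n1 : 1 <= `|1 : R| by rewrite normr1.
have e1 := @closure_gt1 R _ 0 (cl V1 V1c) (fun s h => (V_far f (far s h)).1) 1 n1.
have e2 := @closure_gt1 R _ 1 (cl V2 V2c) (fun s h => (V_far f (far s h)).2) 1 n1.
by move: e1 e2; rewrite !mul1r.
Qed.

Let V0 f x y : 0 < V1 f x y ^+ 2 + V2 f x y ^+ 2.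
Proof.
rewrite lt_neqAle addr_ge0 ?sqr_ge0// andbT eq_sym paddr_eq0 ?sqr_ge0// !sqrf_eq0.
apply/negP => /andP[/eqP v1 /eqP v2]; have := FJ f x y; rewrite /jacdet.
move: v1 v2; rewrite /V1 /V2 => /eqP; rewrite oppr_eq0 => /eqP -> ->.
by rewrite !mul0r subrr => /eqP; rewrite eq_sym oner_eq0.
Qed.

Let om f x y : R := (V1 f x y * dx V2 f x y - dx V1 f x y * V2 f x y) *
  (V1 f x y * V1 f x y + V2 f x y * V2 f x y)^-1.

Let omc : Cinf om.
Proof.
have d1 k : cls k (dx V1) by exact: clsdx (V1c _).
have d2 k : cls k (dx V2) by exact: clsdx (V2c _).
move=> k; apply: clsM; first by apply: clsB; apply: clsM.
apply: clsV; last by apply: clsD; apply: clsM.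
by move=> f x y; rewrite -!expr2 gt_eqF.
Qed.

(* The angle of V; om is the x-component of its differential. *)
Let b f x y : R := prim (fun s => om f s y) (-1) x.

Let bc : Cinf b.
Proof. by move=> k; exact: cls_prim1 (omc k). Qed.

Let om_slice f y : continuous (fun s => om f s y).
Proof.
move=> s; apply: (@unc_comp R X _ (fun=> f) id (fun=> y) om s).
- exact: cvg_cst.
- exact: cvg_id.
- exact: cvg_cst.
- exact: cls_cont (omc 0%N) _.
Qed.

Let b_drv f x y : drv (fun s => b f s y) x (om f x y).
Proof. exact: (drv_prim (-1) x (@om_slice f y)). Qed.

Let om_out f x y : outside x y -> om f x y = 0.
Proof.
move=> xyo.
have w (a : X -> R -> R -> R) v : Cinf a -> (forall x y, outside x y -> a f x y = v) ->
    outside x y -> dx a f x y = 0.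
  move=> ac av [x1|y1]; last first.
    by apply: dx_eq; rewrite (_ : (fun s => _) = fun=> v); [exact: drvC|apply/funext => s; apply: av; right].
  apply: (@closure_gt1 R (fun x => dx a f x y)) x1 => [z|z z1].
    apply: (@unc_comp R X _ (fun=> f) id (fun=> y) (dx a) z).
    - exact: cvg_cst.
    - exact: cvg_id.
    - exact: cvg_cst.
    - exact: cls_cont (clsdx (ac 1%N)) _.
  apply: dx_eq; apply: (@near_drv _ (fun=> v)); last exact: drvC.
  by apply: filterS (near_norm_gt1 z1) => s s1; rewrite av//; left.
rewrite /om (w V1 0 V1c (fun x y h => (V_out f h).1) xyo) (w V2 1 V2c (fun x y h => (V_out f h).2) xyo).
by rewrite mulr0 mul0r subrr mul0r.
Qed.

Let b_left f x y : x <= -1 -> b f x y = 0.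
Proof.
move=> x1; rewrite -(prim0 (fun s => om f s y) (-1)).
apply: (drv0_cst_in x1) => z /andP[_ z1].
by apply: drv_eq (b_drv f z y) _; apply: om_out; left; rewrite ler_normr; apply/orP; right; lra.
Qed.

Let b_y f x y : 1 <= `|y| -> b f x y = 0.
Proof.
move=> y1; rewrite -(prim0 (fun s => om f s y) (-1)).
apply: (@drv0_cst _ (fun s => b f s y)) => z.
by apply: drv_eq (b_drv f z y) _; apply: om_out; right.
Qed.

Let V_polar f x y : polar (V1 f x y) (V2 f x y) (b f x y).
Proof.
apply: (@polar_transport R (fun s => V1 f s y) (fun s => V2 f s y)
  (fun s => dx V1 f s y) (fun s => dx V2 f s y) (fun s => b f s y) (-1)).
- by move=> s; exact: cls_dx (V1c 1%N).
- by move=> s; exact: cls_dx (V2c 1%N).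
- by move=> s; rewrite gt_eqF.
- by move=> s; apply: drv_eq (b_drv f s y) _; rewrite /om !expr2.
- have o1 : outside (-1) y by left; rewrite normrN1.
  have [-> ->] := V_out f o1; rewrite b_left//.
  by split; rewrite ?cos0 ?sin0 ?mul0r ?mulr0 ?addr0// subr0 mul1r.
Qed.

(** On the line [x = 1] the field is vertical, so [b] is a multiple of 2 pi there, and a priori V
    could have turned while crossing the box. As [b f 1 1 = 0], a nonzero value would force [b]
    through [pi / 2] or [- pi / 2], where the cosine vanishes; values of smaller modulus have a
    nonzero sine. *)
Let b_right1 f y : b f 1 y = 0.
Proof.
apply/eqP; apply: contrapT => /negP b0.
have pz z : sin (b f 1 z) = 0 /\ 0 < cos (b f 1 z).
  have o1 : outside 1 z by left; rewrite normr1.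
  have := V_polar f 1 z; have [-> ->] := V_out f o1.
  by rewrite /polar !mul0r !mul1r add0r subr0.
have bcont : continuous (b f 1) by apply: unc_sect; exact: cls_cont (bc 0%N).
have n1 : 1 <= `|1 : R| by rewrite normr1.
have b1 : b f 1 1 = 0 by exact: b_y.
have pih : 0 <= pi / 2 :> R by rewrite divr_ge0 ?pi_ge0.
have hit v : Num.min 0 (b f 1 y) <= v <= Num.max 0 (b f 1 y) -> exists z, b f 1 z = v.
  have [y1|/ltW y1] := leP y 1.
    rewrite minC maxC -b1 => hv.
    by have [z _ <-] := ivt y1 bcont hv; exists z.
  rewrite -b1 => hv.
  by have [z _ <-] := ivt y1 bcont hv; exists z.
have [neg|pos|z] := ltgtP (b f 1 y) 0; last by rewrite z eqxx in b0.
  have [small|big] := leP (b f 1 y) (- (pi / 2)).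
    have [z ez] : exists z, b f 1 z = - (pi / 2).
      by apply: hit; rewrite ge_min le_max small oppr_le0 pih orbT.
    by have [_] := pz z; rewrite ez cosN cos_pihalf ltxx.
  have [s0 _] := pz y.
  have : 0 < sin (- b f 1 y) by apply: sin_gt0_pihalf; rewrite oppr_gt0 neg ltrNl.
  by rewrite sinN s0 oppr0 ltxx.
have [big|small] := leP (pi / 2) (b f 1 y).
  have [z ez] : exists z, b f 1 z = pi / 2.
    by apply: hit; rewrite ge_min le_max big pih orbT.
  by have [_] := pz z; rewrite ez cos_pihalf ltxx.
have [s0 _] := pz y.
have : 0 < sin (b f 1 y) by apply: sin_gt0_pihalf; rewrite pos.
by rewrite s0 ltxx.
Qed.

Let b_out f x y : outside x y -> b f x y = 0.
Proof.
case=> [x1|]; last exact: b_y.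
have [x0|x0] := leP x 0.
  by apply: b_left; move: x1; rewrite ler0_norm//; lra.
have x1' : 1 <= x by move: x1; rewrite gtr0_norm.
rewrite -(b_right1 f y); apply/esym; apply: (@drv0_cst_in _ (fun s => b f s y) _ _ x1') => z /andP[z1 _].
by apply: drv_eq (b_drv f z y) _; apply: om_out; left; rewrite ler_normr z1.
Qed.

(** The time of the isotopy is one more continuous parameter, ranging over all of [R]. *)
Let T : topologicalType := (R * X)%type.
Implicit Types q : T.

Let lift k (a : X -> R -> R -> R) : cls k a -> cls k (fun q x y => a q.2 x y).
Proof.
move=> ac; apply: (@cls_comp R X T k (fun q => q.2) a (fun _ x _ => x) (fun _ _ y => y)) => //.
- by move=> q; exact: cvg_snd.
- exact: clsX.
- exact: clsY.
Qed.

(** Rotating V back by [s * b] leaves a field at angle [(1 - s) * b] from the vertical; this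
    globally defined angle is the [th] that [escape] asks for. *)
Let tau q x y : R := q.1 * b q.2 x y.
Let W1 q x y : R := V1 q.2 x y * cos (tau q x y) + V2 q.2 x y * sin (tau q x y).
Let W2 q x y : R := V2 q.2 x y * cos (tau q x y) - V1 q.2 x y * sin (tau q x y).
Let th q x y : R := b q.2 x y - tau q x y.

Let tauc : Cinf tau.
Proof.
move=> k; apply: clsM; last exact: lift (bc k).
by apply: (@cls_param R T k (fun q => q.1)) => q; exact: cvg_fst.
Qed.

Let SW : standard_field W1 W2.
Proof.
have c1 k : cls k (fun q x y => V1 q.2 x y) := lift (V1c k).
have c2 k : cls k (fun q x y => V2 q.2 x y) := lift (V2c k).
split.
- by move=> k; apply: clsD; apply: clsM => //; [apply: cls_cos|apply: cls_sin].
- by move=> k; apply: clsB; apply: clsM => //; [apply: cls_cos|apply: cls_sin].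
- move=> q x y xyo; rewrite /W1 /W2 /tau b_out// mulr0 cos0 sin0 !mulr1 !mulr0 addr0 subr0.
  exact: V_out.
- move=> q x y; rewrite (_ : _ + _ = (V1 q.2 x y ^+ 2 + V2 q.2 x y ^+ 2) *
    (cos (tau q x y) ^+ 2 + sin (tau q x y) ^+ 2)); last by rewrite /W1 /W2; ring.
  by rewrite cos2Dsin2 mulr1.
Qed.

Let thc : Cinf th.
Proof. by move=> k; apply: clsB; [exact: lift (bc k)|exact: tauc]. Qed.

Let tho q x y : outside x y -> th q x y = 0.
Proof. by move=> xyo; rewrite /th /tau b_out// mulr0 subrr. Qed.

Let pol q x y : polar (W1 q x y) (W2 q x y) (th q x y).
Proof.
have [p1 p2] := V_polar q.2 x y.
rewrite /polar /W1 /W2 /th cosB sinB.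
set B := b q.2 x y in p1 p2 *; set t := tau q x y.
have cs := cos2Dsin2 t.
split.
  rewrite (_ : _ + _ = (V1 q.2 x y * cos B + V2 q.2 x y * sin B) * (cos t ^+ 2 + sin t ^+ 2)).
    by rewrite p1 mul0r.
  by ring.
rewrite (_ : _ - _ = (V2 q.2 x y * cos B - V1 q.2 x y * sin B) * (cos t ^+ 2 + sin t ^+ 2)).
  by rewrite cs mulr1.
by ring.
Qed.

(** At time 0 the field is V, which F sends to the vertical unit field; at time 1 it is vertical by
    the choice of the angle. If [F1] is the first coordinate, then V is already vertical and [b] is
    0, so the field does not move. *)
Theorem isotopy : exists (G1 G2 : T -> R -> R -> R) (M : T -> R),
  [/\ Cinf G1 /\ Cinf G2, continuous M,
      forall q x y, jacdet G1 G2 q x y = 1,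
      (forall q x y x' y', G1 q x y = G1 q x' y' -> G2 q x y = G2 q x' y' -> x = x' /\ y = y')
      /\ (forall q x y, exists x' y', G1 q x' y' = x /\ G2 q x' y' = y) &
   [/\ forall q c v, [\/ 1 <= `|c|, v <= -1 | M q <= v] -> G1 q c v = c /\ G2 q c v = v,
      forall f c v, F1 f (G1 (0, f) c v) (G2 (0, f) c v) = c /\ F2 f (G1 (0, f) c v) (G2 (0, f) c v) = v,
      forall f c v, G1 (1, f) c v = c /\ G2 (1, f) c v = v &
      forall s f, (forall x y, F1 f x y = x) -> forall c v, G1 (s, f) c v = c /\ G2 (s, f) c v = v]].
Proof.
have [G1 [G2 [M [Gc Mc GJ Gb [Gs Gtriv Ginv]]]]] := area_straightening SW thc tho pol.
exists G1, G2, M; split=> //; split=> //.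
- move=> f c v.
  have H := Ginv (0, f) (fun q => F1 q.2) (fun q => F2 q.2) (fun k => lift (F1c k)) (fun k => lift (F2c k)).
  apply: H => [x y|x y|x y|x y /outside_sq h] /=.
  + exact: FJ.
  + by rewrite /W1 /tau /= mul0r cos0 sin0 mulr1 mulr0 addr0.
  + by rewrite /W2 /tau /= mul0r cos0 sin0 mulr1 mulr0 subr0.
  + exact: Fout.
- move=> f; apply: Gtriv => x y; rewrite /W1 /tau /= mul1r.
  by have [] := V_polar f x y.
- move=> s f Fx; apply: Gtriv => x y.
  have v1 x' y' : V1 f x' y' = 0.
    rewrite /V1 (_ : dy F1 f x' y' = 0) ?oppr0//; apply: dy_eq.
    by rewrite (_ : F1 f x' = fun=> x'); [exact: drvC|apply/funext].
  have v2 x' y' : V2 f x' y' = 1.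
    by rewrite /V2 (@dx_congr R X X _ (fun _ x _ => x) f f x' y' y') ?dx_X.
  have o0 x' y' : om f x' y' = 0.
    rewrite /om !v1 (_ : dx V1 f x' y' = 0) ?mul0r ?subrr ?mul0r//.
    by apply: dx_eq; rewrite (_ : (fun s => V1 f s y') = fun=> 0); [exact: drvC|apply/funext].
  have b0 : b f x y = 0.
    rewrite -(prim0 (fun s => om f s y) (-1)); apply: (@drv0_cst _ (fun s => b f s y)) => z.
    by rewrite -(o0 z y).
  by rewrite /W1 /tau /= b0 v1 mulr0 sin0 mul0r mulr0 addr0.
Qed.

End Isotopy.

(** * The C^oo topology *)

Section Plane.
Variable R : realType.
Implicit Types (x y : R) (G : plane R -> plane R) (p : plane R).

Lemma derive_cvg G p v : differentiable G p ->
  h^-1 *: (G (h *: v + p) - G p) @[h --> 0^'] --> 'D_v G p.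
Proof.
by move=> Gp; have H : derivable G p v by exact: diff_derivable.
Qed.

Lemma derive_proj (c : plane R -> R) G p v : continuous c -> differentiable G p ->
  c (h^-1 *: (G (h *: v + p) - G p)) @[h --> 0^'] --> c ('D_v G p).
Proof. by move=> cc /derive_cvg H; exact: continuous_cvg (cc _) (H v). Qed.

Lemma drv_of_cvg (f : R -> R) x l :
  h^-1 * (f (h + x) - f x) @[h --> 0^'] --> l -> drv f x l.
Proof.
move=> fl; have fl' : h^-1 *: (f (h *: (1 : R^o) + x) - f x) @[h --> 0^'] --> l.
  apply: cvg_trans fl; apply: near_eq_cvg; near=> h.
  by rewrite /GRing.scale /= mulr1.
have fcv : derivable (f : R^o -> R^o) x 1 by apply/cvg_ex; exists l.
by rewrite /drv; apply: DeriveDef => //; exact/cvg_lim.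
Unshelve. all: by end_near. Qed.

Lemma drv_partial G x y : differentiable G (x, y) ->
  [/\ drv (fun t => (G (t, y)).1) x ('D_(coord_vec R ord0) G (x, y)).1,
      drv (fun t => (G (t, y)).2) x ('D_(coord_vec R ord0) G (x, y)).2,
      drv (fun t => (G (x, t)).1) y ('D_(coord_vec R ord_max) G (x, y)).1 &
      drv (fun t => (G (x, t)).2) y ('D_(coord_vec R ord_max) G (x, y)).2].
Proof.
move=> Gd.
have c1 : continuous (fst : plane R -> R) by move=> p; exact: cvg_fst.
have c2 : continuous (snd : plane R -> R) by move=> p; exact: cvg_snd.
have key (c : plane R -> R) v (f : R -> R) t : continuous c ->
    (forall h, h^-1 * (f (h + t) - f t) = c (h^-1 *: (G (h *: v + (x, y)) - G (x, y)))) ->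
    drv f t (c ('D_v G (x, y))).
  move=> cc fE; apply: drv_of_cvg; rewrite (funext fE).
  exact: derive_proj.
have e0 h : h *: coord_vec R ord0 + (x, y) = (h + x, y).
  by transitivity (h * 1 + x, h * 0 + y); [by []|by rewrite mulr1 mulr0 add0r].
have e1 h : h *: coord_vec R ord_max + (x, y) = (x, h + y).
  by transitivity (h * 0 + x, h * 1 + y); [by []|by rewrite mulr1 mulr0 add0r].
by split; apply: key => // h; rewrite ?e0 ?e1.
Qed.

(** The norm of the plane is the maximum norm, for which [|h| + |k|] is at most twice the norm;
    hence the [e / 2] given to [linear_approximation]. *)
Lemma is_diff_of_partials (g gx gy : R -> R -> R) x y :
  (forall x y : R, drv (fun s => g s y) x (gx x y)) ->
  (forall x y : R, drv (g x) y (gy x y)) ->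
  {for (x, y), continuous (fun p : R * R => gx p.1 p.2)} ->
  {for (x, y), continuous (fun p : R * R => gy p.1 p.2)} ->
  is_diff (x, y) (fun p : plane R => (g p.1 p.2 : R^o)) 
     (fun v : plane R => v.1 * gx x y + v.2 * gy x y).
Proof.
move=> gxd gyd gxc gyc.
pose L (v : plane R) : R^o := v.1 * gx x y + v.2 * gy x y.
have Llin : linear L.
  by move=> c [u1 u2] [v1 v2]; rewrite /L /= /GRing.scale /= /GRing.scale /=; ring.
pose LL : {linear plane R -> R^o} := HB.pack L (GRing.isLinear.Build _ _ _ _ L Llin).
have Lc : continuous LL.
  move=> v; apply: (@atD _ _ (fun v : plane R => v.1 * gx x y) (fun v : plane R => v.2 * gy x y)).
  - by apply: (@atM _ _ fst (fun=> gx x y)); [exact: cvg_fst|exact: cvg_cst].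
  - by apply: (@atM _ _ snd (fun=> gy x y)); [exact: cvg_snd|exact: cvg_cst].
have key : (fun p : plane R => (g p.1 p.2 : R^o)) \o shift (x, y) =
    cst (g x y : R^o) + LL +o_ (0 : plane R) id.
  apply/eqaddoP => e e0.
  have [d d0 Hd] := linear_approximation gxd gyd gxc gyc (divr_gt0 e0 (ltr0n R 2)).
  apply/nbhs_ballP; exists d => //= -[h k] [/= ]; rewrite /ball/= !sub0r !normrN => h1 k1.
  rewrite [leLHS](_ : _ = `|g (x + h) (y + k) - g x y - (h * gx x y + k * gy x y)|).
    apply: le_trans (Hd _ _ h1 k1) _.
    have hn : `|h| <= `|(h, k) : plane R| by rewrite le_max lexx.
    have kn : `|k| <= `|(h, k) : plane R| by rewrite le_max lexx orbT.
    rewrite -mulrA ler_wpM2l ?(ltW e0)//; lra.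
  by congr `|_|; rewrite (addrC x) (addrC y) -addrA -opprD.
have E := diff_unique Lc key.
apply: DiffDef; last by rewrite E.
by apply/diff_locallyP; rewrite E.
Qed.

End Plane.

(** * Iterated partial derivatives of smooth families *)

Section CinfPartial.
Variables (R : realType) (T : topologicalType).
Implicit Types (a : T -> R -> R -> R) (l : T) (s : seq 'I_2).

Definition iter_partial s a := foldr (fun i b => if i == ord0 then dx b else dy b) a s.

Lemma iter_partial_Cinf s a : Cinf a -> Cinf (iter_partial s a).
Proof.
move=> ac; elim: s => // i s IH k /=.
by case: eqP => _; [exact: clsdx (IH _)|exact: clsdy (IH _)].
Qed.

Definition pair_map a1 a2 l (p : plane R) : plane R := (a1 l p.1 p.2, a2 l p.1 p.2).

Lemma pair_map_is_diff a1 a2 l p : Cinf a1 -> Cinf a2 ->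
  is_diff p (pair_map a1 a2 l) (fun v => 
    (v.1 * dx a1 l p.1 p.2 + v.2 * dy a1 l p.1 p.2,
     v.1 * dx a2 l p.1 p.2 + v.2 * dy a2 l p.1 p.2)).
Proof.
move=> c1 c2; case: p => x y.
have H a : Cinf a -> is_diff (x, y) (fun p : plane R => (a l p.1 p.2 : R^o)) 
     (fun v : plane R => v.1 * dx a l x y + v.2 * dy a l x y).
  move=> c; apply: (@is_diff_of_partials R (a l) (dx a l) (dy a l)).
  - by move=> u v; exact: cls_dx (c 1%N).
  - by move=> u v; exact: cls_dy (c 1%N).
  - by apply: cont_pt; exact: cls_cont (clsdx (c 1%N)).
  - by apply: cont_pt; exact: cls_cont (clsdy (c 1%N)).
exact: (@is_diff_pair _ _ _ _ _ _ _ _ _ (H _ c1) (H _ c2)).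
Qed.

Lemma partial_pair_map a1 a2 l s : Cinf a1 -> Cinf a2 ->
  partial s (pair_map a1 a2 l) = pair_map (iter_partial s a1) (iter_partial s a2) l.
Proof.
move=> c1 c2; elim: s => // i s IH.
rewrite /partial /= -/(partial s _) IH; apply/funext => p.
have D := pair_map_is_diff l p (iter_partial_Cinf s c1) (iter_partial_Cinf s c2).
rewrite deriveE; last exact: ex_diff.
rewrite diff_val /pair_map /coord_vec /=; case: (i == ord0) => /=.
  by rewrite !mul0r !mul1r !addr0.
by rewrite !mul0r !mul1r !add0r.
Qed.

Lemma differentiable_partial a1 a2 l s p : Cinf a1 -> Cinf a2 ->
  differentiable (partial s (pair_map a1 a2 l)) p.
Proof.
move=> c1 c2; rewrite partial_pair_map//.
have D := pair_map_is_diff l p (iter_partial_Cinf s c1) (iter_partial_Cinf s c2).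
exact: ex_diff.
Qed.

End CinfPartial.

Section Locality.
Variable R : realType.
Implicit Types (E F : plane R -> plane R) (U : set (plane R)) (s : seq 'I_2).

Lemma partial_local E F U s : open U -> (forall p, U p -> E p = F p) ->
  forall p, U p -> partial s E p = partial s F p.
Proof.
move=> Uo EF; elim: s => [|i s IH] p Up; first exact: EF.
rewrite /partial /= -/(partial s E) -/(partial s F).
apply: near_eq_derive; apply: filterS (open_nbhs_nbhs (conj Uo Up)) => q.
exact: IH.
Qed.

Lemma near_eq_differentiable (f g : plane R -> plane R) p :
  {near p, f =1 g} -> differentiable f p -> differentiable g p.
Proof.
move=> fg /diff_locallyP[dc dE].
have key : g \o shift p = cst (g p) + 'd f p +o_ (0 : plane R) id.
  apply/eqaddoP => e e0; have /eqaddoP /(_ e e0) := dE.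
  have fg0 : \forall h \near (0 : plane R), f (h + p) = g (h + p).
    by have := fg; rewrite (near_shift 0) subr0.
  apply: filterS2 fg0 => h /= fgh.
  by rewrite -[(g \o _ - _) h]/(g (h + p) - (g p + 'd f p h)) -fgh -(nbhs_singleton fg).
have E := diff_unique dc key.
apply/diff_locallyP; rewrite E; split; [exact: dc|exact: key].
Qed.

End Locality.

(** * The space of diffeomorphisms as a parameter space *)

Section ExtId.
Variable R : realType.
Implicit Types (p : plane R).

Lemma ext_out (f : disc R -> disc R) p : ~ disc R p -> ext_id f p = p.
Proof. by rewrite /ext_id; case: pselect. Qed.

Lemma ext_in (f : disc R -> disc R) (p : disc R) : ext_id f (set_val p) = set_val (f p).
Proof.
rewrite /ext_id; case: pselect => [dp|]; last by move=> /(_ (set_valP p)).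
by congr (set_val (f _)); apply: val_inj.
Qed.

Lemma cont_sqnorm : continuous (fun p : plane R => p.1 ^+ 2 + p.2 ^+ 2).
Proof.
move=> p; apply: (@atD _ _ (fun p : plane R => p.1 ^+ 2) (fun p : plane R => p.2 ^+ 2)).
- by apply: (@atM _ _ (fun p : plane R => p.1) (fun p : plane R => p.1)); exact: cvg_fst.
- by apply: (@atM _ _ (fun p : plane R => p.2) (fun p : plane R => p.2)); exact: cvg_snd.
Qed.

Lemma open_inside : open [set p : plane R | p.1 ^+ 2 + p.2 ^+ 2 < 1].
Proof. exact: ((continuousP _).1 cont_sqnorm _ (@open_lt R 1)). Qed.

Lemma open_outside : open [set p : plane R | 1 < p.1 ^+ 2 + p.2 ^+ 2].
Proof. exact: ((continuousP _).1 cont_sqnorm _ (@open_gt R 1)). Qed.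

Lemma ext_near_id (f : disc R -> disc R) : compactly_supported f ->
  exists V, [/\ open V, (forall p, 1 <= p.1 ^+ 2 + p.2 ^+ 2 -> V p)
    & forall p, V p -> ext_id f p = p].
Proof.
move=> [U [Uo Ub Uf]].
exists (U `|` [set p : plane R | 1 < p.1 ^+ 2 + p.2 ^+ 2]); split.
- by apply: openU => //; exact: open_outside.
- by move=> p; rewrite le_eqVlt => /orP[/eqP p1|]; [left; apply: Ub|right].
- move=> p [Up|p1]; last by apply: ext_out; rewrite /disc /= leNgt p1.
  have [dp|] := pselect (disc R p); last exact: ext_out.
  by have := ext_in f (SigSub (mem_set dp)) => /= ->; rewrite Uf.
Qed.

(** Inside the open disc the extension agrees with the smooth extension that [f] provides; on the
    circle and beyond it is locally the identity. Both agreements hold on open sets, so they pass to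
    iterated partials. *)
Lemma ext_differentiable (f : disc R -> disc R) s p : area_diff_set R f ->
  differentiable (partial s (ext_id f)) p.
Proof.
move=> [[g [_ _ [U [F [Uo Usub Fd Ff]]] _]] fc _].
have [p1|p1] := ltP (p.1 ^+ 2 + p.2 ^+ 2) 1.
  have E q : q.1 ^+ 2 + q.2 ^+ 2 < 1 -> F q = ext_id f q.
    move=> q1; have dq : disc R q by exact: ltW.
    by have := ext_in f (SigSub (mem_set dq)) => /= ->; rewrite -Ff.
  apply: (@near_eq_differentiable R (partial s F)); last first.
    by apply: Fd; apply: Usub; exact: ltW.
  apply: filterS (open_nbhs_nbhs (conj open_inside p1)) => q q1.
  by apply: partial_local q1; [exact: open_inside|exact: E].
have [V [Vo Vs Vi]] := ext_near_id fc.
apply: (@near_eq_differentiable R (partial s id)); last exact: differentiable_partial_id.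
apply: filterS (open_nbhs_nbhs (conj Vo (Vs p p1))) => q qV.
by apply: partial_local qV => // r rV; rewrite Vi.
Qed.

Lemma partial_out (f : disc R -> disc R) s p : compactly_supported f ->
  1 <= p.1 ^+ 2 + p.2 ^+ 2 -> partial s (ext_id f) p = partial s id p.
Proof.
move=> fc p1; have [V [Vo Vs Vi]] := ext_near_id fc.
by apply: partial_local (Vs p p1).
Qed.

Definition ext (f : Diffc R) : plane R -> plane R := ext_id (set_val (f : area_diff_set R)).

Lemma Diffc_prop (f : Diffc R) : area_diff_set R (set_val (f : area_diff_set R)).
Proof. exact: set_valP. Qed.

(** Outside the open disc all iterated partials are those of the identity, so uniform closeness on
    the disc extends to the plane. *)
Lemma jets_near (f0 : Diffc R) s (e : R) : 0 < e ->
  \forall f \near f0, forall p, `|partial s (ext f) p - partial s (ext f0) p| < e.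
Proof.
move=> e0.
have jc : continuous (fun f : Diffc R => jets f s : {uniform disc R -> plane R}).
  move=> f; apply: (@continuous_comp _ _ _ (@jets R : Diffc R -> _) (fun h => h s)).
    exact: initial_continuous.
  exact: proj_continuous.
have N : nbhs (jets f0 s : {uniform disc R -> plane R})
   [set h : {uniform disc R -> plane R} | forall p : disc R, `|jets f0 s p - h p| < e].
  apply/uniform_nbhs; exists [set xy : plane R * plane R | ball xy.1 e xy.2]; split.
    exact: (entourage_ball _ (PosNum e0)).
  by move=> h H p; have := H p I; rewrite /= -ball_normE.
have := jc f0 _ N; rewrite nbhs_simpl /=; apply: filterS => f /= H p.
have [p1|p1] := leP 1 (p.1 ^+ 2 + p.2 ^+ 2).
  have [_ c1 _] := Diffc_prop f; have [_ c2 _] := Diffc_prop f0.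
  by rewrite /ext !partial_out// subrr normr0.
have dp : disc R p by exact: ltW.
by have := H (SigSub (mem_set dp)); rewrite distrC.
Qed.

(** Uniform closeness in [f] and continuity of the partial of [f0] add up to joint continuity. [c]
    stands for either coordinate. *)
Lemma ext_cont (c : plane R -> R) s : (forall u v, `|c u - c v| <= `|u - v|) ->
  continuous (unc (fun (f : Diffc R) x y => c (partial s (ext f) (x, y)))).
Proof.
move=> cl [f0 [x0 y0]]; apply/cvgrPdist_lt => e e0.
have e2 : 0 < e / 2 by rewrite divr_gt0.
have H1 := jets_near f0 s e2.
have /differentiable_continuous /cvgrPdist_lt /(_ _ e2) H2 :=
  ext_differentiable s (x0, y0) (Diffc_prop f0).
exists ([set f | forall p, `|partial s (ext f) p - partial s (ext f0) p| < e / 2],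
   [set p | `|partial s (ext f0) (x0, y0) - partial s (ext f0) p| < e / 2]) => //.
move=> [f [x y]] [/= h1 h2]; rewrite /unc /=.
apply: le_lt_trans (cl _ _) _.
rewrite -(subrK (partial s (ext f0) (x, y)) (partial s (ext f0) (x0, y0))) -addrA.
apply: le_lt_trans (ler_normD _ _) _.
by rewrite (splitr e) ltrD// distrC.
Qed.

Definition ext1 (f : Diffc R) x y : R := (ext f (x, y)).1.
Definition ext2 (f : Diffc R) x y : R := (ext f (x, y)).2.

Lemma partial_cls (c : plane R -> R) k s :
  (forall u v, `|c u - c v| <= `|u - v|) ->
  (forall f s x y,
    drv (fun t => c (partial s (ext f) (t, y))) x (c (partial (ord0 :: s) (ext f) (x, y))) /\
    drv (fun t => c (partial s (ext f) (x, t))) y (c (partial (ord_max :: s) (ext f) (x, y)))) ->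
  cls k (fun (f : Diffc R) x y => c (partial s (ext f) (x, y))).
Proof.
move=> cl cd; elim: k s => [|k IH] s; first by split => //; exact: ext_cont.
apply: (@cls_intro R _ k _ (fun f x y => c (partial (ord0 :: s) (ext f) (x, y)))
  (fun f x y => c (partial (ord_max :: s) (ext f) (x, y)))).
- exact: ext_cont.
- by move=> f x y; have [] := cd f s x y.
- by move=> f x y; have [] := cd f s x y.
- exact: IH.
- exact: IH.
Qed.

Lemma ext_drv (f : Diffc R) s x y :
  [/\ drv (fun t => (partial s (ext f) (t, y)).1) x (partial (ord0 :: s) (ext f) (x, y)).1,
      drv (fun t => (partial s (ext f) (t, y)).2) x (partial (ord0 :: s) (ext f) (x, y)).2,
      drv (fun t => (partial s (ext f) (x, t)).1) y (partial (ord_max :: s) (ext f) (x, y)).1 &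
      drv (fun t => (partial s (ext f) (x, t)).2) y (partial (ord_max :: s) (ext f) (x, y)).2].
Proof. exact: drv_partial (ext_differentiable s (x, y) (Diffc_prop f)). Qed.

(** The tautological family: [Diffc R] parametrizes its own elements. With [ext2_Cinf], this is how
    the C^oo topology feeds the constructions. *)
Lemma ext1_Cinf : Cinf ext1.
Proof.
move=> k; apply: (@partial_cls fst k [::]) => [u v|f s x y]; last by have [] := ext_drv f s x y.
by rewrite le_max lexx.
Qed.

Lemma ext2_Cinf : Cinf ext2.
Proof.
move=> k; apply: (@partial_cls snd k [::]) => [u v|f s x y]; last by have [] := ext_drv f s x y.
by rewrite le_max lexx orbT.
Qed.

Lemma ext_jacobian (f : Diffc R) x y : jacdet ext1 ext2 f x y = 1.
Proof.
rewrite /jacdet; have [d1 d2 d3 d4] := ext_drv f [::] x y.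
rewrite (dx_eq (a := ext1) d1) (dx_eq (a := ext2) d2) (dy_eq (a := ext1) d3) (dy_eq (a := ext2) d4).
have [_ fc fa] := Diffc_prop f.
have [xy|xy] := leP 1 (x ^+ 2 + y ^+ 2).
  rewrite /ext !partial_out// /partial /= !derive_val /coord_vec /=; ring.
have := fa (x, y) (ltW xy) (coord_vec R ord0) (coord_vec R ord_max).
have D := ext_differentiable [::] (x, y) (Diffc_prop f).
have two0 : (2 : R) != 0 by rewrite pnatr_eq0.
rewrite -!deriveE// /area_form /= mulr1 mulr0 subr0 => /(mulfI two0) H.
by rewrite [X in _ - X]mulrC; exact: H.
Qed.

Lemma ext_outside (f : Diffc R) x y : 1 <= x ^+ 2 + y ^+ 2 -> ext1 f x y = x /\ ext2 f x y = y.
Proof.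
move=> xy; have [_ fc _] := Diffc_prop f.
by have := partial_out [::] (p := (x, y)) fc xy; rewrite /ext1 /ext2 /ext /= => ->.
Qed.

Lemma ext_inj (f g : Diffc R) : ext f = ext g -> f = g.
Proof.
move=> fg; apply: val_inj; apply/funext => p; apply: val_inj.
by have := congr1 (fun h => h (set_val p)) fg; rewrite /ext !ext_in.
Qed.

Lemma ext_id_Diffc : ext (id_Diffc R) = id.
Proof. exact: ext_id_id. Qed.

End ExtId.

(** * From families of plane maps to maps into the space of diffeomorphisms *)

Section Realize.
Variables (R : realType) (T : topologicalType).
Variables a1 a2 b1 b2 : T -> R -> R -> R.
Hypothesis a1c : Cinf a1.
Hypothesis a2c : Cinf a2.
Hypothesis b1c : Cinf b1.
Hypothesis b2c : Cinf b2.

(** A bijection of the plane that fixes all points outside the open disc preserves the disc, so it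
    restricts; the second family provides the smooth inverse. *)
Lemma realize l : cancel (pair_map a1 a2 l) (pair_map b1 b2 l) ->
  cancel (pair_map b1 b2 l) (pair_map a1 a2 l) ->
  (forall x y, jacdet a1 a2 l x y = 1) ->
  (exists U : set (plane R), [/\ open U, forall p, 1 <= p.1 ^+ 2 + p.2 ^+ 2 -> U p &
     forall p, U p -> pair_map a1 a2 l p = p]) ->
  exists f : Diffc R, ext f = pair_map a1 a2 l.
Proof.
set A := pair_map a1 a2 l; set B := pair_map b1 b2 l => AB BA J [U [Uo Us UA]].
have dA p : disc R p -> disc R (A p).
  rewrite /disc /= => dp; rewrite leNgt; apply/negP => p1.
  have Ap : A p = p by apply: (can_inj AB); apply: UA; apply: Us; exact: ltW.
  by move: dp; rewrite leNgt -{1 2}Ap p1.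
have dB p : disc R p -> disc R (B p).
  rewrite /disc /= => dp; rewrite leNgt; apply/negP => p1.
  have Bp : B p = p by rewrite -[in RHS](BA p) UA//; apply: Us; exact: ltW.
  by move: dp; rewrite leNgt -{1 2}Bp p1.
pose f (p : disc R) : disc R := SigSub (mem_set (dA _ (set_valP p))).
pose g (p : disc R) : disc R := SigSub (mem_set (dB _ (set_valP p))).
have extf : ext_id f = A.
  apply/funext => p; rewrite /ext_id; case: pselect => //= dp.
  by rewrite UA//; apply: Us; rewrite leNgt; apply/negP => /ltW.
suff fP : area_diff_set R f by exists (SigSub (mem_set fP)).
split.
- exists g; split.
  + by move=> p; apply: val_inj => /=; exact: AB.
  + by move=> p; apply: val_inj => /=; exact: BA.
  + exists setT, A; split=> //; first exact: openT.
    by move=> s p _; exact: differentiable_partial.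
  + exists setT, B; split=> //; first exact: openT.
    by move=> s p _; exact: differentiable_partial.
- exists U; split=> //.
    by move=> p p1; apply: Us; rewrite p1.
  by move=> p Up; apply: val_inj => /=; exact: UA.
- move=> p _ u v; rewrite extf.
  have D := pair_map_is_diff l p a1c a2c.
  rewrite diff_val /area_form /=; have := J p.1 p.2; rewrite /jacdet => Jp.
  rewrite -[u.1 * v.2 - u.2 * v.1]mul1r -Jp; ring.
Qed.

Lemma near_box (a : T -> R -> R -> R) l (e : R) : Cinf a -> 0 < e ->
  \forall m \near l, forall p, disc R p -> `|a m p.1 p.2 - a l p.1 p.2| < e.
Proof.
move=> ac e0.
have K : compact (`[(-1 : R), 1] `*` `[(-1 : R), 1]).
  by apply: compact_setX; exact: segment_compact.
apply: filterS (@compact_tube _ T _ _ (fun m p => a m p.1 p.2) l K _ e e0) => [m H p dp|p _]; last first.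
  exact: cls_cont (ac 0%N) (l, p).
have sq (x y : R) : x ^+ 2 + y ^+ 2 <= 1 -> x \in `[(-1 : R), 1].
  move=> xy; rewrite in_itv /= -ler_norml -(@ler_sqr _ `|x| 1) ?nnegrE// real_normK ?num_real// expr1n.
  by have := sqr_ge0 y; lra.
by apply: H; split => /=; [exact: sq dp|move: dp; rewrite /disc /= addrC; exact: sq].
Qed.

(** The product topology allows one iterated partial at a time; it is jointly continuous and the
    disc is bounded, so it varies uniformly there. *)
Lemma realize_continuous (F : T -> Diffc R) :
  (forall l, ext (F l) = pair_map a1 a2 l) -> continuous F.
Proof.
move=> FE; apply: continuous_comp_initial => l.
apply/cvg_sup => s V [W [[Z Zo <-] /= Zl] WV].
have /uniform_nbhs[E [entE EZ]] := open_nbhs_nbhs (conj Zo Zl).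
move: entE; rewrite -entourage_ballE => -[e /= e0 eE].
rewrite nbhs_simpl /=.
apply: filterS2 (near_box l (iter_partial_Cinf s a1c) e0) (near_box l (iter_partial_Cinf s a2c) e0) => m h1 h2.
apply: WV; apply: EZ => p _; apply: eE => /=.
rewrite -ball_normE /= /jets -!/(ext _) !FE !partial_pair_map//.
have dp : disc R (set_val p) := set_valP p.
rewrite distrC; have := h1 _ dp; have := h2 _ dp => k2 k1.
rewrite /pair_map.
change (Num.max `|iter_partial s a1 m (set_val p).1 (set_val p).2 - iter_partial s a1 l (set_val p).1 (set_val p).2| `|iter_partial s a2 m (set_val p).1 (set_val p).2 - iter_partial s a2 l (set_val p).1 (set_val p).2| < e).
by rewrite gt_max k1 k2.
Qed.

End Realize.

(** * The retraction *)

Section Family.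
Variables (R : realType) (T : topologicalType) (A1 A2 : T -> R -> R -> R).
Hypothesis A1c : Cinf A1.
Hypothesis A2c : Cinf A2.
Let A := pair_map A1 A2.
Hypothesis AJ : forall t x y, jacdet A1 A2 t x y = 1.
Hypothesis Ainj : forall t, injective (A t).
Hypothesis Asurj : forall t p, exists r, A t r = p.
Hypothesis Asupp : forall t, exists U : set (plane R),
  [/\ open U, forall p, 1 <= p.1 ^+ 2 + p.2 ^+ 2 -> U p & forall p, U p -> A t p = p].

Let A_cont : continuous (fun q : T * plane R => A q.1 q.2).
Proof.
move=> q; apply: (@continuous_pair_at _ _ _ (fun q : T * plane R => A1 q.1 q.2.1 q.2.2)
  (fun q : T * plane R => A2 q.1 q.2.1 q.2.2)).
- exact: cls_cont (A1c 0%N) q.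
- exact: cls_cont (A2c 0%N) q.
Qed.

Let A_out t p : 1 <= p.1 ^+ 2 + p.2 ^+ 2 -> A t p = p.
Proof. by move=> p1; have [U [_ Us UA]] := Asupp t; exact/UA/Us. Qed.

(** Preimages of points near [q0.2] stay in a fixed square, since [A] is the identity outside the
    disc. On the compact part [K] of this square away from [r0], injectivity keeps [A] off [q0.2],
    and by compactness this persists for nearby data. *)
Lemma family_inverse_continuous (B : T -> plane R -> plane R) :
  (forall t p, A t (B t p) = p) -> continuous (fun q : T * plane R => B q.1 q.2).
Proof.
move=> AB q0; apply/cvgrPdist_lt => e e0; set r0 := B q0.1 q0.2.
pose N : R := `|q0.2| + 1.
have N1 : 1 <= N by rewrite lerDr.
pose K := (`[(- N), N] `*` `[(- N), N]) `&` [set r : plane R | e <= `|r0 - r|].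
have Kc : compact K.
  apply: compact_closedI; first by apply: compact_setX; exact: segment_compact.
  have c : continuous (fun r : plane R => `|r0 - r|).
    by move=> r; apply: cvg_norm; apply: cvgB; [exact: cvg_cst|exact: cvg_id].
  exact: (continuous_closedP _).1 c _ (@closed_ge R e).
have near1 : \forall q \near q0, forall r, K r -> A q.1 r <> q.2.
  apply: ((compact_near_coveringP K).1 Kc (T * plane R)%type (nbhs q0)
    (fun q r => A q.1 r <> q.2)) => r [_ /= re].
  pose phi (z : plane R * (T * plane R)) : R := `|A z.2.1 z.1 - z.2.2|.
  have phic : continuous phi.
    move=> z; apply: cvg_norm; apply: cvgB.
      apply: (@continuous_comp _ _ _ (fun z : plane R * (T * plane R) => (z.2.1, z.1))
        (fun q : T * plane R => A q.1 q.2)).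
        apply: continuous_pair_at; last exact: cvg_fst.
        by apply: (@continuous_comp _ _ _ snd fst); [exact: cvg_snd|exact: cvg_fst].
      exact: A_cont.
    by apply: (@continuous_comp _ _ _ snd snd); exact: cvg_snd.
  have phi0 : 0 < phi (r, q0).
    rewrite normr_gt0 subr_eq0; apply/eqP => Ar.
    have rr : r = r0 by apply: (@Ainj q0.1); rewrite Ar AB.
    by move: re; rewrite rr subrr normr0 leNgt e0.
  have P : \forall z \near (r, q0), 0 < phi z by exact: (cvgr_gt _ (phic (r, q0))).
  apply: filterS P => -[r' q] /=; rewrite /phi /= normr_gt0 subr_eq0 => /eqP h.
  exact: h.
have near_plane : \forall q \near q0, `|q0.2 - q.2| < 1.
  have s : {for q0, continuous (fun q : T * plane R => q.2)} by exact: cvg_snd.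
  by have /cvgrPdist_lt := s; exact.
apply: filterS2 near1 near_plane => q H1 H2.
rewrite ltNge; apply/negP => He; set r := B q.1 q.2 in He.
apply: (H1 r _ (AB _ _)); split => //.
have rN : `|r.1| <= N /\ `|r.2| <= N.
  have [r1|r1] := leP 1 (r.1 ^+ 2 + r.2 ^+ 2).
    have -> : r = q.2 by rewrite -(A_out q.1 r1) AB.
    have qN : `|q.2| <= N.
      rewrite -(subrK q0.2 q.2) addrC; apply: le_trans (ler_normD _ _) _.
      by rewrite lerD2l distrC ltW.
    by split; apply: le_trans qN; rewrite le_max lexx ?orbT.
  have sq (x y : R) : x ^+ 2 + y ^+ 2 < 1 -> `|x| <= N.
    move=> xy; apply: le_trans N1; rewrite -(@ler_sqr _ `|x| 1) ?nnegrE// real_normK ?num_real// expr1n.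
    by have := sqr_ge0 y; lra.
  by split; [exact: sq r1|apply: (@sq _ r.1); rewrite addrC].
by split => /=; rewrite in_itv /= -ler_norml; case: rN.
Qed.

(** It is the inverses of [A] that are realized: the isotopy starts at the inverse of f, so that its
    inverses start at f. *)
Lemma family_realize : exists F : T -> Diffc R, continuous F /\
  forall t p, ext (F t) (A t p) = p.
Proof.
have [B BP] : exists B : T -> plane R -> plane R, forall t p, A t (B t p) = p.
  have /choice[B BP] : forall q : T * plane R, exists r, A q.1 r = q.2 by move=> q; exact: Asurj.
  by exists (fun t p => B (t, p)) => t p; exact: (BP (t, p)).
have Bc := family_inverse_continuous BP.
pose B1 t x y := (B t (x, y)).1; pose B2 t x y := (B t (x, y)).2.
have e0 (q : T * plane R) : (q.1, (q.2.1, q.2.2)) = q by case: q => t [].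
have c1 : continuous (unc B1).
  rewrite (_ : unc B1 = fst \o (fun q : T * plane R => B q.1 q.2)).
    by move=> q; apply: continuous_comp; [exact: Bc|exact: cvg_fst].
  by apply/funext => -[t [x y]].
have c2 : continuous (unc B2).
  rewrite (_ : unc B2 = snd \o (fun q : T * plane R => B q.1 q.2)).
    by move=> q; apply: continuous_comp; [exact: Bc|exact: cvg_snd].
  by apply/funext => -[t [x y]].
have B12 t x y : (B1 t x y, B2 t x y) = B t (x, y) by rewrite /B1 /B2; case: (B t (x, y)).
have i1 t x y : A1 t (B1 t x y) (B2 t x y) = x.
  by have := congr1 fst (BP t (x, y)); rewrite -B12.
have i2 t x y : A2 t (B1 t x y) (B2 t x y) = y.
  by have := congr1 snd (BP t (x, y)); rewrite -B12.
have [B1c B2c] : Cinf B1 /\ Cinf B2.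
  apply: (cls_inverse A1c A2c c1 c2 i1 i2) => t x y.
  by have := AJ t x y; rewrite /jacdet => ->; exact: oner_neq0.
have BJ t x y : jacdet B1 B2 t x y = 1.
  have := @jacdet_comp R T A1 A2 B1 B2 t x y (A1c 1%N) (A2c 1%N) (B1c 1%N) (B2c 1%N).
  have -> : (fun l x y => A1 l (B1 l x y) (B2 l x y)) = (fun _ x _ => x).
    by apply/funext => l'; apply/funext => x'; apply/funext => y'; exact: i1.
  have -> : (fun l x y => A2 l (B1 l x y) (B2 l x y)) = (fun _ _ y => y).
    by apply/funext => l'; apply/funext => x'; apply/funext => y'; exact: i2.
  by rewrite AJ mul1r /jacdet dx_X dy_X dx_Y dy_Y mul0r subr0 mul1r => <-.
have AB t : cancel (pair_map B1 B2 t) (A t).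
  by move=> [x y]; rewrite /pair_map /= B12 BP.
have BA t : cancel (A t) (pair_map B1 B2 t).
  by move=> p; apply: (@Ainj t); exact: AB.
have real t : exists f : Diffc R, ext f = pair_map B1 B2 t.
  apply: (realize B1c B2c A1c A2c (AB t) (BA t) (BJ t)).
  have [U [Uo Us UA]] := Asupp t; exists U; split => // p Up.
  by rewrite -{1}(UA p Up) BA.
have [F FP] := choice real.
exists F; split; first exact: (@realize_continuous R T B1 B2 B1c B2c F FP).
by move=> t p; rewrite FP BA.
Qed.

End Family.

Section Clamp.
Variable R : realType.

(** Two successive clamped ramps run the dilation and then the isotopy, and make the homotopy
    continuous for all real times. *)
Definition clamp (u : R) : R := Num.max 0 (Num.min 1 u).

Lemma clamp_le0 u : u <= 0 -> clamp u = 0.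
Proof. by move=> u0; rewrite /clamp max_l// ge_min u0 orbT. Qed.

Lemma clamp_ge1 u : 1 <= u -> clamp u = 1.
Proof. by move=> u1; rewrite /clamp min_l// max_r. Qed.

Lemma clamp_ge0 u : 0 <= clamp u.
Proof. by rewrite /clamp le_max lexx. Qed.

Lemma clamp_cont : continuous clamp.
Proof.
move=> u; pose one (z : R) : R^o := 1; pose zero (z : R) : R^o := 0; pose idR (z : R) : R^o := z.
have h : {for u, continuous (zero \max (one \min idR))}.
  by apply: continuous_max; [exact: cvg_cst|apply: continuous_min; [exact: cvg_cst|exact: cvg_id]].
exact: h.
Qed.

Lemma clamp_affine_cont (X : topologicalType) (a b : R) :
  continuous (fun t : R * X => clamp (a * t.1 + b)).
Proof.
move=> t; apply: (@at_fun _ _ (fun t : R * X => a * t.1 + b)); first exact: clamp_cont.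
apply: (@atD _ _ (fun t : R * X => a * t.1) (fun=> b)); last exact: cvg_cst.
by apply: (@atM _ _ (fun=> a) (fun t : R * X => t.1)); [exact: cvg_cst|exact: cvg_fst].
Qed.

End Clamp.

Theorem theorem1p7 (R : realType) :
  strong_deformation_retract R [set id_Diffc R].
Proof.
pose X : topologicalType := Diffc R; pose T : topologicalType := (R * X)%type.
have [G1 [G2 [M [[G1c G2c] Mc GJ [Ginj Gsurj] [Gs Ginv G1id Gtriv]]]]] :=
  @isotopy R X (@ext1 R) (@ext2 R) (@ext1_Cinf R) (@ext2_Cinf R) (@ext_jacobian R) (@ext_outside R).
pose q (t : T) : T := (clamp (2 * t.1 + - 1), t.2).
have qc : continuous q.
  by move=> t; apply: (@continuous_pair_at T R X); [exact: clamp_affine_cont|exact: cvg_snd].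
(* The support of G at the time of q t lies in the disc of radius m t.  On the
   first half of the homotopy q t stays at time 0, where G is f^-1. *)
pose m (t : T) : R := 1 + clamp (2 * t.1 + 0) * (2 + `|M (q t)|).
have mc : continuous m.
  move=> t; apply: (@atD _ _ (fun=> 1) (fun t : T => clamp (2 * t.1 + 0) * (2 + `|M (q t)|))); first exact: cvg_cst.
  apply: (@atM _ _ (fun t : T => clamp (2 * t.1 + 0)) (fun t : T => 2 + `|M (q t)|)); first exact: clamp_affine_cont.
  apply: (@atD _ _ (fun=> 2) (fun t : T => `|M (q t)|)); first exact: cvg_cst.
  by apply: cvg_norm; apply: continuous_comp; [exact: qc|exact: Mc].
have m1 t : 1 <= m t by rewrite lerDl mulr_ge0 ?clamp_ge0// addr_ge0.
have m0 t : m t != 0 by rewrite gt_eqF// (lt_le_trans ltr01).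
have mI t (z : R) : m t * (z / m t) = z by rewrite mulrC divfK.
(* Conjugation by the dilation of ratio [m t] divides the support by [m t] and leaves the Jacobian
   unchanged. *)
pose A1 (t : T) x y := G1 (q t) (m t * x) (m t * y) / m t.
pose A2 (t : T) x y := G2 (q t) (m t * x) (m t * y) / m t.
have mcls k : cls k (fun (t : T) (_ _ : R) => m t) by exact: cls_param.
have mVcls k : cls k (fun (t : T) (_ _ : R) => (m t)^-1) by apply: clsV (mcls k).
have sx k : cls k (fun (t : T) (x _ : R) => m t * x) by apply: clsM (mcls k) (clsX R T k).
have sy k : cls k (fun (t : T) (_ y : R) => m t * y) by apply: clsM (mcls k) (clsY R T k).
have Acls (G : T -> R -> R -> R) : Cinf G -> Cinf (fun t x y => G (q t) (m t * x) (m t * y) / m t).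
  by move=> Gc k; apply: clsM (mVcls k); exact: (cls_comp qc (Gc k) (sx k) (sy k)).
have Adx (G : T -> R -> R -> R) t x y : Cinf G ->
    dx (fun t x y => G (q t) (m t * x) (m t * y) / m t) t x y = dx G (q t) (m t * x) (m t * y) /\
    dy (fun t x y => G (q t) (m t * x) (m t * y) / m t) t x y = dy G (q t) (m t * x) (m t * y).
  move=> Gc; split; [apply: dx_eq|apply: dy_eq].
    have d := @drv_comp R (fun u => G (q t) u (m t * y)) (fun s => m t * s) x _ _
      (cls_dx _ _ _ (Gc 1%N)) (drvZ (m t) (drvI x)).
    by apply: drv_eq (drvM d (drvC (m t)^-1 x)) _; rewrite mulr0 addr0 mulr1 mulfK.
  have d := @drv_comp R (fun u => G (q t) (m t * x) u) (fun s => m t * s) y _ _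
    (cls_dy _ _ _ (Gc 1%N)) (drvZ (m t) (drvI y)).
  by apply: drv_eq (drvM d (drvC (m t)^-1 y)) _; rewrite mulr0 addr0 mulr1 mulfK.
have AJ t x y : jacdet A1 A2 t x y = 1.
  rewrite /jacdet; have [-> ->] := Adx _ t x y G1c; have [-> ->] := Adx _ t x y G2c.
  exact: GJ.
have Ainj t : injective (pair_map A1 A2 t).
  move=> [x y] [x' y'] [e1 e2].
  have h1 := mulIf (invr_neq0 (m0 t)) e1; have h2 := mulIf (invr_neq0 (m0 t)) e2.
  by have [/(mulfI (m0 t)) -> /(mulfI (m0 t)) ->] := Ginj _ _ _ _ _ h1 h2.
have Asurj t p : exists r, pair_map A1 A2 t r = p.
  have [x [y [h1 h2]]] := Gsurj (q t) (m t * p.1) (m t * p.2).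
  exists (x / m t, y / m t); rewrite /pair_map /A1 /A2 /= !mI h1 h2 -!(mulrC _^-1) !mulKf//.
  by case: p {h1 h2}.
have G0 f x y : pair_map G1 G2 (0, f) (ext f (x, y)) = (x, y).
  have [x' [y' [h1 h2]]] := Gsurj (0, f) x y.
  have [k1 k2] := Ginv f x' y'; move: k1 k2; rewrite h1 h2 => k1 k2.
  have -> : ext f (x, y) = (x', y') by rewrite -k1 -k2 /ext1 /ext2; case: (ext f (x, y)).
  by rewrite /pair_map /= h1 h2.
have Gopen t : exists V : set (plane R), [/\ open V,
    forall p, (m t) ^+ 2 <= p.1 ^+ 2 + p.2 ^+ 2 -> V p & forall p, V p -> pair_map G1 G2 (q t) p = p].
  (* On the first half the map is still the inverse of f, supported where f is, and [1 <= m t] is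
     enough. *)
  have [t1|t1] := leP (2 * t.1) 1.
    have qE : q t = (0, t.2) by rewrite /q clamp_le0//; lra.
    have [_ fc _] := Diffc_prop t.2; have [V [Vo Vs Vi]] := ext_near_id fc.
    exists V; split => //.
      move=> p mp; apply: Vs; apply: le_trans mp; rewrite expr_ge1//.
      exact: le_trans ler01 _.
    by move=> [x y] Vp; rewrite qE -{1}(Vi _ Vp); exact: G0.
  have mE : m t = 3 + `|M (q t)| by rewrite /m clamp_ge1; lra.
  pose N := Num.max 1 (M (q t)).
  exists ([set p : plane R | 1 < `|p.1|] `|` ([set p : plane R | p.2 < -1] `|` [set p : plane R | M (q t) < p.2])).
  have c2 : continuous (snd : plane R -> R) by move=> p; exact: cvg_snd.
  have c1 : continuous (fun p : plane R => `|p.1|).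
    by move=> p; apply: cvg_norm; exact: cvg_fst.
  split.
  - apply: openU; first exact: ((continuousP _).1 c1 _ (@open_gt R 1)).
    apply: openU; first exact: ((continuousP _).1 c2 _ (@open_lt R (-1))).
    exact: ((continuousP _).1 c2 _ (@open_gt R (M (q t)))).
  - move=> [x y]; rewrite mE /= => xy.
    have [x1|x1] := ltP 1 `|x|; [by left|right].
    have x2 : x ^+ 2 <= 1 by rewrite -real_normK ?num_real// expr_le1.
    have M0 := normr_ge0 (M (q t)).
    (* [(3 + |M|) ^+ 2 - 1] exceeds [(1 + |M|) ^+ 2]; hence a point with [|x| < 1] beyond the radius
       [m t] is above [M] or below -1, where [G] is the identity. This is the reason for the 2 in
       [m]. *)
    have y2 : (1 + `|M (q t)|) ^+ 2 < `|y| ^+ 2 by rewrite real_normK ?num_real//; nra.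
    have y1 : 1 + `|M (q t)| < `|y| by rewrite -ltr_sqr ?nnegrE// addr_ge0.
    have MM := ler_norm (M (q t)).
    have [y0|y0] := leP 0 y.
      by right => /=; rewrite (ger0_norm y0) in y1; lra.
    by left => /=; rewrite (ltr0_norm y0) in y1; lra.
  - move=> [x y]; rewrite /pair_map /= => H.
    suff h : [\/ 1 <= `|x|, y <= -1 | M (q t) <= y] by have [-> ->] := Gs _ _ _ h.
    by case: H => [/ltW|[/ltW|/ltW]]; [constructor 1|constructor 2|constructor 3].
have Asupp t : exists U : set (plane R),
  [/\ open U, forall p, 1 <= p.1 ^+ 2 + p.2 ^+ 2 -> U p & forall p, U p -> pair_map A1 A2 t p = p].
  have [V [Vo Vs Vi]] := Gopen t.
  have c : continuous (fun p : plane R => (m t * p.1, m t * p.2)).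
    move=> p; apply: (@continuous_pair_at _ _ _ (fun p : plane R => m t * p.1) (fun p : plane R => m t * p.2)).
    - by apply: (@atM _ _ (fun=> m t) (fun p : plane R => p.1)); [exact: cvg_cst|exact: cvg_fst].
    - by apply: (@atM _ _ (fun=> m t) (fun p : plane R => p.2)); [exact: cvg_cst|exact: cvg_snd].
  exists [set p | V (m t * p.1, m t * p.2)]; split.
  - exact: ((continuousP _).1 c _ Vo).
  - move=> p p1; apply: Vs; rewrite /= !exprMn -mulrDr ler_peMr// sqr_ge0//.
  - move=> [x y] /= /Vi [h1 h2]; rewrite /pair_map /A1 /A2 /= h1 h2.
    by rewrite -!(mulrC _^-1) !mulKf.
have [F [Fc FA]] := family_realize (Acls _ G1c) (Acls _ G2c) AJ Ainj Asurj Asupp.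
have Fid t : (forall x y, G1 (q t) x y = x /\ G2 (q t) x y = y) -> F t = id_Diffc R.
  move=> Gid; apply: ext_inj; rewrite ext_id_Diffc; apply/funext => p.
  have Ap : pair_map A1 A2 t p = p.
    rewrite /pair_map /A1 /A2; have [-> ->] := Gid (m t * p.1) (m t * p.2).
    by rewrite -!(mulrC _^-1) !mulKf//; case: p.
  by rewrite -{1}Ap FA.
exists (fun s f => F (s, f)); split.
- apply: continuous_subspaceT.
  by rewrite (_ : (fun _ => _) = F)//; apply/funext => -[].
- move=> f; apply: ext_inj; apply/funext => p.
  have [r rp] := Asurj (0, f) p; rewrite -{1}rp FA.
  (* At time 0 there is neither dilation nor rotation: the map is the inverse of f, and [F] inverts
     it. *)
  have qE : q (0, f) = (0, f) by rewrite /q /= clamp_le0//; lra.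
  have mE : m (0, f) = 1 by rewrite /m /= clamp_le0 ?mul0r ?addr0//; lra.
  have [k1 k2] := Ginv f r.1 r.2.
  rewrite -rp /pair_map /A1 /A2 mE qE !mul1r !divr1.
  move: k1 k2; rewrite /ext1 /ext2; case: (ext f _) => u v /= -> ->.
  by case: r {rp}.
- move=> f; apply: Fid => x y.
  have -> : q (1, f) = (1, f) by rewrite /q /= clamp_ge1//; lra.
  exact: G1id.
- move=> s f _ ->; apply: Fid => x y; apply: Gtriv => u v.
  by rewrite /ext1 ext_id_Diffc.
Qed.
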